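(* Let $r\ge2$ be an integer, $a>0$, $b^{(1)},\dots,b^{(r-1)}\in\mathbb{R}$, $b^{(r)}>0$, and for $m>0$ let $$H_m=\frac{1}{2m}p^2+\frac a2q^2+V(q),\qquad V(q)=b^{(1)}q^2+b^{(2)}q^4+\cdots+b^{(r)}q^{2r},$$ acting in $L^2(\mathbb{R})$ (with $p=-i\,d/dx$, $q$ multiplication by $x$). Let $E_0<E_1<\cdots$ be its eigenvalues, $\Delta_m=\min_{n\in\mathbb{N}}(E_n-E_{n-1})$ its gap parameter and $\mathcal{R}_m=m\Delta_m^2$ its quantum rigidity. Then $\Delta_m$ and $\mathcal{R}_m$ are continuous functions of $m\in(0,\infty)$, and there is $\Delta_0>0$ such that, as $m\to0$, $$\Delta_m\sim\Delta_0\,m^{-r/(r+1)},\qquad \mathcal{R}_m\sim\Delta_0^2\,m^{-(r-1)/(r+1)},$$ where $f\sim g$ means $f/g\to1$.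
   Context: $H_m$ is essentially self-adjoint on $C_0^\infty(\mathbb{R})$, and its spectrum consists of simple eigenvalues only, so the eigenvalues can be listed in increasing order $E_0<E_1<\cdots$. *)

(* Defs.v *)
From Stdlib Require Import Reals Lra.
From Coquelicot Require Import Coquelicot.
Open Scope R_scope.

Definition Vpot (r : nat) (b : nat -> R) (q : R) : R :=
  sum_f_R0 (fun k => b (S k) * q ^ (2 * S k)) (r - 1).

Definition Wpot (r : nat) (a : R) (b : nat -> R) (q : R) : R :=
  a / 2 * q ^ 2 + Vpot r b q.

(* E is an eigenvalue of H_m = p^2/(2m) + (a/2) q^2 + V(q) in L^2(R):
   there is a nonzero, twice differentiable, square-integrable psi with
   - psi''/(2m) + W psi = E psi.  (Real-valued eigenfunctions suffice since
   the coefficients are real.) *)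
Definition is_eigenvalue (r : nat) (a : R) (b : nat -> R) (m E : R) : Prop :=
  exists psi dpsi d2psi : R -> R,
    (forall x, is_derive psi x (dpsi x)) /\
    (forall x, is_derive dpsi x (d2psi x)) /\
    (exists x, psi x <> 0) /\
    ex_RInt_gen (fun x => psi x ^ 2) (Rbar_locally m_infty) (Rbar_locally p_infty) /\
    (forall x, - d2psi x / (2 * m) + Wpot r a b x * psi x = E * psi x).

Definition gap (r : nat) (a : R) (b : nat -> R) (m : R) : R :=
  real (Glb_Rbar (fun g => exists E E',
     is_eigenvalue r a b m E /\ is_eigenvalue r a b m E' /\ E < E' /\
     (forall E'', is_eigenvalue r a b m E'' -> ~ (E < E'' < E')) /\
     g = E' - E)).

Definition rigidity (r : nat) (a : R) (b : nat -> R) (m : R) : R :=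
  m * (gap r a b m) ^ 2.

(* Main.v *)
Require Import Defs.
From Stdlib Require Import Reals Lra Lia Ranalysis5 Arith ClassicalEpsilon.
From Coquelicot Require Import Coquelicot.
Open Scope R_scope.

(** Put [s = m^(1/(r+1))] and rescale [x = y / sqrt s]: the levels of [H_m] are
    [m^(-r/(r+1))] times those of [- 1/2 d^2/dy^2 + U_s], where [U_s] is a polynomial
    depending continuously on [s >= 0], down to [U_0 = b_r y^(2r)].  So both asymptotics
    and continuity reduce to: the minimal gap of the rescaled problem is positive and
    continuous in [s >= 0], including [s = 0].

    For energy [E] let [chi] be the solution decaying at [+oo].  As [U_s] is even, [E]
    is a level iff [chi(0) = 0] or [chi'(0) = 0].  The Wronskian of two such solutions
    at [0] is [2 (E2 - E1) int chi1 chi2], positive for close energies, so levels are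
    simple, alternate in parity, and move continuously with [s].

    Only finitely many gaps matter, because gaps grow with the energy: for an even
    [u] and an odd [v] at levels [E], [E'],
    [u(0) v'(0) = 2 (E' - E) int u v <= 2 |E' - E| |u| |v|], while
    [u'(0)^2 + 2 E u(0)^2 = 2 int U' u^2], and virial identities show
    [int U' u^2 >= kappa E^(3/4) int u^2] when [r >= 2]. *)

(** * Linear equations [u'' = P u] with entire [P] *)

(** The obstacle is the infimum over infinitely many gaps: continuity of each level separately does
    not make it continuous. For neighbouring levels of size E, multiplying the boundary bounds
    u(0)^2 >= kappa E^(-1/4) |u|^2 and v'(0)^2 >= kappa E^(3/4) |v|^2 shows that they are at least
    of order E^(1/4) apart, uniformly for s in a bounded interval. For a quartic potential this is
    the semiclassical order of the gaps, while for a harmonic oscillator they stay constant, which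
    is why the argument asks for r >= 2. The remaining gaps live in a bounded energy window, where
    compactness applies.

    Eigenvalues are defined through the differential equation, so no operator theory enters. The
    solution chi is fixed by the value 1 at a point X beyond which the coefficient is at least 1,
    with the same X for all (E, s) in a bounded box. This avoids a normalization at 0, where chi may
    vanish, and makes chi(0) and chi'(0) continuous in (E, s): levels are zeros of continuous
    functions. *)

Definition entire (f : R -> R) : Prop :=
  exists p : nat -> R, CV_radius p = p_infty /\ forall x, f x = PSeries p x.

(** A finite radius c is contradicted by the bound at max(1, c + 1), so testing [rho >= 1] is
    enough. *)
Lemma CV_radius_infinite (p : nat -> R) :
  (forall rho, 1 <= rho -> exists M, forall n, Rabs (p n * rho ^ n) <= M) ->
  CV_radius p = p_infty.
Proof.
  intros H.
  destruct (CV_radius p) as [c| |] eqn:Hc; [exfalso|reflexivity|exfalso].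
  - destruct (H (Rmax 1 (c + 1)) (Rmax_l _ _)) as [M HM].
    destruct (CV_radius_bounded p) as [Hub _].
    specialize (Hub (Rmax 1 (c + 1)) (ex_intro _ M HM)).
    rewrite Hc in Hub; simpl in Hub.
    pose proof (Rmax_r 1 (c + 1)); lra.
  - pose proof (CV_radius_ge_0 p) as Hp; rewrite Hc in Hp; exact Hp.
Qed.

Lemma entire_const (c : R) : entire (fun _ => c).
Proof.
  exists (fun n => match n with O => c | _ => 0 end); split.
  - apply CV_radius_infinite; intros rho _; exists (Rabs c); intros [|n].
    + simpl; rewrite Rmult_1_r; lra.
    + rewrite Rmult_0_l, Rabs_R0; apply Rabs_pos.
  - intros x; symmetry; apply is_series_unique.
    apply (is_series_ext (fun n => match n with O => c | _ => 0 end)).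
    + intros [|n]; unfold scal; simpl; unfold mult; simpl; ring.
    + apply (filterlim_ext (fun _ => c)); [|apply filterlim_const].
      intros n; induction n as [|n IH].
      * rewrite sum_O; reflexivity.
      * rewrite sum_Sn, <- IH; unfold plus; simpl; ring.
Qed.

Lemma entire_mul_id (f : R -> R) : entire f -> entire (fun x => x * f x).
Proof.
  intros [p [Hp Hf]]; exists (PS_incr_1 p); split.
  - now rewrite CV_radius_incr_1.
  - intros x; now rewrite PSeries_incr_1, Hf.
Qed.

Lemma entire_plus (f g : R -> R) :
  entire f -> entire g -> entire (fun x => f x + g x).
Proof.
  intros [p [Hp Hf]] [q [Hq Hg]]; exists (PS_plus p q); split.
  - pose proof (CV_radius_plus p q) as H; rewrite Hp, Hq in H.
    rewrite (proj2 (Rbar_min_case_strong p_infty p_infty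
      (fun z => z = p_infty /\ z = p_infty) (fun _ => conj eq_refl eq_refl)
      (fun _ => conj eq_refl eq_refl))) in H.
    destruct (CV_radius (PS_plus p q)); simpl in H; tauto.
  - intros x; rewrite PSeries_plus, Hf, Hg; [reflexivity| |];
      apply CV_radius_inside; rewrite ?Hp, ?Hq; exact I.
Qed.

Lemma entire_scal (c : R) (f : R -> R) : entire f -> entire (fun x => c * f x).
Proof.
  intros [p [Hp Hf]].
  destruct (Req_dec c 0) as [->|Hc].
  - destruct (entire_const 0) as [q [Hq Hq']]; exists q; split; trivial.
    intros x; rewrite <- Hq'; ring.
  - exists (PS_scal c p); split.
    + now rewrite CV_radius_scal.
    + intros x; rewrite PSeries_scal, Hf; reflexivity.
Qed.

Lemma entire_pow (n : nat) : entire (fun x => x ^ n).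
Proof.
  induction n as [|n IH]; [exact (entire_const 1)|exact (entire_mul_id _ IH)].
Qed.

Lemma entire_sum (f : nat -> R -> R) (n : nat) :
  (forall k, entire (f k)) -> entire (fun x => sum_f_R0 (fun k => f k x) n).
Proof.
  intros H; induction n as [|n IH]; simpl; [apply H|].
  apply entire_plus; [exact IH|apply H].
Qed.

Definition sol (P u du : R -> R) : Prop :=
  (forall x, is_derive u x (du x)) /\ (forall x, is_derive du x (P x * u x)).

Definition cauchy_step (p : nat -> R) (al be : R) (g : nat -> R) (k : nat) : R :=
  match k with
  | O => al
  | S O => be
  | S (S j) => PS_mult p g j / (INR (S j) * INR (S (S j)))
  end.

(** Each coefficient depends on all earlier ones, so the recursion is not structural. Iterating the
    step on whole sequences avoids this: entry [k] is settled after [k + 1] rounds. *)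
Definition cauchy_iter (p : nat -> R) (al be : R) (n : nat) : nat -> R :=
  Nat.iter n (cauchy_step p al be) (fun _ => 0).

Lemma PS_mult_ext (p g h : nat -> R) (n : nat) :
  (forall k, (k <= n)%nat -> g k = h k) -> PS_mult p g n = PS_mult p h n.
Proof.
  intros H; unfold PS_mult; apply sum_eq; intros i Hi; rewrite H; [ring|lia].
Qed.

Lemma cauchy_iter_stable (p : nat -> R) (al be : R) (k n : nat) :
  (k < n)%nat -> cauchy_iter p al be (S n) k = cauchy_iter p al be n k.
Proof.
  revert n; induction k as [k IH] using (well_founded_induction Nat.lt_wf_0).
  intros [|n] Hk; [lia|].
  change (cauchy_step p al be (cauchy_iter p al be (S n)) k
          = cauchy_step p al be (cauchy_iter p al be n) k).
  destruct k as [|[|k]]; [reflexivity|reflexivity|]; simpl.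
  f_equal; apply PS_mult_ext; intros j Hj; apply IH; lia.
Qed.

Lemma cauchy_iter_stable' (p : nat -> R) (al be : R) (k n : nat) :
  (k < n)%nat -> cauchy_iter p al be n k = cauchy_iter p al be (S k) k.
Proof.
  intros H; induction H as [|n H IH]; [reflexivity|].
  rewrite cauchy_iter_stable; [exact IH|lia].
Qed.

Lemma cauchy_coeffs (p : nat -> R) (al be : R) :
  exists c : nat -> R, c O = al /\ c 1%nat = be /\
    forall n, INR (S n) * INR (S (S n)) * c (S (S n)) = PS_mult p c n.
Proof.
  exists (fun k => cauchy_iter p al be (S k) k); split; [reflexivity|split; [reflexivity|]].
  intros n.
  change (cauchy_iter p al be (S (S (S n))) (S (S n))) with
    (PS_mult p (cauchy_iter p al be (S (S n))) n / (INR (S n) * INR (S (S n)))).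
  rewrite (PS_mult_ext p (cauchy_iter p al be (S (S n)))
             (fun k => cauchy_iter p al be (S k) k)).
  - field; split; apply not_0_INR; lia.
  - intros k Hk; apply cauchy_iter_stable'; lia.
Qed.

Lemma sum_f_R0_le_Series (a : nat -> R) (n : nat) :
  (forall k, 0 <= a k) -> ex_series a -> sum_f_R0 a n <= Series a.
Proof.
  intros Ha [l Hl]; rewrite (is_series_unique _ _ Hl).
  rewrite <- sum_n_Reals.
  refine (is_lim_seq_incr_compare (sum_n a) l Hl _ n).
  intros k; rewrite sum_Sn; unfold plus; simpl; specialize (Ha (S k)); lra.
Qed.

Lemma PS_mult_bound (p c : nat -> R) (rho S0 M : R) (n : nat) :
  0 <= rho -> 0 <= M ->
  sum_f_R0 (fun k => Rabs (p k * rho ^ k)) n <= S0 ->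
  (forall k, (k <= n)%nat -> Rabs (c k * rho ^ k) <= M) ->
  Rabs (PS_mult p c n * rho ^ n) <= S0 * M.
Proof.
  intros Hr HM HS Hc.
  apply Rle_trans with (sum_f_R0 (fun k => Rabs (p k * rho ^ k) * M) n).
  - unfold PS_mult; rewrite (Rmult_comm (sum_f_R0 _ _)), scal_sum.
    eapply Rle_trans; [apply Rsum_abs|].
    apply sum_Rle; intros k Hk.
    replace (p k * c (n - k)%nat * rho ^ n)
      with ((p k * rho ^ k) * (c (n - k)%nat * rho ^ (n - k))).
    + rewrite Rabs_mult; apply Rmult_le_compat_l; [apply Rabs_pos|apply Hc; lia].
    + replace (rho ^ n) with (rho ^ k * rho ^ (n - k)); [ring|].
      rewrite <- pow_add; f_equal; lia.
  - rewrite <- scal_sum, Rmult_comm.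
    apply Rmult_le_compat_r; assumption.
Qed.

(** Beyond the index [N > S0 * rho ^ 2] the division by (n + 1)(n + 2) beats the factor
    [S0 * rho ^ 2] of the convolution bound. Hence a bound [M] for the initial terms, taken as the
    sum of their absolute values, propagates by strong induction. *)
Lemma cauchy_coeffs_radius (p c : nat -> R) :
  CV_radius p = p_infty ->
  (forall n, INR (S n) * INR (S (S n)) * c (S (S n)) = PS_mult p c n) ->
  CV_radius c = p_infty.
Proof.
  intros Hp Hc; apply CV_radius_infinite; intros rho Hrho.
  set (S0 := Series (fun k => Rabs (p k * rho ^ k))).
  assert (Hex : ex_series (fun k => Rabs (p k * rho ^ k))).
  { apply CV_disk_inside; rewrite Hp; exact I. }
  assert (HS : forall n, sum_f_R0 (fun k => Rabs (p k * rho ^ k)) n <= S0).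
  { intros n; apply sum_f_R0_le_Series; [intros; apply Rabs_pos|exact Hex]. }
  destruct (INR_unbounded (S0 * rho ^ 2)) as [N HN].
  set (M := sum_f_R0 (fun k => Rabs (c k * rho ^ k)) (N + 1)).
  assert (HM0 : 0 <= M) by (apply cond_pos_sum; intros; apply Rabs_pos).
  exists M.
  assert (Hinit : forall n, (n <= N + 1)%nat -> Rabs (c n * rho ^ n) <= M).
  { intros n Hn; unfold M; clear -Hn; induction Hn as [|m Hm IH].
    - destruct n; simpl; [lra|].
      pose proof (cond_pos_sum (fun k => Rabs (c k * rho ^ k)) n
                    (fun _ => Rabs_pos _)); simpl in *; lra.
    - rewrite tech5; pose proof (Rabs_pos (c (S m) * rho ^ S m)); lra. }
  intros n; induction n as [n IH] using (well_founded_induction Nat.lt_wf_0).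
  destruct (le_lt_dec n (N + 1)) as [Hn|Hn]; [now apply Hinit|].
  destruct n as [|[|n]]; [lia|lia|].
  assert (Hb : Rabs (PS_mult p c n * rho ^ n) <= S0 * M).
  { apply PS_mult_bound; [lra|exact HM0|apply HS|].
    intros k Hk; apply IH; lia. }
  assert (HNn : INR N <= INR (S n)) by (apply le_INR; lia).
  assert (H2 : 1 <= INR (S (S n))).
  { rewrite S_INR; pose proof (pos_INR (S n)); lra. }
  assert (H1 : 1 <= INR (S n)).
  { rewrite S_INR; pose proof (pos_INR n); lra. }
  assert (Hden : 0 < INR (S n) * INR (S (S n))) by nra.
  apply Rmult_le_reg_l with (INR (S n) * INR (S (S n))); [exact Hden|].
  rewrite <- (Rabs_pos_eq (INR (S n) * INR (S (S n)))) at 1 by lra.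
  rewrite <- Rabs_mult.
  replace (INR (S n) * INR (S (S n)) * (c (S (S n)) * rho ^ S (S n)))
    with (rho ^ 2 * (PS_mult p c n * rho ^ n)).
  2:{ rewrite <- Hc; simpl; ring. }
  rewrite Rabs_mult, (Rabs_pos_eq (rho ^ 2)) by nra.
  apply Rle_trans with (rho ^ 2 * (S0 * M)).
  { apply Rmult_le_compat_l; [nra|exact Hb]. }
  assert (S0 * rho ^ 2 <= INR (S n) * INR (S (S n))) by nra.
  nra.
Qed.

(** The infinite radius of convergence gives the solution on the whole line at once, with no gluing
    of local solutions; this is the purpose of [entire]. *)
Lemma sol_from_zero (P : R -> R) (al be : R) :
  entire P -> exists u du, sol P u du /\ u 0 = al /\ du 0 = be.
Proof.
  intros [p [Hp HP]].
  destruct (cauchy_coeffs p al be) as [c [H0 [H1 Hc]]].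
  pose proof (cauchy_coeffs_radius p c Hp Hc) as Hr.
  exists (PSeries c), (PSeries (PS_derive c)); split; [split|split].
  - intros x; apply is_derive_PSeries; rewrite Hr; exact I.
  - intros x; rewrite HP.
    replace (PSeries p x * PSeries c x)
      with (PSeries (PS_derive (PS_derive c)) x).
    + apply is_derive_PSeries; rewrite CV_radius_derive, Hr; exact I.
    + rewrite <- PSeries_mult by (rewrite ?Hp, ?Hr; exact I).
      apply PSeries_ext; intros n; rewrite <- Hc; unfold PS_derive; ring.
  - rewrite PSeries_0; exact H0.
  - rewrite PSeries_0; unfold PS_derive; rewrite H1; simpl; ring.
Qed.

(** * Uniqueness and dependence on the coefficient *)

Lemma is_derive_continuous (f : R -> R) (x l : R) : is_derive f x l -> continuous f x.
Proof. intros H; apply (ex_derive_continuous f x); now exists l. Qed.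

Lemma derive_mean_value (f df : R -> R) (a b : R) :
  a <= b -> (forall x, a <= x <= b -> is_derive f x (df x)) ->
  exists c, a <= c <= b /\ f b - f a = df c * (b - a).
Proof.
  intros Hab Hf.
  destruct (MVT_gen f a b df) as [c Hc].
  - rewrite Rmin_left, Rmax_right by exact Hab; intros; apply Hf; lra.
  - rewrite Rmin_left, Rmax_right by exact Hab; intros x Hx.
    apply continuity_pt_filterlim, (is_derive_continuous _ _ _ (Hf x Hx)).
  - rewrite Rmin_left, Rmax_right in Hc by exact Hab; exists c; exact Hc.
Qed.

Lemma derive_nonneg_incr (f df : R -> R) (a b : R) :
  a <= b -> (forall x, a <= x <= b -> is_derive f x (df x)) ->
  (forall x, a <= x <= b -> 0 <= df x) -> f a <= f b.
Proof.
  intros Hab Hf Hdf.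
  destruct (derive_mean_value f df a b Hab Hf) as [c [Hc E]].
  specialize (Hdf c Hc); nra.
Qed.

Lemma derive_nonpos_decr (f df : R -> R) (a b : R) :
  a <= b -> (forall x, a <= x <= b -> is_derive f x (df x)) ->
  (forall x, a <= x <= b -> df x <= 0) -> f b <= f a.
Proof.
  intros Hab Hf Hdf.
  destruct (derive_mean_value f df a b Hab Hf) as [c [Hc E]].
  specialize (Hdf c Hc); nra.
Qed.

Lemma exp_le_compat (x y : R) : x <= y -> exp x <= exp y.
Proof. intros [H| ->]; [now apply Rlt_le, exp_increasing|apply Rle_refl]. Qed.

(** The shift [kap] absorbs an inhomogeneous term. The estimate runs in both directions, since (e +
    kap) exp(- L x) decreases and (e + kap) exp(L x) increases; decaying solutions are later
    compared from a far point back towards 0. *)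
Lemma gronwall (e de : R -> R) (a b L kap : R) :
  (forall x, a <= x <= b -> is_derive e x (de x)) ->
  (forall x, a <= x <= b -> Rabs (de x) <= L * (e x + kap)) ->
  forall x y, a <= x <= b -> a <= y <= b ->
  e x + kap <= (e y + kap) * exp (L * Rabs (x - y)).
Proof.
  intros He Hde x y Hx Hy.
  destruct (Rle_dec y x) as [Hyx|Hyx].
  - rewrite Rabs_pos_eq by lra.
    assert (H : (e x + kap) * exp (- L * x) <= (e y + kap) * exp (- L * y)).
    { apply (derive_nonpos_decr (fun t => (e t + kap) * exp (- L * t))
        (fun t => (de t - L * (e t + kap)) * exp (- L * t))); [lra| |].
      - intros t Ht; auto_derive; [exists (de t); apply He; lra|].
        rewrite (is_derive_unique (fun x : R => e x) t (de t)); [ring|apply He; lra].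
      - intros t Ht; assert (Hb := Hde t ltac:(lra)).
        pose proof (Rle_abs (de t)); pose proof (exp_pos (- L * t)); nra. }
    apply Rmult_le_reg_r with (exp (- L * x)); [apply exp_pos|].
    rewrite Rmult_assoc, <- exp_plus.
    replace (L * (x - y) + - L * x) with (- L * y) by ring; exact H.
  - rewrite Rabs_left by lra.
    assert (H : (e x + kap) * exp (L * x) <= (e y + kap) * exp (L * y)).
    { apply (derive_nonneg_incr (fun t => (e t + kap) * exp (L * t))
        (fun t => (de t + L * (e t + kap)) * exp (L * t))); [lra| |].
      - intros t Ht; auto_derive; [exists (de t); apply He; lra|].
        rewrite (is_derive_unique (fun x : R => e x) t (de t)); [ring|apply He; lra].
      - intros t Ht; assert (Hb := Hde t ltac:(lra)).
        pose proof (Rle_abs (- de t)) as Hn; rewrite Rabs_Ropp in Hn.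
        pose proof (exp_pos (L * t)); nra. }
    apply Rmult_le_reg_r with (exp (L * x)); [apply exp_pos|].
    rewrite Rmult_assoc, <- exp_plus.
    replace (L * - (x - y) + L * x) with (L * y) by ring; exact H.
Qed.

Lemma sol_derive_combination (P u du v dv : R -> R) (al be : R) :
  sol P u du -> sol P v dv ->
  sol P (fun x => al * u x + be * v x) (fun x => al * du x + be * dv x).
Proof.
  intros [H1 H2] [H3 H4]; split; intros x.
  - apply (is_derive_plus (fun x => al * u x) (fun x => be * v x));
      apply is_derive_scal; trivial.
  - replace (P x * (al * u x + be * v x))
      with (plus (al * (P x * u x)) (be * (P x * v x)))
      by (unfold plus; simpl; ring).
    apply (is_derive_plus (fun x => al * du x) (fun x => be * dv x));
      apply is_derive_scal; trivial.
Qed.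

Definition wronskian (u du v dv : R -> R) (x : R) : R := u x * dv x - du x * v x.

Lemma wronskian_derive (P Q u du v dv : R -> R) (x : R) :
  sol P u du -> sol Q v dv ->
  is_derive (wronskian u du v dv) x ((Q x - P x) * (u x * v x)).
Proof.
  intros [H1 H2] [H3 H4]; unfold wronskian.
  auto_derive.
  - repeat split; eexists; eauto.
  - rewrite (is_derive_unique (fun x : R => u x) _ _ (H1 x)), (is_derive_unique (fun x : R => du x) _ _ (H2 x)),
      (is_derive_unique (fun x : R => v x) _ _ (H3 x)), (is_derive_unique (fun x : R => dv x) _ _ (H4 x)); ring.
Qed.

Lemma wronskian_const (P u du v dv : R -> R) (x y : R) :
  sol P u du -> sol P v dv -> wronskian u du v dv x = wronskian u du v dv y.
Proof.
  intros Hu Hv.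
  assert (H : forall a b, a <= b -> wronskian u du v dv b = wronskian u du v dv a).
  { intros a b Hab.
    destruct (derive_mean_value (wronskian u du v dv)
                (fun x => (P x - P x) * (u x * v x)) a b Hab) as [c [_ E]].
    - intros; now apply wronskian_derive.
    - replace (P c - P c) with 0 in E by ring; lra. }
  destruct (Rle_dec x y) as [h|h]; [symmetry|]; apply H; lra.
Qed.

(** With d = u - v and z = (P - Q) v, the derivative of [e] is 2 d d' + 2 P d d' + 2 d' z. Bounding
    each product by a sum of squares gives the rate [K + 2], and z^2 <= (eta V)^2 is the shift in
    [gronwall]. *)
Lemma sol_close (P Q u du v dv : R -> R) (a b K eta V : R) :
  sol P u du -> sol Q v dv ->
  (forall x, a <= x <= b -> Rabs (P x) <= K) ->
  (forall x, a <= x <= b -> Rabs (P x - Q x) <= eta) ->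
  (forall x, a <= x <= b -> Rabs (v x) <= V) ->
  let e := fun x => (u x - v x) ^ 2 + (du x - dv x) ^ 2 in
  forall x y, a <= x <= b -> a <= y <= b ->
  e x <= (e y + (eta * V) ^ 2) * exp ((K + 2) * Rabs (x - y)).
Proof.
  intros [H1 H2] [H3 H4] HP HPQ HV e x y Hx Hy.
  apply Rle_trans with (e x + (eta * V) ^ 2).
  { pose proof (pow2_ge_0 (eta * V)); lra. }
  apply (gronwall e (fun t => 2 * (u t - v t) * (du t - dv t)
           + 2 * (du t - dv t) * (P t * u t - Q t * v t)) a b); trivial.
  - intros t _; unfold e.
    auto_derive.
    + repeat split; eexists; eauto.
    + rewrite (is_derive_unique (fun x : R => u x) _ _ (H1 t)), (is_derive_unique (fun x : R => du x) _ _ (H2 t)),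
        (is_derive_unique (fun x : R => v x) _ _ (H3 t)), (is_derive_unique (fun x : R => dv x) _ _ (H4 t)); ring.
  - intros t Ht; unfold e.
    specialize (HP t Ht); specialize (HPQ t Ht); specialize (HV t Ht).
    replace (P t * u t - Q t * v t)
      with (P t * (u t - v t) + (P t - Q t) * v t) by ring.
    set (z := (P t - Q t) * v t).
    assert (Hz : z ^ 2 <= (eta * V) ^ 2).
    { apply pow_maj_Rabs; unfold z; rewrite Rabs_mult.
      apply Rmult_le_compat; trivial; apply Rabs_pos. }
    set (d := u t - v t); set (d' := du t - dv t); fold d d'.
    assert (A1 : Rabs (2 * d * d') <= d ^ 2 + d' ^ 2).
    { pose proof (pow2_ge_0 (d + d')); pose proof (pow2_ge_0 (d - d')).
      apply Rabs_le; split; nra. }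
    assert (A2 : Rabs (2 * d' * z) <= d' ^ 2 + z ^ 2).
    { pose proof (pow2_ge_0 (d' + z)); pose proof (pow2_ge_0 (d' - z)).
      apply Rabs_le; split; nra. }
    assert (A3 : Rabs (P t * (2 * d * d')) <= K * (d ^ 2 + d' ^ 2)).
    { rewrite Rabs_mult; apply Rmult_le_compat; trivial; apply Rabs_pos. }
    replace (2 * d * d' + 2 * d' * (P t * d + z))
      with (2 * d * d' + (P t * (2 * d * d') + 2 * d' * z)) by ring.
    assert (0 <= K) by (pose proof (Rabs_pos (P t)); lra).
    pose proof (Rabs_triang (2 * d * d') (P t * (2 * d * d') + 2 * d' * z)).
    pose proof (Rabs_triang (P t * (2 * d * d')) (2 * d' * z)).
    pose proof (pow2_ge_0 (eta * V)); pose proof (pow2_ge_0 d).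
    nra.
Qed.

Lemma continuous_bounded (f : R -> R) (a b : R) :
  (forall x, a <= x <= b -> continuous f x) ->
  exists K, 0 <= K /\ forall x, a <= x <= b -> Rabs (f x) <= K.
Proof.
  intros Hf; destruct (Rle_dec a b) as [Hab|Hab].
  - destruct (continuity_ab_maj (fun x => Rabs (f x)) a b Hab) as [c [Hc _]].
    + intros x Hx; apply continuity_pt_filterlim.
      apply (continuous_comp f Rabs); [now apply Hf|apply continuous_Rabs].
    + exists (Rabs (f c)); split; [apply Rabs_pos|exact Hc].
  - exists 0; split; [lra|intros; lra].
Qed.

Lemma sol_unique (P u du v dv : R -> R) (y : R) :
  (forall x, continuous P x) -> sol P u du -> sol P v dv ->
  u y = v y -> du y = dv y -> forall x, u x = v x /\ du x = dv x.
Proof.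
  intros HP Hu Hv E1 E2 x.
  destruct (continuous_bounded P (Rmin x y) (Rmax x y)) as [K [_ HK]]; [auto|].
  destruct (continuous_bounded v (Rmin x y) (Rmax x y)) as [V [_ HV]].
  { intros t _; apply (is_derive_continuous _ _ _ (proj1 Hv t)). }
  pose proof (sol_close P P u du v dv _ _ K 0 V Hu Hv HK) as H.
  simpl in H.
  assert (Hx : Rmin x y <= x <= Rmax x y) by (split; [apply Rmin_l|apply Rmax_l]).
  assert (Hy : Rmin x y <= y <= Rmax x y) by (split; [apply Rmin_r|apply Rmax_r]).
  specialize (H (fun t _ => ltac:(rewrite Rminus_diag_eq by reflexivity;
                                  rewrite Rabs_R0; apply Rle_refl)) HV x y Hx Hy).
  rewrite E1, E2 in H.
  replace (((v y - v y) * ((v y - v y) * 1) + (dv y - dv y) * ((dv y - dv y) * 1) +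
         0 * V * (0 * V * 1)) * exp ((K + 2) * Rabs (x - y))) with 0 in H by ring.
  set (p := u x - v x) in H; set (q := du x - dv x) in H.
  pose proof (Rle_0_sqr p); pose proof (Rle_0_sqr q); unfold Rsqr in *.
  split; apply Rminus_diag_uniq, Rsqr_0_uniq; unfold Rsqr; fold p q; lra.
Qed.

(** The two solutions normalized at 0 have Wronskian 1 everywhere, so Cramer's rule at [y] requires
    no division. *)
Lemma sol_exists (P : R -> R) (y al be : R) :
  entire P -> exists u du, sol P u du /\ u y = al /\ du y = be.
Proof.
  intros HP.
  destruct (sol_from_zero P 1 0 HP) as [c [dc [Hc [c0 c1]]]].
  destruct (sol_from_zero P 0 1 HP) as [s [ds [Hs [s0 s1]]]].
  pose proof (wronskian_const P c dc s ds y 0 Hc Hs) as W.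
  unfold wronskian in W; rewrite c0, c1, s0, s1 in W.
  exists (fun x => (al * ds y - be * s y) * c x + (be * c y - al * dc y) * s x).
  exists (fun x => (al * ds y - be * s y) * dc x + (be * c y - al * dc y) * ds x).
  split; [now apply sol_derive_combination|split].
  - transitivity (al * (c y * ds y - dc y * s y)); [ring|rewrite W; ring].
  - transitivity (be * (c y * ds y - dc y * s y)); [ring|rewrite W; ring].
Qed.

Lemma sol_reflect (P u du : R -> R) :
  (forall x, P (- x) = P x) -> sol P u du ->
  sol P (fun x => u (- x)) (fun x => - du (- x)).
Proof.
  intros HP [H1 H2]; split; intros x.
  - replace (- du (- x)) with (scal (-1) (du (- x)))
      by (unfold scal; simpl; unfold mult; simpl; ring).
    apply (is_derive_comp u (fun x => - x)); [apply H1|].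
    auto_derive; [exact I|ring].
  - rewrite <- (HP x).
    replace (P (- x) * u (- x)) with (- (scal (-1) (P (- x) * u (- x))))
      by (unfold scal; simpl; unfold mult; simpl; ring).
    apply (is_derive_opp (fun x => du (- x))).
    apply (is_derive_comp du (fun x => - x)); [apply H2|].
    auto_derive; [exact I|ring].
Qed.

(** * The solution decaying at infinity *)

Lemma sol_continuous (P u du : R -> R) (x : R) :
  sol P u du -> continuous u x /\ continuous du x.
Proof.
  intros [H1 H2]; split; eapply is_derive_continuous; [apply H1|apply H2].
Qed.

Lemma positive_of_nonvanishing (f : R -> R) (a b : R) :
  a <= b -> (forall x, continuous f x) -> 0 < f a ->
  (forall x, a < x <= b -> f x <> 0) -> 0 < f b.
Proof.
  intros Hab Hf Ha Hnz.
  destruct (Rlt_dec 0 (f b)) as [h|h]; [exact h|exfalso].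
  destruct (Req_dec (f b) 0) as [E|E].
  - destruct (Req_dec a b) as [->|hab]; [lra|apply (Hnz b); lra].
  - assert (a <> b) by (intros ->; lra).
    destruct (IVT_interv (fun x => - f x) a b) as [z [Hz Ez]]; [|lra|lra|lra|].
    + intros x _; apply continuity_pt_opp, continuity_pt_filterlim, Hf.
    + assert (a <> z) by (intros ->; lra).
      apply (Hnz z); lra.
Qed.

Lemma sol_nontrivial (P u du : R -> R) (x y : R) :
  (forall t, continuous P t) -> sol P u du ->
  (u y <> 0 \/ du y <> 0) -> u x <> 0 \/ du x <> 0.
Proof.
  intros HP Hu Hy.
  destruct (Req_dec (u x) 0) as [E1|E1]; [|now left].
  destruct (Req_dec (du x) 0) as [E2|E2]; [exfalso|now right].
  assert (H0 : sol P (fun _ => 0) (fun _ => 0)).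
  { split; intros t; [|rewrite Rmult_0_r]; apply (is_derive_const (K := R_AbsRing) 0). }
  destruct (sol_unique P u du _ _ x HP Hu H0 E1 E2 y); tauto.
Qed.

(* The product [u u'] is increasing wherever [P > 0], so neither factor can vanish again. *)
Lemma sol_growing (P u du : R -> R) (X : R) :
  (forall t, continuous P t) -> (forall x, X <= x -> 1 <= P x) -> sol P u du ->
  0 <= u X -> 0 <= du X -> 0 < u X \/ 0 < du X ->
  forall x, X < x -> 0 < u x /\ 0 < du x.
Proof.
  intros HP HP1 Hu Hu0 Hdu0 Hpos.
  assert (Hnt : forall x, u x <> 0 \/ du x <> 0).
  { intros x; apply (sol_nontrivial P u du x X HP Hu); destruct Hpos; [left|right]; lra. }
  assert (Hy : forall x, X < x -> 0 < u x * du x).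
  { intros x Hx.
    destruct (derive_mean_value (fun t => u t * du t)
                (fun t => du t * du t + u t * (P t * u t)) X x) as [c [Hc E]]; [lra| |].
    - intros t _; apply (is_derive_mult u du t (du t) (P t * u t));
        [apply Hu|apply Hu|intros; apply Rmult_comm].
    - assert (0 < du c * du c + u c * (P c * u c)).
      { specialize (HP1 c (proj1 Hc)).
        destruct (Hnt c) as [h|h]; apply Rsqr_pos_lt in h; unfold Rsqr in h;
        pose proof (Rle_0_sqr (u c)); pose proof (Rle_0_sqr (du c)); unfold Rsqr in *; nra. }
      nra. }
  intros x Hx; specialize (Hy x Hx) as Hyx.
  destruct Hpos as [h|h].
  - assert (0 < u x).
    { apply (positive_of_nonvanishing u X x); [lra| |exact h|].
      - intros t; apply (sol_continuous P u du t Hu).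
      - intros t Ht E; specialize (Hy t ltac:(lra)); rewrite E in Hy; lra. }
    split; [assumption|nra].
  - assert (0 < du x).
    { apply (positive_of_nonvanishing du X x); [lra| |exact h|].
      - intros t; apply (sol_continuous P u du t Hu).
      - intros t Ht E; specialize (Hy t ltac:(lra)); rewrite E in Hy; lra. }
    split; [nra|assumption].
Qed.

(** Supplies the unbounded second solution; any component along it will destroy square
    integrability. *)
Lemma sol_growing_linear (P u du : R -> R) (X : R) :
  (forall t, continuous P t) -> (forall x, X <= x -> 1 <= P x) -> sol P u du ->
  u X = 0 -> du X = 1 -> forall x, X <= x -> x - X <= u x /\ 1 <= du x.
Proof.
  intros HP HP1 Hu E0 E1.
  assert (Hd : forall x, X <= x -> 1 <= du x).
  { intros x Hx; rewrite <- E1.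
    apply (derive_nonneg_incr du (fun t => P t * u t)); [exact Hx|intros; apply Hu|].
    intros t Ht; pose proof (HP1 t (proj1 Ht)).
    destruct (Req_dec X t) as [<-|h]; [rewrite E0; lra|].
    destruct (sol_growing P u du X HP HP1 Hu) with (x := t); [lra|lra|lra|lra|nra]. }
  intros x Hx; split; [|now apply Hd].
  destruct (derive_mean_value u du X x Hx) as [c [Hc E]]; [intros; apply Hu|].
  specialize (Hd c (proj1 Hc)); nra.
Qed.

(** The subdominant (Weyl) solution at +oo, described without a limit: where [P >= 1], positivity
    and monotonicity already force exponential decay. It is normalized at [X] because it may vanish
    at 0. *)
Definition dec (P : R -> R) (X : R) (u du : R -> R) : Prop :=
  sol P u du /\ u X = 1 /\ forall x, X <= x -> 0 < u x /\ du x <= 0.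

(* With [A], [B] normalized at [X], [A'/B'] increases, [A/B] decreases and
   [A'/B' < A/B]; any [w] between them makes [A - w B] decay. *)
Lemma dec_exists (P : R -> R) (X : R) :
  entire P -> (forall t, continuous P t) -> (forall x, X <= x -> 1 <= P x) ->
  exists u du, dec P X u du.
Proof.
  intros HE HP HP1.
  destruct (sol_exists P X 1 0 HE) as [A [dA [HA [A0 A1]]]].
  destruct (sol_exists P X 0 1 HE) as [B [dB [HB [B0 B1]]]].
  assert (GA : forall x, X < x -> 0 < A x /\ 0 < dA x)
    by (apply (sol_growing P A dA X HP HP1 HA); lra).
  assert (GB : forall x, X < x -> 0 < B x /\ 0 < dB x)
    by (apply (sol_growing P B dB X HP HP1 HB); lra).
  assert (W : forall x, A x * dB x - dA x * B x = 1).
  { intros x; pose proof (wronskian_const P A dA B dB x X HA HB) as E.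
    unfold wronskian in E; rewrite A0, A1, B0, B1 in E; lra. }
  assert (M1 : forall x y, X < x -> x <= y -> A y / B y <= A x / B x).
  { intros x y Hx Hxy.
    apply (derive_nonpos_decr (fun t => A t / B t)
             (fun t => (dA t * B t - A t * dB t) / B t ^ 2)); [exact Hxy| |].
    - intros t Ht; destruct (GB t ltac:(lra)).
      apply (is_derive_div A B t); [apply HA|apply HB|lra].
    - intros t Ht; destruct (GB t ltac:(lra)).
      replace (dA t * B t - A t * dB t) with (- (1)) by (rewrite <- (W t); ring).
      assert (0 < / B t ^ 2) by (apply Rinv_0_lt_compat; nra).
      unfold Rdiv; lra. }
  assert (M2 : forall x y, X < x -> x <= y -> dA x / dB x <= dA y / dB y).
  { intros x y Hx Hxy.
    apply (derive_nonneg_incr (fun t => dA t / dB t)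
             (fun t => ((P t * A t) * dB t - dA t * (P t * B t)) / dB t ^ 2)); [exact Hxy| |].
    - intros t Ht; destruct (GB t ltac:(lra)).
      apply (is_derive_div dA dB t); [apply HA|apply HB|lra].
    - intros t Ht; destruct (GB t ltac:(lra)).
      replace (P t * A t * dB t - dA t * (P t * B t)) with (P t)
        by (rewrite <- (Rmult_1_r (P t)) at 1; rewrite <- (W t); ring).
      assert (0 < / dB t ^ 2) by (apply Rinv_0_lt_compat; nra).
      specialize (HP1 t ltac:(lra)); unfold Rdiv; nra. }
  assert (M3 : forall x, X < x -> dA x / dB x <= A x / B x).
  { intros x Hx; destruct (GB x Hx); apply Rmult_le_reg_r with (B x * dB x); [nra|].
    field_simplify; [|lra|lra]; specialize (W x); lra. }
  assert (M4 : forall x y, X < x -> X < y -> dA x / dB x <= A y / B y).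
  { intros x y Hx Hy.
    pose proof (Rmax_l x y); pose proof (Rmax_r x y).
    apply Rle_trans with (dA (Rmax x y) / dB (Rmax x y)); [apply M2; lra|].
    apply Rle_trans with (A (Rmax x y) / B (Rmax x y)); [apply M3; lra|apply M1; lra]. }
  destruct (completeness (fun z => exists x, X < x /\ z = dA x / dB x)) as [w [Hw1 Hw2]].
  { exists (A (X + 1) / B (X + 1)); intros z [x [Hx ->]]; apply M4; lra. }
  { exists (dA (X + 1) / dB (X + 1)), (X + 1); split; [lra|reflexivity]. }
  assert (Hdu : forall x, X < x -> dA x - w * dB x <= 0).
  { intros x Hx; destruct (GB x Hx).
    assert (h : dA x / dB x <= w) by (apply Hw1; exists x; now split).
    apply (Rmult_le_compat_r (dB x)) in h; [|lra].
    unfold Rdiv in h; rewrite Rmult_assoc, Rinv_l, Rmult_1_r in h; lra. }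
  assert (Hu : forall x, X < x -> 0 <= A x - w * B x).
  { intros x Hx; destruct (GB x Hx).
    assert (h : w <= A x / B x) by (apply Hw2; intros z [y [Hy ->]]; now apply M4).
    apply (Rmult_le_compat_r (B x)) in h; [|lra].
    unfold Rdiv in h; rewrite Rmult_assoc, Rinv_l, Rmult_1_r in h; lra. }
  exists (fun x => 1 * A x + (- w) * B x), (fun x => 1 * dA x + (- w) * dB x).
  split; [now apply sol_derive_combination|split].
  { rewrite A0, B0; ring. }
  assert (Hw : 0 <= w).
  { apply Rle_trans with (dA (X + 1) / dB (X + 1)).
    - destruct (GA (X + 1)); [lra|]; destruct (GB (X + 1)); [lra|].
      apply Rlt_le, Rdiv_lt_0_compat; assumption.
    - apply Hw1; exists (X + 1); split; [lra|reflexivity]. }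
  intros x Hx; destruct (Req_dec X x) as [<-|hx].
  { rewrite A0, A1, B0, B1; lra. }
  assert (Hx' : X < x) by lra; split; [|specialize (Hdu x Hx'); lra].
  (* A nonnegative nonincreasing function with a zero vanishes from there on; then at some [c] both
     A - w B and its derivative are 0, which contradicts the Wronskian of [A] and [B] being 1. *)
  destruct (Req_dec (A x - w * B x) 0) as [E|E]; [exfalso|specialize (Hu x Hx'); lra].
  destruct (derive_mean_value (fun x => A x - w * B x) (fun x => dA x - w * dB x)
              x (x + 1)) as [c [Hc Ec]]; [lra| |].
  { intros t _.
    apply (is_derive_minus A (fun t => w * B t)); [apply HA|].
    apply is_derive_scal, HB. }
  assert (Ec1 : A c - w * B c <= A x - w * B x).
  { apply (derive_nonpos_decr (fun x => A x - w * B x) (fun x => dA x - w * dB x)); [lra| |].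
    - intros t _; apply (is_derive_minus A (fun t => w * B t)); [apply HA|].
      apply is_derive_scal, HB.
    - intros t Ht; apply Hdu; lra. }
  pose proof (Hu c ltac:(lra)); pose proof (Hu (x + 1) ltac:(lra)).
  pose proof (Hdu c ltac:(lra)).
  assert (F1 : A c - w * B c = 0) by lra.
  assert (F2 : dA c - w * dB c = 0) by nra.
  specialize (W c).
  replace (A c) with (w * B c) in W by lra; replace (dA c) with (w * dB c) in W by lra.
  lra.
Qed.

(** The derivative of (u' + u) exp(- t) is (P - 1) u exp(- t) >= 0. If u' + u were positive
    somewhere it would grow exponentially, although u' <= 0 and u <= 1. *)
Lemma dec_derive_le (P u du : R -> R) (X : R) :
  (forall x, X <= x -> 1 <= P x) -> dec P X u du ->
  forall x, X <= x -> du x <= - u x.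
Proof.
  intros HP [Hu [E Hp]] x Hx.
  destruct (Rle_dec (du x) (- u x)) as [h|h]; [exact h|exfalso].
  set (g := du x + u x); assert (Hg : 0 < g) by (unfold g; lra).
  (* At distance 1/g the growth is already too large: g exp(1/g) > g + 1 > 1 >= u'(y) + u(y). *)
  set (y := x + / g).
  assert (Hy : 0 < / g) by now apply Rinv_0_lt_compat.
  assert (H1 : (du x + u x) * exp (- x) <= (du y + u y) * exp (- y)).
  { apply (derive_nonneg_incr (fun t => (du t + u t) * exp (- t))
             (fun t => (P t * u t - u t) * exp (- t))); [unfold y; lra| |].
    - intros t _; auto_derive.
      + exact (conj (ex_intro _ _ (proj2 Hu t)) (conj (ex_intro _ _ (proj1 Hu t)) I)).
      + rewrite (is_derive_unique (fun x : R => u x) _ _ (proj1 Hu t)),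
          (is_derive_unique (fun x : R => du x) _ _ (proj2 Hu t)); ring.
    - intros t Ht; specialize (HP t ltac:(lra)); destruct (Hp t ltac:(lra)).
      pose proof (exp_pos (- t)); apply Rmult_le_pos; [nra|lra]. }
  fold g in H1.
  assert (H2 : u y <= 1).
  { rewrite <- E; apply (derive_nonpos_decr u du); [unfold y; lra|intros; apply Hu|].
    intros t Ht; apply Hp; lra. }
  destruct (Hp y) as [H3 H4]; [unfold y; lra|].
  assert (H5 : g * exp (/ g) <= du y + u y).
  { apply Rmult_le_reg_r with (exp (- y)); [apply exp_pos|].
    rewrite Rmult_assoc, <- exp_plus.
    replace (/ g + - y) with (- x) by (unfold y; ring); exact H1. }
  pose proof (exp_ineq1 (/ g) ltac:(lra)) as H6.
  assert (g * (1 + / g) < g * exp (/ g)) by (apply Rmult_lt_compat_l; assumption).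
  rewrite Rmult_plus_distr_l, Rinv_r in * by lra; lra.
Qed.

Lemma dec_le_exp (P u du : R -> R) (X : R) :
  (forall x, X <= x -> 1 <= P x) -> dec P X u du ->
  forall x, X <= x -> u x <= exp (- (x - X)).
Proof.
  intros HP Hd x Hx; pose proof (dec_derive_le P u du X HP Hd) as Hdu.
  destruct Hd as [Hu [E Hp]].
  assert (H : u x * exp (x - X) <= u X * exp (X - X)).
  { apply (derive_nonpos_decr (fun t => u t * exp (t - X))
             (fun t => (du t + u t) * exp (t - X))); [exact Hx| |].
    - intros t _; auto_derive.
      + exact (ex_intro _ _ (proj1 Hu t)).
      + rewrite (is_derive_unique (fun x : R => u x) _ _ (proj1 Hu t)); unfold Rminus; ring.
    - intros t Ht; specialize (Hdu t ltac:(lra)); pose proof (exp_pos (t - X)); nra. }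
  replace (X - X) with 0 in H by ring; rewrite E, exp_0 in H.
  apply Rmult_le_reg_r with (exp (x - X)); [apply exp_pos|].
  rewrite <- exp_plus; replace (- (x - X) + (x - X)) with 0 by ring.
  rewrite exp_0; lra.
Qed.

(* By convexity the slope at [x] is at most the drop of [u] over [x - 1, x]. *)
Lemma dec_derive_ge_exp (P u du : R -> R) (X : R) :
  (forall x, X <= x -> 1 <= P x) -> dec P X u du ->
  forall x, X + 1 <= x -> - du x <= exp (- (x - 1 - X)).
Proof.
  intros HP Hd x Hx; pose proof (dec_le_exp P u du X HP Hd (x - 1) ltac:(lra)) as H1.
  destruct Hd as [Hu [E Hp]].
  destruct (derive_mean_value u du (x - 1) x) as [c [Hc Ec]]; [lra|intros; apply Hu|].
  assert (du c <= du x).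
  { apply (derive_nonneg_incr du (fun t => P t * u t)); [lra|intros; apply Hu|].
    intros t Ht; specialize (HP t ltac:(lra)); destruct (Hp t ltac:(lra)); nra. }
  destruct (Hp x ltac:(lra)); lra.
Qed.

Lemma exp_neg_small (eps : R) : 0 < eps -> exists T, 0 <= T /\ forall x, T <= x -> exp (- x) < eps.
Proof.
  intros He; exists (/ eps); split; [now apply Rlt_le, Rinv_0_lt_compat|].
  assert (0 < / eps) by now apply Rinv_0_lt_compat.
  intros x Hx; pose proof (exp_ineq1 x ltac:(lra)).
  rewrite exp_Ropp; apply Rlt_le_trans with (/ / eps); [|rewrite Rinv_inv; lra].
  apply Rinv_lt_contravar; [apply Rmult_lt_0_compat; [assumption|apply exp_pos]|lra].
Qed.

(** Replaces the limit 0 of the Wronskian at infinity: a single far point is all that the arguments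
    by monotonicity need. Each of its two products is kept below [eps / 2]. *)
Lemma wronskian_dec_small (P Q u du v dv : R -> R) (X eps : R) :
  (forall x, X <= x -> 1 <= P x) -> (forall x, X <= x -> 1 <= Q x) ->
  dec P X u du -> dec Q X v dv -> 0 < eps ->
  exists y, X <= y /\ Rabs (wronskian u du v dv y) < eps.
Proof.
  intros HP HQ Hu Hv He.
  destruct (exp_neg_small (eps / 2) ltac:(lra)) as [T [HT0 HT]].
  exists (X + 1 + T); split; [lra|].
  set (y := X + 1 + T).
  assert (Hy : X <= y) by (unfold y; lra).
  pose proof (dec_le_exp P u du X HP Hu y Hy) as A1.
  pose proof (dec_le_exp Q v dv X HQ Hv y Hy) as A2.
  pose proof (dec_derive_ge_exp P u du X HP Hu y ltac:(unfold y; lra)) as A3.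
  pose proof (dec_derive_ge_exp Q v dv X HQ Hv y ltac:(unfold y; lra)) as A4.
  pose proof (HT (y - 1 - X) ltac:(unfold y; lra)) as A5.
  destruct Hu as [_ [_ Hu]]; destruct Hv as [_ [_ Hv]].
  destruct (Hu y Hy) as [B1 B2]; destruct (Hv y Hy) as [B3 B4].
  assert (A6 : exp (- (y - X)) <= 1).
  { rewrite <- exp_0; apply Rlt_le, exp_increasing; unfold y; lra. }
  unfold wronskian; apply Rabs_lt_between; split; nra.
Qed.

(** As both solutions are 1 at [X], the Wronskian there is the difference of slopes, and its
    derivative is (Q - P) u v. One decaying exponential tames the possibly polynomial growth of Q -
    P, the other one integrates to 1. The integration is expressed by monotonicity of the Wronskian
    plus or minus eta exp(- (t - X)). *)
Lemma dec_slope_close (P Q u du v dv : R -> R) (X eta : R) :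
  (forall x, X <= x -> 1 <= P x) -> (forall x, X <= x -> 1 <= Q x) ->
  dec P X u du -> dec Q X v dv ->
  (forall x, X <= x -> Rabs (Q x - P x) * exp (- (x - X)) <= eta) ->
  Rabs (dv X - du X) <= eta.
Proof.
  intros HP HQ Hu Hv Heta.
  assert (HW : wronskian u du v dv X = dv X - du X).
  { unfold wronskian; destruct Hu as [_ [-> _]]; destruct Hv as [_ [-> _]]; ring. }
  assert (Hb : forall x, X <= x ->
     Rabs ((Q x - P x) * (u x * v x)) <= eta * exp (- (x - X))).
  { intros x Hx; specialize (Heta x Hx).
    pose proof (dec_le_exp P u du X HP Hu x Hx) as A1.
    pose proof (dec_le_exp Q v dv X HQ Hv x Hx) as A2.
    destruct Hu as [_ [_ Hu]]; destruct Hv as [_ [_ Hv]].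
    destruct (Hu x Hx) as [B1 _]; destruct (Hv x Hx) as [B3 _].
    pose proof (exp_pos (- (x - X))); pose proof (Rabs_pos (Q x - P x)).
    rewrite Rabs_mult, (Rabs_pos_eq (u x * v x)) by nra.
    apply Rle_trans with (Rabs (Q x - P x) * exp (- (x - X)) * exp (- (x - X))); [|nra].
    rewrite Rmult_assoc; apply Rmult_le_compat_l; [assumption|].
    apply Rmult_le_compat; lra. }
  assert (He : forall x, is_derive (fun t => eta * exp (- (t - X))) x (- (eta * exp (- (x - X))))).
  { intros x; auto_derive; [exact I|unfold Rminus; ring]. }
  pose proof (proj1 Hu) as Hsu; pose proof (proj1 Hv) as Hsv.
  assert (Heta0 : 0 <= eta).
  { specialize (Heta X (Rle_refl X)); pose proof (Rabs_pos (Q X - P X)).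
    pose proof (exp_pos (- (X - X))); nra. }
  rewrite <- HW; destruct (Rle_dec (Rabs (wronskian u du v dv X)) eta) as [h|h]; [exact h|exfalso].
  destruct (wronskian_dec_small P Q u du v dv X (Rabs (wronskian u du v dv X) - eta))
    as [y [Hy Hs]]; trivial; [lra|].
  assert (F1 : wronskian u du v dv y + eta * exp (- (y - X))
               <= wronskian u du v dv X + eta * exp (- (X - X))).
  { apply (derive_nonpos_decr (fun t => wronskian u du v dv t + eta * exp (- (t - X)))
      (fun t => (Q t - P t) * (u t * v t) + - (eta * exp (- (t - X))))); [exact Hy| |].
    - intros t _; apply (is_derive_plus (wronskian u du v dv)); [|apply He].
      now apply wronskian_derive.
    - intros t Ht; specialize (Hb t ltac:(lra)); apply Rabs_le_between in Hb; lra. }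
  assert (F2 : wronskian u du v dv X - eta * exp (- (X - X))
               <= wronskian u du v dv y - eta * exp (- (y - X))).
  { apply (derive_nonneg_incr (fun t => wronskian u du v dv t - eta * exp (- (t - X)))
      (fun t => (Q t - P t) * (u t * v t) - - (eta * exp (- (t - X))))); [exact Hy| |].
    - intros t _; apply (is_derive_minus (wronskian u du v dv)); [|apply He].
      now apply wronskian_derive.
    - intros t Ht; specialize (Hb t ltac:(lra)); apply Rabs_le_between in Hb; lra. }
  replace (- (X - X)) with 0 in F1, F2 by ring; rewrite exp_0 in F1, F2.
  pose proof (exp_pos (- (y - X))).
  assert (0 <= eta * exp (- (y - X))) by (apply Rmult_le_pos; lra).
  apply Rabs_def2 in Hs.
  destruct (Rle_dec 0 (wronskian u du v dv X)) as [k|k];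
    [rewrite (Rabs_pos_eq _ k) in *|rewrite Rabs_left in * by lra]; lra.
Qed.

(** Beyond [X] the Wronskian is nonincreasing and it comes arbitrarily close to 0. *)
Lemma wronskian_dec_nonneg (P Q u du v dv : R -> R) (X : R) :
  (forall x, X <= x -> 1 <= P x) -> (forall x, X <= x -> 1 <= Q x) ->
  dec P X u du -> dec Q X v dv -> (forall x, X <= x -> Q x <= P x) ->
  0 <= wronskian u du v dv X.
Proof.
  intros HP HQ Hu Hv HPQ.
  destruct (Rle_dec 0 (wronskian u du v dv X)) as [h|h]; [exact h|exfalso].
  destruct (wronskian_dec_small P Q u du v dv X (- wronskian u du v dv X))
    as [y [Hy Hs]]; trivial; [lra|].
  assert (wronskian u du v dv y <= wronskian u du v dv X).
  { apply (derive_nonpos_decr _ (fun t => (Q t - P t) * (u t * v t))); [exact Hy| |].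
    - intros t _; now apply wronskian_derive; [apply Hu|apply Hv].
    - intros t Ht; specialize (HPQ t (proj1 Ht)).
      destruct (proj2 (proj2 Hu) t (proj1 Ht)); destruct (proj2 (proj2 Hv) t (proj1 Ht)).
      assert (0 < u t * v t) by (now apply Rmult_lt_0_compat); nra. }
  apply Rabs_def2 in Hs; lra.
Qed.

Lemma dec_unique (P u du v dv : R -> R) (X : R) :
  (forall t, continuous P t) -> (forall x, X <= x -> 1 <= P x) ->
  dec P X u du -> dec P X v dv -> forall x, u x = v x /\ du x = dv x.
Proof.
  intros HP HP1 Hu Hv.
  assert (H : Rabs (dv X - du X) <= 0).
  { apply (dec_slope_close P P u du v dv X 0 HP1 HP1 Hu Hv).
    intros x _; rewrite Rminus_diag_eq, Rabs_R0 by reflexivity; lra. }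
  pose proof (Rabs_pos (dv X - du X)).
  assert (E : dv X - du X = 0).
  { destruct (Req_dec (dv X - du X) 0) as [h|h]; [exact h|].
    apply Rabs_pos_lt in h; lra. }
  destruct Hu as [Su [Eu _]]; destruct Hv as [Sv [Ev _]].
  apply (sol_unique P u du v dv X HP Su Sv); lra.
Qed.

Lemma dec_global_bound (P u du : R -> R) (X : R) :
  0 <= X -> (forall x, X <= x -> 1 <= P x) -> dec P X u du ->
  exists C, 0 <= C /\ forall x, 0 <= x -> Rabs (u x) <= C * exp (- x) /\ Rabs (du x) <= C * exp (- x).
Proof.
  intros HX HP Hd.
  pose proof (dec_le_exp P u du X HP Hd) as E1.
  pose proof (dec_derive_ge_exp P u du X HP Hd) as E2.
  destruct Hd as [Hu [_ Hp]].
  destruct (continuous_bounded u 0 (X + 1)) as [K1 [P1 HK1]].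
  { intros x _; apply (sol_continuous P u du x Hu). }
  destruct (continuous_bounded du 0 (X + 1)) as [K2 [P2 HK2]].
  { intros x _; apply (sol_continuous P u du x Hu). }
  assert (Hm : forall K x, 0 <= K -> 0 <= x <= X + 1 -> K <= K * exp (X + 1) * exp (- x)).
  { intros K x HK Hx; rewrite Rmult_assoc, <- exp_plus.
    rewrite <- (Rmult_1_r K) at 1; apply Rmult_le_compat_l; [exact HK|].
    rewrite <- exp_0 at 1; apply exp_le_compat; lra. }
  exists ((K1 + K2 + 1) * exp (X + 1)).
  pose proof (exp_pos (X + 1)) as Ep; split; [nra|].
  intros x Hx; pose proof (exp_pos (- x)) as Ex.
  destruct (Rle_dec x (X + 1)) as [h|h].
  - pose proof (Hm (K1 + K2 + 1) x ltac:(lra) ltac:(lra)).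
    specialize (HK1 x ltac:(lra)); specialize (HK2 x ltac:(lra)); lra.
  - assert (F : exp (- (x - X)) <= exp (- (x - 1 - X))).
    { apply Rlt_le, exp_increasing; lra. }
    assert (G : exp (- (x - 1 - X)) = exp (X + 1) * exp (- x)).
    { rewrite <- exp_plus; f_equal; ring. }
    specialize (E1 x ltac:(lra)); specialize (E2 x ltac:(lra)).
    destruct (Hp x ltac:(lra)).
    rewrite (Rabs_pos_eq (u x)) by lra; rewrite (Rabs_left1 (du x)) by lra.
    assert (0 < exp (X + 1) * exp (- x)) by (apply Rmult_lt_0_compat; assumption).
    split; nra.
Qed.

(** * Rapidly decaying functions on the half-line *)

(** A class closed under sums and multiplication by powers of x, so that all virial integrands are
    integrable by construction. Bounds are asked on the half-line only, since decaying solutions may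
    explode on the left. *)
Definition fast (f : R -> R) : Prop :=
  (forall x, continuous f x) /\
  forall j : nat, exists C, forall x, 0 <= x -> Rabs (x ^ j * f x) <= C.

Lemma fast_ext (f g : R -> R) : (forall x, f x = g x) -> fast f -> fast g.
Proof.
  intros E [H1 H2]; split.
  - intros x; apply (continuous_ext f g); auto.
  - intros j; destruct (H2 j) as [C HC]; exists C; intros x Hx; rewrite <- E; auto.
Qed.

Lemma fast_plus (f g : R -> R) : fast f -> fast g -> fast (fun x => f x + g x).
Proof.
  intros [H1 H2] [H3 H4]; split.
  - intros x; apply (continuous_plus f g); auto.
  - intros j; destruct (H2 j) as [C HC]; destruct (H4 j) as [D HD]; exists (C + D).
    intros x Hx; specialize (HC x Hx); specialize (HD x Hx).
    rewrite Rmult_plus_distr_l; eapply Rle_trans; [apply Rabs_triang|lra].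
Qed.

Lemma fast_scal (c : R) (f : R -> R) : fast f -> fast (fun x => c * f x).
Proof.
  intros [H1 H2]; split.
  - intros x; apply (continuous_scal_r c f); auto.
  - intros j; destruct (H2 j) as [C HC]; exists (Rabs c * C).
    intros x Hx; specialize (HC x Hx).
    replace (x ^ j * (c * f x)) with (c * (x ^ j * f x)) by ring.
    rewrite Rabs_mult; apply Rmult_le_compat_l; [apply Rabs_pos|exact HC].
Qed.

Lemma fast_minus (f g : R -> R) : fast f -> fast g -> fast (fun x => f x - g x).
Proof.
  intros Hf Hg; apply (fast_ext (fun x => f x + (-1) * g x)); [intros; ring|].
  apply fast_plus; [exact Hf|now apply fast_scal].
Qed.

Lemma fast_pow (n : nat) (f : R -> R) : fast f -> fast (fun x => x ^ n * f x).
Proof.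
  intros [H1 H2]; split.
  - intros x; apply (continuous_mult (fun x => x ^ n) f); [|apply H1].
    apply (ex_derive_continuous (fun x => x ^ n)); auto_derive; exact I.
  - intros j; destruct (H2 (j + n)%nat) as [C HC]; exists C; intros x Hx.
    rewrite <- Rmult_assoc, <- pow_add; auto.
Qed.

Lemma fast_sum (f : nat -> R -> R) (n : nat) :
  (forall k, fast (f k)) -> fast (fun x => sum_f_R0 (fun k => f k x) n).
Proof.
  intros H; induction n as [|n IH]; simpl; [apply H|apply fast_plus; auto].
Qed.

(** One of the two exponentials is spent on x^j through exp x >= x^j / j!, the other one is bounded
    by 1. *)
Lemma fast_mult_exp (f g : R -> R) (C D : R) :
  (forall x, continuous f x) -> (forall x, continuous g x) ->
  (forall x, 0 <= x -> Rabs (f x) <= C * exp (- x)) ->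
  (forall x, 0 <= x -> Rabs (g x) <= D * exp (- x)) ->
  fast (fun x => f x * g x).
Proof.
  intros Cf Cg Hf Hg; split.
  - intros x; apply (continuous_mult f g); auto.
  - intros j; exists (INR (fact j) * C * D); intros x Hx.
    specialize (Hf x Hx); specialize (Hg x Hx).
    assert (Hj : x ^ j <= INR (fact j) * exp x).
    { pose proof (exp_ge_taylor x j Hx) as H.
      assert (H1 : x ^ j / INR (fact j) <= exp x).
      { eapply Rle_trans; [|exact H]. clear -Hx.
        destruct j; [apply Rle_refl|]; rewrite tech5.
        assert (0 <= sum_f_R0 (fun k : nat => x ^ k / INR (fact k)) j).
        { apply cond_pos_sum; intros k; apply Rmult_le_pos; [now apply pow_le|].
          apply Rlt_le, Rinv_0_lt_compat, INR_fact_lt_0. }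
        lra. }
      pose proof (INR_fact_lt_0 j) as Hf0.
      apply (Rmult_le_compat_r (INR (fact j))) in H1; [|lra].
      unfold Rdiv in H1; rewrite Rmult_assoc, Rinv_l, Rmult_1_r in H1 by lra; lra. }
    pose proof (exp_pos (- x)) as E1; pose proof (exp_pos x) as E2.
    assert (E3 : exp x * exp (- x) = 1) by (rewrite <- exp_plus, Rplus_opp_r; apply exp_0).
    assert (E4 : exp (- x) <= 1).
    { rewrite <- exp_0; apply exp_le_compat; lra. }
    pose proof (pow_le x j Hx) as E5; pose proof (INR_fact_lt_0 j).
    pose proof (Rabs_pos (f x)); pose proof (Rabs_pos (g x)).
    assert (0 <= C) by nra; assert (0 <= D) by nra.
    rewrite !Rabs_mult, (Rabs_pos_eq (x ^ j)) by exact E5.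
    apply Rle_trans with ((INR (fact j) * exp x) * ((C * exp (- x)) * (D * exp (- x)))).
    { apply Rmult_le_compat; trivial; [nra|apply Rmult_le_compat; trivial]. }
    replace (INR (fact j) * exp x * (C * exp (- x) * (D * exp (- x))))
      with (INR (fact j) * C * D * (exp x * exp (- x)) * exp (- x)) by ring.
    rewrite E3, Rmult_1_r. rewrite <- (Rmult_1_r (INR (fact j) * C * D)) at 2.
    apply Rmult_le_compat_l; [|exact E4].
    apply Rmult_le_pos; [apply Rmult_le_pos|]; lra.
Qed.

(** The majorant has the explicit primitive - C / (1 + x), which bounds the tails of the
    integral. *)
Lemma fast_inv_square (f : R -> R) :
  fast f -> exists C, 0 <= C /\ forall x, 0 <= x -> Rabs (f x) <= C / (1 + x) ^ 2.
Proof.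
  intros [_ H]; destruct (H 0%nat) as [C0 H0]; destruct (H 1%nat) as [C1 H1];
    destruct (H 2%nat) as [C2 H2].
  assert (HC : forall x, 0 <= x -> Rabs (f x) * (1 + x) ^ 2 <= C0 + 2 * C1 + C2).
  { intros x Hx; specialize (H0 x Hx); specialize (H1 x Hx); specialize (H2 x Hx).
    rewrite Rabs_mult, Rabs_pos_eq in H0, H1, H2 by (now apply pow_le).
    simpl in *; lra. }
  exists (C0 + 2 * C1 + C2); split.
  { specialize (HC 0 (Rle_refl 0)); pose proof (Rabs_pos (f 0)); lra. }
  intros x Hx; specialize (HC x Hx); assert (0 < (1 + x) ^ 2) by nra.
  apply Rmult_le_reg_r with ((1 + x) ^ 2); [assumption|].
  unfold Rdiv; rewrite Rmult_assoc, Rinv_l, Rmult_1_r; lra.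
Qed.

Lemma continuous_ex_RInt (f : R -> R) (a b : R) :
  (forall x, continuous f x) -> ex_RInt f a b.
Proof. intros H; apply (ex_RInt_continuous (V := R_CompleteNormedModule)); auto. Qed.

Lemma fast_RInt_cauchy (f : R -> R) :
  fast f -> exists C, 0 <= C /\ forall a b, 0 <= a -> a <= b -> Rabs (RInt f a b) <= C / (1 + a).
Proof.
  intros Hf; destruct (fast_inv_square f Hf) as [C [HC0 HC]]; exists C; split; [exact HC0|].
  intros a b Ha Hab.
  assert (Hp : is_RInt (fun x => C / (1 + x) ^ 2) a b (- C / (1 + b) - - C / (1 + a))).
  { apply (is_RInt_derive (fun x => - C / (1 + x)) (fun x => C / (1 + x) ^ 2)).
    - intros x Hx; rewrite Rmin_left, Rmax_right in Hx by lra.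
      auto_derive; [lra|field; lra].
    - intros x Hx; rewrite Rmin_left, Rmax_right in Hx by lra.
      apply (ex_derive_continuous (fun x => C / (1 + x) ^ 2)); auto_derive.
      assert (0 < (1 + x) * ((1 + x) * 1)) by nra; simpl; lra. }
  apply Rle_trans with (RInt (fun x => C / (1 + x) ^ 2) a b).
  - eapply Rle_trans; [apply abs_RInt_le; [exact Hab|now apply continuous_ex_RInt, Hf]|].
    apply RInt_le; [exact Hab| | |].
    + apply continuous_ex_RInt; intros x; apply (continuous_comp f Rabs);
        [apply Hf|apply continuous_Rabs].
    + eexists; exact Hp.
    + intros x Hx; apply HC; lra.
  - rewrite (is_RInt_unique _ _ _ _ Hp).
    assert (0 <= C / (1 + b)) by (apply Rmult_le_pos; [lra|apply Rlt_le, Rinv_0_lt_compat; lra]).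
    unfold Rdiv in *; lra.
Qed.

(** The integral over the half-line, made total by [real]; [J_correct] gives it its meaning on
    [fast] functions. *)
Definition J (f : R -> R) : R := real (Lim (fun b => RInt f 0 b) p_infty).

Lemma inv_small (C eps : R) : 0 <= C -> 0 < eps -> exists T, 0 <= T /\ forall a, T <= a -> C / (1 + a) < eps.
Proof.
  intros HC He; exists (C / eps); split; [apply Rmult_le_pos; [lra|apply Rlt_le, Rinv_0_lt_compat; lra]|].
  intros a Ha.
  assert (H0 : 0 <= C / eps) by (apply Rmult_le_pos; [lra|apply Rlt_le, Rinv_0_lt_compat; lra]).
  assert (H1 : C = C / eps * eps) by (field; lra).
  apply Rmult_lt_reg_r with (1 + a); [lra|].
  unfold Rdiv at 1; rewrite Rmult_assoc, Rinv_l, Rmult_1_r by lra; nra.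
Qed.

Lemma J_correct (f : R -> R) : fast f -> is_lim (fun b => RInt f 0 b) p_infty (J f).
Proof.
  intros Hf.
  destruct (proj1 (filterlim_locally_cauchy (F := Rbar_locally' p_infty) (fun b => RInt f 0 b)))
    as [l Hl].
  - intros eps; destruct (fast_RInt_cauchy f Hf) as [C [HC0 HC]].
    destruct (inv_small C eps HC0 (cond_pos eps)) as [T [HT0 HT]].
    exists (fun b => T < b); split; [exists T; trivial|].
    assert (H : forall u v, T < u -> u <= v -> Rabs (RInt f 0 v - RInt f 0 u) < eps).
    { intros u v Hu Huv.
      rewrite <- (RInt_Chasles f 0 u v) by (now apply continuous_ex_RInt, Hf).
      assert (E : forall p q : R, plus p q - p = q) by (intros; unfold plus; simpl; ring).
      rewrite E; eapply Rle_lt_trans; [apply HC; lra|apply HT; lra]. }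
    intros u v Hu Hv; destruct (Rle_dec u v) as [h|h].
    + apply H; trivial.
    + apply ball_sym, H; [exact Hv|lra].
  - assert (HL : is_lim (fun b => RInt f 0 b) p_infty l) by exact Hl.
    unfold J; rewrite (is_lim_unique _ _ _ HL); exact HL.
Qed.

Lemma J_unique (f : R -> R) (l : R) : is_lim (fun b => RInt f 0 b) p_infty l -> J f = l.
Proof. intros H; unfold J; now rewrite (is_lim_unique _ _ _ H). Qed.

Lemma J_ext (f g : R -> R) : (forall x, f x = g x) -> J f = J g.
Proof.
  intros E; unfold J; f_equal; apply Lim_ext; intros b; apply RInt_ext; auto.
Qed.

Lemma J_plus (f g : R -> R) : fast f -> fast g -> J (fun x => f x + g x) = J f + J g.
Proof.
  intros Hf Hg; apply J_unique.
  apply (is_lim_ext (fun b => RInt f 0 b + RInt g 0 b)).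
  - intros b; symmetry; apply (RInt_plus f g); now apply continuous_ex_RInt, Hf || apply continuous_ex_RInt, Hg.
  - apply (is_lim_plus _ _ p_infty (J f) (J g)); [now apply J_correct|now apply J_correct|reflexivity].
Qed.

Lemma J_scal (c : R) (f : R -> R) : fast f -> J (fun x => c * f x) = c * J f.
Proof.
  intros Hf; apply J_unique.
  apply (is_lim_ext (fun b => c * RInt f 0 b)).
  - intros b; symmetry; apply (RInt_scal f); now apply continuous_ex_RInt, Hf.
  - apply (is_lim_scal_l _ c p_infty (J f)), J_correct, Hf.
Qed.

Lemma J_minus (f g : R -> R) : fast f -> fast g -> J (fun x => f x - g x) = J f - J g.
Proof.
  intros Hf Hg; rewrite (J_ext _ (fun x => f x + (-1) * g x)) by (intros; ring).
  rewrite J_plus, J_scal; trivial; [ring|now apply fast_scal].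
Qed.

Lemma J_le (f g : R -> R) :
  fast f -> fast g -> (forall x, 0 <= x -> f x <= g x) -> J f <= J g.
Proof.
  intros Hf Hg H.
  refine (is_lim_le_loc (fun b => RInt f 0 b) (fun b => RInt g 0 b) p_infty (J f) (J g)
            _ (J_correct f Hf) (J_correct g Hg)).
  exists 0; intros b Hb; apply RInt_le; [lra|now apply continuous_ex_RInt, Hf|
    now apply continuous_ex_RInt, Hg|intros x Hx; apply H; lra].
Qed.

Lemma J_nonneg (f : R -> R) : fast f -> (forall x, 0 <= x -> 0 <= f x) -> 0 <= J f.
Proof.
  intros Hf H; replace 0 with (0 * J f) by ring; rewrite <- J_scal by exact Hf.
  apply J_le; [now apply fast_scal|exact Hf|intros x Hx; specialize (H x Hx); lra].
Qed.

Lemma fast_lim0 (f : R -> R) : fast f -> is_lim f p_infty 0.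
Proof.
  intros [_ H]; destruct (H 1%nat) as [C HC].
  assert (HC0 : 0 <= C) by (specialize (HC 0 (Rle_refl 0)); pose proof (Rabs_pos (0 ^ 1 * f 0)); lra).
  intros P [eps HP]; exists (C / eps + 1); intros x Hx; apply HP.
  pose proof (cond_pos eps) as He.
  assert (0 <= C / eps) by (apply Rmult_le_pos; [lra|apply Rlt_le, Rinv_0_lt_compat; lra]).
  assert (H1 : C = C / eps * eps) by (field; lra).
  specialize (HC x ltac:(lra)).
  rewrite Rabs_mult, pow_1, Rabs_pos_eq in HC by lra.
  change (Rabs (f x - 0) < eps); rewrite Rminus_0_r.
  apply Rmult_lt_reg_l with x; [lra|].
  eapply Rle_lt_trans; [exact HC|]; rewrite H1; nra.
Qed.

(** Every virial identity below is one instance of this, obtained by choosing [G]. *)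
Lemma J_derive (G g : R -> R) :
  (forall x, is_derive G x (g x)) -> fast G -> fast g -> J g = - G 0.
Proof.
  intros HG HG0 Hg; apply J_unique.
  apply (is_lim_ext (fun b => G b - G 0)).
  - intros b; symmetry; apply is_RInt_unique.
    apply (is_RInt_derive G g); [intros; apply HG|intros; apply Hg].
  - replace (Finite (- G 0)) with (Rbar_minus 0 (G 0))
      by (simpl; f_equal; ring).
    apply (is_lim_minus _ _ p_infty 0 (G 0));
      [now apply fast_lim0|apply is_lim_const|reflexivity].
Qed.

Lemma RInt_pos_at (f : R -> R) (a b c : R) :
  a < b -> (forall x, continuous f x) -> (forall x, a <= x <= b -> 0 <= f x) ->
  a <= c <= b -> 0 < f c -> 0 < RInt f a b.
Proof.
  intros Hab Cf Hf Hc Hfc.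
  destruct (Cf c (fun y => f c / 2 < y)) as [d Hd].
  { exists (mkposreal (f c / 2) ltac:(lra)); intros y Hy.
    apply Rabs_def2 in Hy; simpl in Hy; unfold minus, plus, opp in Hy; simpl in Hy; lra. }
  assert (H : exists p q, a <= p /\ p < q /\ q <= b /\ forall x, p < x < q -> 0 < f x).
  { pose proof (cond_pos d).
    exists (Rmax a (c - d / 2)), (Rmin b (c + d / 2)).
    assert (Rmax a (c - d / 2) < Rmin b (c + d / 2)).
    { unfold Rmax, Rmin; destruct Rle_dec; destruct Rle_dec; lra. }
    split; [apply Rmax_l|split; [assumption|split; [apply Rmin_l|]]].
    intros x [H1 H2]; pose proof (Rmax_r a (c - d / 2)); pose proof (Rmin_r b (c + d / 2)).
    assert (f c / 2 < f x); [|lra].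
    apply Hd; change (Rabs (x - c) < d); apply Rabs_def1; lra. }
  destruct H as [p [q [H1 [H2 [H3 H4]]]]].
  assert (Ex : forall u v, ex_RInt f u v) by (intros; now apply continuous_ex_RInt).
  rewrite <- (RInt_Chasles f a p b), <- (RInt_Chasles f p q b) by apply Ex.
  unfold plus; simpl.
  assert (0 <= RInt f a p) by (apply RInt_ge_0; [lra|apply Ex|intros; apply Hf; lra]).
  assert (0 <= RInt f q b) by (apply RInt_ge_0; [lra|apply Ex|intros; apply Hf; lra]).
  assert (0 < RInt f p q) by (apply RInt_gt_0; [exact H2|exact H4|intros; apply Cf]).
  lra.
Qed.

Lemma J_pos (f : R -> R) (c : R) :
  fast f -> (forall x, 0 <= x -> 0 <= f x) -> 0 <= c -> 0 < f c -> 0 < J f.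
Proof.
  intros Hf H0 Hc Hfc.
  assert (H : 0 < RInt f 0 (c + 1)).
  { apply (RInt_pos_at f 0 (c + 1) c); [lra|apply Hf|intros; apply H0; lra|lra|exact Hfc]. }
  eapply Rlt_le_trans; [exact H|].
  refine (is_lim_le_loc (fun _ => RInt f 0 (c + 1)) (fun b => RInt f 0 b) p_infty
            (RInt f 0 (c + 1)) (J f) _ (is_lim_const _ _) (J_correct f Hf)).
  exists (c + 1); intros b Hb.
  rewrite <- (RInt_Chasles f 0 (c + 1) b) by (now apply continuous_ex_RInt, Hf).
  unfold plus; simpl.
  assert (0 <= RInt f (c + 1) b)
    by (apply RInt_ge_0; [lra|now apply continuous_ex_RInt, Hf|intros; apply H0; lra]).
  lra.
Qed.

(** * Square-integrable solutions *)

Definition L2_line (f : R -> R) : Prop :=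
  ex_RInt_gen (fun x => f x ^ 2) (Rbar_locally m_infty) (Rbar_locally p_infty).

(** Equivalently, 0 is an eigenvalue of - d^2/dx^2 + P. With mass and energy absorbed in [P],
    rescaling acts on a single function. *)
Definition singular (P : R -> R) : Prop :=
  exists psi dpsi : R -> R, sol P psi dpsi /\ (exists x, psi x <> 0) /\ L2_line psi.

(** Convergence would put the integrals over all large intervals within 1 of the limit, whereas
    lengthening an interval by 2 on the bad side adds at least 2. *)
Lemma not_ex_RInt_gen (f : R -> R) :
  (forall x, continuous f x) ->
  (exists x1, forall x, x1 <= x -> 1 <= f x) \/ (exists x1, forall x, x <= x1 -> 1 <= f x) ->
  ~ ex_RInt_gen f (Rbar_locally m_infty) (Rbar_locally p_infty).
Proof.
  intros Cf Hf [l Hl].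
  destruct (Hl (fun y => ball l 1 y)) as [S1 S2 [M1 HM1] [M2 HM2] HS].
  { exists (mkposreal 1 Rlt_0_1); trivial. }
  assert (Hclose : forall a b, a < M1 -> M2 < b -> Rabs (RInt f a b - l) < 1).
  { intros a b Ha Hb; destruct (HS a b (HM1 a Ha) (HM2 b Hb)) as [y [Hy1 Hy2]].
    simpl in Hy1; rewrite (is_RInt_unique _ _ _ _ Hy1); exact Hy2. }
  assert (Ex : forall a b, ex_RInt f a b) by (intros; now apply continuous_ex_RInt).
  assert (Hlow : forall a, (forall x, a <= x <= a + 2 -> 1 <= f x) -> 2 <= RInt f a (a + 2)).
  { intros a Ha.
    replace 2 with (RInt (fun _ => 1) a (a + 2)) at 1
      by (rewrite RInt_const; unfold scal; simpl; unfold mult; simpl; ring).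
    apply RInt_le; [lra|apply ex_RInt_const|apply Ex|intros x Hx; apply Ha; lra]. }
  destruct Hf as [[x1 Hx1]|[x1 Hx1]].
  - set (b := Rmax M2 x1 + 1); set (a := M1 - 1).
    pose proof (Rmax_l M2 x1); pose proof (Rmax_r M2 x1).
    pose proof (Hclose a b ltac:(unfold a; lra) ltac:(unfold b; lra)) as H1.
    pose proof (Hclose a (b + 2) ltac:(unfold a; lra) ltac:(unfold b; lra)) as H2.
    rewrite <- (RInt_Chasles f a b (b + 2)) in H2 by apply Ex.
    specialize (Hlow b ltac:(intros; apply Hx1; unfold b in *; lra)).
    apply Rabs_def2 in H1; apply Rabs_def2 in H2; unfold plus in H2; simpl in H2; lra.
  - set (b := M2 + 1); set (a := Rmin M1 x1 - 3).
    pose proof (Rmin_l M1 x1); pose proof (Rmin_r M1 x1).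
    pose proof (Hclose a b ltac:(unfold a; lra) ltac:(unfold b; lra)) as H1.
    pose proof (Hclose (a + 2) b ltac:(unfold a; lra) ltac:(unfold b; lra)) as H2.
    rewrite <- (RInt_Chasles f a (a + 2) b) in H1 by apply Ex.
    specialize (Hlow a ltac:(intros; apply Hx1; unfold a in *; lra)).
    apply Rabs_def2 in H1; apply Rabs_def2 in H2; unfold plus in H1; simpl in H1; lra.
Qed.

Lemma RInt_even (f : R -> R) (a : R) :
  (forall x, continuous f x) -> (forall x, f (- x) = f x) -> RInt f a 0 = RInt f 0 (- a).
Proof.
  intros Cf Hf; apply is_RInt_unique.
  assert (H : is_RInt f (- 0) (- a) (RInt f 0 (- a))).
  { rewrite Ropp_0; apply (RInt_correct f); now apply continuous_ex_RInt. }
  apply is_RInt_comp_opp, is_RInt_swap, is_RInt_opp in H.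
  rewrite opp_opp in H; revert H; apply is_RInt_ext.
  intros x _; rewrite opp_opp; apply Hf.
Qed.

Lemma fast_even_ex_RInt_gen (f : R -> R) :
  fast f -> (forall x, f (- x) = f x) ->
  ex_RInt_gen f (Rbar_locally m_infty) (Rbar_locally p_infty).
Proof.
  intros Hf He; exists (J f + J f).
  pose proof (J_correct f Hf) as HJ.
  assert (Cf : forall x, continuous f x) by apply Hf.
  assert (Ex : forall a b, ex_RInt f a b) by (intros; now apply continuous_ex_RInt).
  intros P [eps HP].
  destruct (HJ (fun y => Rabs (y - J f) < eps / 2)) as [M HM].
  { exists (mkposreal (eps / 2) ltac:(pose proof (cond_pos eps); lra)); trivial. }
  apply (Filter_prod _ _ _ (fun a => a < - M) (fun b => M < b)).
  - exists (- M); trivial.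
  - exists M; trivial.
  - intros a b Ha Hb; exists (RInt f a b); split; [apply (RInt_correct f), Ex|].
    apply HP; change (Rabs (RInt f a b - (J f + J f)) < eps).
    rewrite <- (RInt_Chasles f a 0 b), RInt_even by (trivial; apply Ex).
    pose proof (HM (- a) ltac:(lra)) as H1; pose proof (HM b Hb) as H2.
    apply Rabs_def2 in H1; apply Rabs_def2 in H2; simpl in H1, H2.
    unfold plus; simpl; apply Rabs_def1; lra.
Qed.

(* Any other solution picks up a component growing at least linearly. *)
Lemma bounded_sol_is_dec (P u du v dv : R -> R) (X : R) :
  entire P -> (forall t, continuous P t) -> (forall x, X <= x -> 1 <= P x) ->
  dec P X u du -> sol P v dv ->
  ~ (exists x1, forall x, x1 <= x -> 1 <= v x ^ 2) ->
  forall x, v x = v X * u x /\ dv x = v X * du x.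
Proof.
  intros HE HP HP1 [Hu [Eu Hp]] Hv Hn.
  destruct (sol_exists P X 0 1 HE) as [B [dB [HB [B0 B1]]]].
  set (be := dv X - v X * du X).
  assert (H : forall x, v x = v X * u x + be * B x /\ dv x = v X * du x + be * dB x).
  { apply (sol_unique P v dv _ _ X HP Hv (sol_derive_combination P u du B dB (v X) be Hu HB)).
    - rewrite Eu, B0; ring.
    - rewrite B1; unfold be; ring. }
  destruct (Req_dec be 0) as [E|E].
  { intros x; destruct (H x) as [-> ->]; rewrite E; split; ring. }
  (* From this point on the growing part is at least 1 + |v(X)| in size, while the decaying part is
     at most |v(X)|. *)
  exfalso; apply Hn; exists (X + (1 + Rabs (v X)) / Rabs be).
  intros x Hx; destruct (H x) as [-> _].
  assert (Hb : 0 < Rabs be) by now apply Rabs_pos_lt.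
  pose proof (Rabs_pos (v X)) as Hv0.
  assert (H0 : 0 <= (1 + Rabs (v X)) / Rabs be)
    by (apply Rmult_le_pos; [lra|now apply Rlt_le, Rinv_0_lt_compat]).
  assert (HxX : X <= x) by lra.
  destruct (sol_growing_linear P B dB X HP HP1 HB B0 B1 x HxX) as [HBx _].
  assert (Hux : u x <= 1).
  { rewrite <- Eu; apply (derive_nonpos_decr u du); [exact HxX|intros; apply Hu|].
    intros t Ht; apply Hp; lra. }
  destruct (Hp x HxX) as [Hux0 _].
  assert (H1 : 1 + Rabs (v X) <= Rabs be * B x).
  { apply Rle_trans with (Rabs be * ((1 + Rabs (v X)) / Rabs be)); [right; field; lra|].
    apply Rmult_le_compat_l; lra. }
  assert (H2 : 1 <= Rabs (v X * u x + be * B x)).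
  { pose proof (Rabs_triang_inv (be * B x) (- (v X * u x))) as T.
    replace (be * B x - - (v X * u x)) with (v X * u x + be * B x) in T by ring.
    rewrite Rabs_Ropp, !Rabs_mult, (Rabs_pos_eq (u x)), (Rabs_pos_eq (B x)) in T by lra.
    assert (Rabs (v X) * u x <= Rabs (v X)) by nra; lra. }
  rewrite <- pow2_abs; nra.
Qed.

(** A square-integrable solution and its reflection are both multiples of [u]. Comparing values at 0
    gives equal factors unless u(0) = 0, and comparing slopes then gives u'(0) = 0. Conversely
    either condition gives [u] a parity, so its decay on the right holds on the left too. *)
Lemma singular_iff (P u du : R -> R) (X : R) :
  entire P -> (forall t, continuous P t) -> (forall x, P (- x) = P x) ->
  0 <= X -> (forall x, X <= x -> 1 <= P x) -> dec P X u du ->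
  singular P <-> u 0 = 0 \/ du 0 = 0.
Proof.
  intros HE HP Heven HX HP1 Hdec; split.
  - intros [v [dv [Hv [[x0 Hx0] HL]]]].
    assert (Cv : forall x, continuous (fun x => v x ^ 2) x).
    { intros x; apply (ex_derive_continuous (fun x => v x ^ 2)); auto_derive.
      exact (ex_intro _ _ (proj1 Hv x)). }
    assert (R1 : forall x, v x = v X * u x /\ dv x = v X * du x).
    { apply (bounded_sol_is_dec P u du v dv X HE HP HP1 Hdec Hv).
      intros H; exact (not_ex_RInt_gen _ Cv (or_introl H) HL). }
    assert (R2 : forall x, v (- x) = v (- X) * u x /\ - dv (- x) = v (- X) * du x).
    { apply (bounded_sol_is_dec P u du (fun x => v (- x)) (fun x => - dv (- x)) X HE HP HP1 Hdec
               (sol_reflect P v dv Heven Hv)).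
      intros [x1 H]; apply (not_ex_RInt_gen _ Cv); [right|exact HL].
      exists (- x1); intros x Hx; specialize (H (- x) ltac:(lra)); now rewrite Ropp_involutive in H. }
    destruct (Req_dec (u 0) 0) as [h|h]; [now left|right].
    destruct (R1 0) as [E1 E2]; destruct (R2 0) as [E3 E4]; rewrite Ropp_0 in E3, E4.
    assert (E5 : v X = v (- X)) by (apply Rmult_eq_reg_r with (u 0); [lra|exact h]).
    assert (E6 : v X * du 0 = 0) by (rewrite <- E5 in E4; lra).
    apply Rmult_integral in E6; destruct E6 as [E6|E6]; [exfalso|exact E6].
    apply Hx0; destruct (R1 x0) as [-> _]; rewrite E6; ring.
  - intros H0.
    destruct (dec_global_bound P u du X HX HP1 Hdec) as [C [HC Hb]].
    pose proof (proj1 Hdec) as Hu.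
    assert (Hev : forall x, u (- x) ^ 2 = u x ^ 2).
    { pose proof (sol_reflect P u du Heven Hu) as Hr.
      intros x; destruct H0 as [H0|H0].
      - pose proof (sol_derive_combination P _ _ _ _ (-1) 0 Hr Hr) as Hr'.
        destruct (sol_unique P _ _ _ _ 0 HP Hr' Hu) with (x := x) as [E _].
        + rewrite Ropp_0, H0; ring.
        + rewrite Ropp_0; ring.
        + rewrite <- E; ring.
      - destruct (sol_unique P _ _ _ _ 0 HP Hr Hu) with (x := x) as [E _].
        + now rewrite Ropp_0.
        + rewrite Ropp_0, H0; ring.
        + now rewrite E. }
    exists u, du; split; [exact Hu|split].
    + exists X; destruct Hdec as [_ [-> _]]; lra.
    + apply (fast_even_ex_RInt_gen (fun x => u x ^ 2)); [|exact Hev].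
      apply (fast_ext (fun x => u x * u x)); [intros; ring|].
      apply (fast_mult_exp u u C C); trivial; try (intros x; apply (sol_continuous P u du x Hu));
        intros x Hx; apply Hb; exact Hx.
Qed.

(** * The scaled potentials *)

Lemma pow_exp_bound (j : nat) : exists D, 0 <= D /\ forall x, 0 <= x -> x ^ j * exp (- x) <= D.
Proof.
  assert (H : fast (fun x => exp (- x) * exp (- x))).
  { assert (Ce : forall x, continuous (fun x => exp (- x)) x).
    { intros x; apply (ex_derive_continuous (fun x => exp (- x))); auto_derive; exact I. }
    apply (fast_mult_exp (fun x => exp (- x)) (fun x => exp (- x)) 1 1); trivial;
      intros x _; rewrite Rmult_1_l, Rabs_pos_eq by (apply Rlt_le, exp_pos); lra. }
  destruct (proj2 H j) as [C HC].
  exists (C * 2 ^ j); split.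
  { apply Rmult_le_pos; [|apply pow_le; lra].
    specialize (HC 0 (Rle_refl 0)); eapply Rle_trans; [apply Rabs_pos|exact HC]. }
  intros x Hx; specialize (HC (x / 2) ltac:(lra)).
  rewrite <- exp_plus in HC; replace (- (x / 2) + - (x / 2)) with (- x) in HC by field.
  rewrite Rabs_pos_eq in HC.
  - replace (x ^ j) with ((x / 2) ^ j * 2 ^ j).
    + pose proof (pow_lt 2 j ltac:(lra)); nra.
    + rewrite <- Rpow_mult_distr; f_equal; field.
  - apply Rmult_le_pos; [apply pow_le; lra|apply Rlt_le, exp_pos].
Qed.

(** Two errors add up: the slope at [X], controlled by the tail through [dec_slope_close], and its
    propagation back to 0, controlled by [sol_close]. Polynomially growing perturbations are allowed
    because the decay of the solutions absorbs them. *)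
Lemma dec_close (P0 u0 du0 : R -> R) (X : R) (j : nat) :
  0 <= X -> (forall t, continuous P0 t) -> (forall x, X <= x -> 1 <= P0 x) -> dec P0 X u0 du0 ->
  forall eps, 0 < eps -> exists om, 0 < om /\
  forall P u du, (forall x, X <= x -> 1 <= P x) ->
  (forall x, 0 <= x -> Rabs (P x - P0 x) <= om * (1 + x ^ j)) -> dec P X u du ->
  forall x, 0 <= x <= X -> Rabs (u x - u0 x) < eps /\ Rabs (du x - du0 x) < eps.
Proof.
  intros HX HP0 HP01 Hd0 eps Heps.
  destruct (pow_exp_bound j) as [D0 [HD0 HD]].
  destruct (continuous_bounded P0 0 X) as [K [HK0 HK]]; [auto|].
  destruct (continuous_bounded u0 0 X) as [V [HV0 HV]].
  { intros x _; apply (sol_continuous P0 u0 du0 x (proj1 Hd0)). }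
  (* [D] bounds the weight 1 + x^j on [0, X], and beyond [X] its product with exp(- (x - X)). *)
  set (D := 1 + X ^ j + exp X + exp X * D0).
  pose proof (exp_pos X) as EX; pose proof (pow_le X j HX) as XJ.
  assert (ED : 0 <= exp X * D0) by (apply Rmult_le_pos; lra).
  assert (HDge : 1 <= D) by (unfold D; lra).
  assert (D1 : forall x, 0 <= x <= X -> 1 + x ^ j <= D).
  { intros x Hx; assert (x ^ j <= X ^ j) by (apply pow_incr; lra).
    unfold D; lra. }
  assert (D2 : forall x, X <= x -> (1 + x ^ j) * exp (- (x - X)) <= D).
  { intros x Hx; replace (- (x - X)) with (X + - x) by ring; rewrite exp_plus.
    specialize (HD x ltac:(lra)).
    assert (exp (- x) <= 1).
    { rewrite <- exp_0; apply exp_le_compat; lra. }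
    unfold D; pose proof (exp_pos (- x)); nra. }
  set (A := exp ((K + 1 + 2) * X)).
  assert (HA : 1 <= A).
  { unfold A; rewrite <- exp_0 at 1; apply exp_le_compat, Rmult_le_pos; lra. }
  (* [Q] is the total amplification of [om]. The first entry of the minimum below gives
     [om * D <= 1], so that |P| <= K + 1 on [0, X]; the second makes the final error smaller than
     [eps]. *)
  set (Q := D * (1 + V) * A).
  assert (HQ : 0 < Q) by (unfold Q; apply Rmult_lt_0_compat; [apply Rmult_lt_0_compat|]; lra).
  exists (Rmin (/ D) (eps / (2 * Q))); set (om := Rmin (/ D) (eps / (2 * Q))).
  assert (Hom : 0 < om).
  { unfold om; apply Rmin_glb_lt; [apply Rinv_0_lt_compat; lra|apply Rdiv_lt_0_compat; lra]. }
  assert (Ho1 : om * D <= 1).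
  { apply Rle_trans with (/ D * D); [apply Rmult_le_compat_r; [lra|apply Rmin_l]|].
    rewrite Rinv_l; lra. }
  assert (Ho2 : om * Q < eps).
  { apply Rle_lt_trans with (eps / (2 * Q) * Q); [apply Rmult_le_compat_r; [lra|apply Rmin_r]|].
    replace (eps / (2 * Q) * Q) with (eps / 2) by (field; lra); lra. }
  split; [exact Hom|].
  intros P u du HP1 HPP Hd x Hx.
  assert (Hdiff : forall t, 0 <= t <= X -> Rabs (P t - P0 t) <= om * D).
  { intros t Ht; eapply Rle_trans; [apply HPP; lra|].
    apply Rmult_le_compat_l; [lra|now apply D1]. }
  assert (Hslope : Rabs (du X - du0 X) <= om * D).
  { apply (dec_slope_close P0 P u0 du0 u du X); trivial.
    intros t Ht; eapply Rle_trans.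
    - apply Rmult_le_compat_r; [apply Rlt_le, exp_pos|apply HPP; lra].
    - rewrite Rmult_assoc; apply Rmult_le_compat_l; [lra|now apply D2]. }
  pose proof (sol_close P P0 u du u0 du0 0 X (K + 1) (om * D) V (proj1 Hd) (proj1 Hd0)) as H.
  simpl in H; specialize (fun a => H a Hdiff HV x X Hx ltac:(lra)).
  assert (HPK : forall t, 0 <= t <= X -> Rabs (P t) <= K + 1).
  { intros t Ht; specialize (Hdiff t Ht); specialize (HK t Ht).
    replace (P t) with (P0 t + (P t - P0 t)) by ring.
    eapply Rle_trans; [apply Rabs_triang|lra]. }
  specialize (H HPK).
  destruct Hd as [_ [E1 _]]; destruct Hd0 as [_ [E2 _]]; rewrite E1, E2 in H.
  assert (Hx1 : exp ((K + 1 + 2) * Rabs (x - X)) <= A).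
  { unfold A; rewrite Rabs_left1 by lra; apply exp_le_compat, Rmult_le_compat_l; lra. }
  set (p := u x - u0 x) in *; set (q := du x - du0 x) in *.
  set (d := du X - du0 X) in *; set (o := om * D) in *.
  assert (Hd2 : d * d <= o * o).
  { apply Rabs_le_between in Hslope.
    assert (0 <= (o - d) * (o + d)) by (apply Rmult_le_pos; lra); nra. }
  assert (Ho : 0 < o) by (unfold o; apply Rmult_lt_0_compat; lra).
  assert (HB : p * p + q * q <= (om * Q) * (om * Q)).
  { apply Rle_trans with ((o * o + o * V * (o * V)) * A).
    - eapply Rle_trans; [|apply Rmult_le_compat_l; [nra|exact Hx1]].
      replace (p * p + q * q) with (p * (p * 1) + q * (q * 1)) by ring.
      eapply Rle_trans; [exact H|].
      apply Rmult_le_compat_r; [apply Rlt_le, exp_pos|]; nra.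
    - replace (om * Q * (om * Q)) with (o * o * ((1 + V) * (1 + V)) * (A * A))
        by (unfold o, Q; ring).
      replace ((o * o + o * V * (o * V)) * A) with (o * o * (1 + V * V) * A) by ring.
      apply Rmult_le_compat; [apply Rmult_le_pos; nra|lra| |nra].
      apply Rmult_le_compat_l; nra. }
  assert (HoQ : 0 <= om * Q) by nra.
  split; apply Rle_lt_trans with (om * Q); trivial; rewrite <- (Rabs_pos_eq (om * Q)) by exact HoQ;
    apply Rsqr_le_abs_0; unfold Rsqr;
    pose proof (Rle_0_sqr p); pose proof (Rle_0_sqr q); unfold Rsqr in *; lra.
Qed.

(** Up to [T] the lower power is at most T^i; beyond [T] one has eps x >= K, and one extra factor x
    suffices. *)
Lemma pow_absorb (i j : nat) (K eps : R) :
  (i < j)%nat -> 0 <= K -> 0 < eps ->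
  exists C, 0 <= C /\ forall x, 0 <= x -> K * x ^ i <= eps * x ^ j + C.
Proof.
  intros Hij HK He; set (T := 1 + K / eps).
  assert (HT : 1 <= T).
  { unfold T; assert (0 <= K / eps) by (apply Rmult_le_pos; [lra|now apply Rlt_le, Rinv_0_lt_compat]); lra. }
  exists (K * T ^ i); split; [apply Rmult_le_pos; [lra|apply pow_le; lra]|].
  intros x Hx; pose proof (pow_le x i Hx); pose proof (pow_le x j Hx).
  destruct (Rle_dec x T) as [h|h].
  - assert (x ^ i <= T ^ i) by (apply pow_incr; lra).
    assert (K * x ^ i <= K * T ^ i) by (apply Rmult_le_compat_l; lra).
    assert (0 <= eps * x ^ j) by (apply Rmult_le_pos; lra); lra.
  - assert (H1 : x * x ^ i <= x ^ j).
    { change (x ^ S i <= x ^ j); apply Rle_pow; [lra|lia]. }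
    assert (H2 : K <= eps * x).
    { apply Rle_trans with (eps * T); [|apply Rmult_le_compat_l; lra].
      replace (eps * T) with (eps + K) by (unfold T; field; lra); lra. }
    assert (0 <= T ^ i) by (apply pow_le; lra).
    nra.
Qed.

(* Here [r = n + 2], and [c k] is the coefficient of degree [2 k + 2]. *)
Definition U (n : nat) (c : nat -> R) (s x : R) : R :=
  sum_f_R0 (fun k => c k * s ^ (S n - k) * x ^ (2 * S k)) (S n).

Definition dU (n : nat) (c : nat -> R) (s x : R) : R :=
  sum_f_R0 (fun k => c k * s ^ (S n - k) * (INR (2 * S k) * x ^ pred (2 * S k))) (S n).

(** The equation u'' = Q u is - u''/2 + U u = E u. *)
Definition Q (n : nat) (c : nat -> R) (E s x : R) : R := 2 * (U n c s x - E).

Lemma U_entire (n : nat) (c : nat -> R) (s : R) : entire (U n c s).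
Proof.
  apply (entire_sum (fun k x => c k * s ^ (S n - k) * x ^ (2 * S k))).
  intros k; apply entire_scal, entire_pow.
Qed.

Lemma Q_entire (n : nat) (c : nat -> R) (E s : R) : entire (Q n c E s).
Proof.
  apply entire_scal, (entire_plus (U n c s) (fun _ => - E)); [apply U_entire|apply entire_const].
Qed.

Lemma is_derive_sum (f df : nat -> R -> R) (n : nat) (x : R) :
  (forall k, is_derive (f k) x (df k x)) ->
  is_derive (fun x => sum_f_R0 (fun k => f k x) n) x (sum_f_R0 (fun k => df k x) n).
Proof.
  intros H; induction n as [|n IH]; simpl; [apply H|].
  apply (is_derive_plus (fun x => sum_f_R0 (fun k => f k x) n) (f (S n))); [exact IH|apply H].
Qed.

Lemma U_derive (n : nat) (c : nat -> R) (s x : R) : is_derive (U n c s) x (dU n c s x).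
Proof.
  apply (is_derive_sum (fun k x => c k * s ^ (S n - k) * x ^ (2 * S k))
           (fun k x => c k * s ^ (S n - k) * (INR (2 * S k) * x ^ pred (2 * S k)))).
  intros k; apply is_derive_scal.
  replace (INR (2 * S k) * x ^ pred (2 * S k)) with (INR (2 * S k) * 1 * x ^ pred (2 * S k)) by ring.
  apply (is_derive_pow (fun x => x)), (is_derive_id x).
Qed.

Lemma U_continuous (n : nat) (c : nat -> R) (s x : R) : continuous (U n c s) x.
Proof. exact (is_derive_continuous _ _ _ (U_derive n c s x)). Qed.

Lemma Q_continuous (n : nat) (c : nat -> R) (E s x : R) : continuous (Q n c E s) x.
Proof.
  apply (continuous_scal_r 2 (fun x => U n c s x - E)).
  apply (continuous_minus (U n c s) (fun _ => E)); [apply U_continuous|apply continuous_const].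
Qed.

Lemma U_even (n : nat) (c : nat -> R) (s x : R) : U n c s (- x) = U n c s x.
Proof.
  unfold U; apply sum_eq; intros k _; f_equal.
  rewrite !pow_mult; f_equal; ring.
Qed.

Lemma Q_even (n : nat) (c : nat -> R) (E s x : R) : Q n c E s (- x) = Q n c E s x.
Proof. unfold Q; now rewrite U_even. Qed.

Lemma U_0 (n : nat) (c : nat -> R) (s : R) : U n c s 0 = 0.
Proof.
  unfold U; rewrite (sum_eq _ (fun _ => 0)).
  - rewrite sum_cte; ring.
  - intros k _; rewrite pow_i by lia; ring.
Qed.

Lemma sum_Rabs_le (f g : nat -> R) (n : nat) (B : R) :
  (forall k, (k <= n)%nat -> Rabs (f k) <= g k * B) ->
  Rabs (sum_f_R0 f n) <= sum_f_R0 g n * B.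
Proof.
  intros H; eapply Rle_trans; [apply Rsum_abs|].
  rewrite Rmult_comm, scal_sum; apply sum_Rle; exact H.
Qed.

Lemma pow_le_1_plus (x : R) (i j : nat) : 0 <= x -> (i <= j)%nat -> x ^ i <= 1 + x ^ j.
Proof.
  intros Hx Hij; pose proof (pow_le x j Hx); destruct (Rle_dec x 1) as [h|h].
  - assert (x ^ i <= 1 ^ i) by (apply pow_incr; lra); rewrite pow1 in *; lra.
  - assert (x ^ i <= x ^ j) by (apply Rle_pow; [lra|lia]); lra.
Qed.

(** The top coefficient carries s^0 = 1, also at s = 0, and all others carry positive powers of s
    that are bounded on [0, M]. Hence the lower-order terms are uniform down to s = 0. *)
Lemma U_leading (n : nat) (c : nat -> R) (M : R) :
  exists K, 0 <= K /\ forall s x, 0 <= s <= M -> 0 <= x ->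
    Rabs (U n c s x - c (S n) * x ^ (2 * n + 4)) <= K * (1 + x ^ (2 * n + 2)) /\
    Rabs (dU n c s x - INR (2 * n + 4) * c (S n) * x ^ (2 * n + 3)) <= K * (1 + x ^ (2 * n + 2)).
Proof.
  set (g := fun k => Rabs (c k) * (1 + Rabs M) ^ (S n) * INR (2 * S k)).
  exists (sum_f_R0 g n); split.
  { apply cond_pos_sum; intros k; unfold g; pose proof (Rabs_pos M).
    apply Rmult_le_pos; [apply Rmult_le_pos; [apply Rabs_pos|apply pow_le; lra]|apply pos_INR]. }
  intros s x Hs Hx.
  assert (Hsp : forall k, (k <= n)%nat -> 0 <= s ^ (S n - k) <= (1 + Rabs M) ^ S n).
  { intros k Hk; split; [apply pow_le; lra|].
    pose proof (Rle_abs M); pose proof (Rabs_pos M).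
    apply Rle_trans with ((1 + Rabs M) ^ (S n - k)); [apply pow_incr; lra|].
    apply Rle_pow; [lra|lia]. }
  split.
  - unfold U; rewrite tech5, Nat.sub_diag, pow_O.
    replace (2 * S (S n))%nat with (2 * n + 4)%nat by lia.
    replace (_ + c (S n) * 1 * _ - _)
      with (sum_f_R0 (fun k => c k * s ^ (S n - k) * x ^ (2 * S k)) n) by ring.
    apply sum_Rabs_le; intros k Hk; destruct (Hsp k Hk) as [S1 S2]; unfold g.
    pose proof (pow_le x (2 * S k) Hx) as E.
    rewrite !Rabs_mult, (Rabs_pos_eq (s ^ _)), (Rabs_pos_eq (x ^ _)) by assumption.
    pose proof (pow_le_1_plus x (2 * S k) (2 * n + 2) Hx ltac:(lia)).
    assert (1 <= INR (2 * S k)) by (apply (le_INR 1); lia).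
    pose proof (Rabs_pos (c k)).
    apply Rmult_le_compat; trivial; [apply Rmult_le_pos; trivial|].
    rewrite <- (Rmult_1_r (_ * s ^ _)).
    apply Rmult_le_compat; try lra; [apply Rmult_le_pos; trivial|apply Rmult_le_compat_l; trivial].
  - unfold dU; rewrite tech5, Nat.sub_diag, pow_O.
    replace (pred (2 * S (S n))) with (2 * n + 3)%nat by lia.
    replace (2 * S (S n))%nat with (2 * n + 4)%nat by lia.
    replace (_ + c (S n) * 1 * _ - _)
      with (sum_f_R0 (fun k => c k * s ^ (S n - k) * (INR (2 * S k) * x ^ pred (2 * S k))) n) by ring.
    apply sum_Rabs_le; intros k Hk; destruct (Hsp k Hk) as [S1 S2]; unfold g.
    pose proof (pow_le x (pred (2 * S k)) Hx) as E.
    assert (1 <= INR (2 * S k)) by (apply (le_INR 1); lia).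
    rewrite !Rabs_mult, (Rabs_pos_eq (s ^ _)), (Rabs_pos_eq (x ^ _)), (Rabs_pos_eq (INR _)) by (trivial; lra).
    pose proof (pow_le_1_plus x (pred (2 * S k)) (2 * n + 2) Hx ltac:(lia)).
    pose proof (Rabs_pos (c k)).
    rewrite <- Rmult_assoc; apply Rmult_le_compat; trivial.
    + apply Rmult_le_pos; [apply Rmult_le_pos; trivial|lra].
    + apply Rmult_le_compat_r; [lra|apply Rmult_le_compat_l; trivial].
Qed.

Lemma U_lower (n : nat) (c : nat -> R) (M : R) :
  0 < c (S n) -> exists C, 0 <= C /\ forall s x, 0 <= s <= M -> 0 <= x ->
    c (S n) / 2 * x ^ (2 * n + 4) - C <= U n c s x.
Proof.
  intros Hc; destruct (U_leading n c M) as [K [HK H]].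
  destruct (pow_absorb (2 * n + 2) (2 * n + 4) K (c (S n) / 2)) as [C [HC HC']]; [lia|lra|lra|].
  exists (C + K); split; [lra|]; intros s x Hs Hx.
  destruct (H s x Hs Hx) as [H1 _]; apply Rabs_le_between in H1; specialize (HC' x Hx).
  lra.
Qed.

Lemma Q_ge_1 (n : nat) (c : nat -> R) (M : R) :
  0 < c (S n) -> exists X, 0 <= X /\ forall E s x, Rabs E <= M -> 0 <= s <= M -> X <= x ->
    1 <= Q n c E s x.
Proof.
  intros Hc; destruct (U_lower n c M Hc) as [C [HC H]].
  (* The summand 1 puts x above 1, where x <= x^(2n+4), so a choice linear in the required height is
     enough. *)
  exists (1 + (C + Rabs M + 1) * (2 / c (S n))).
  assert (H2 : 0 < 2 / c (S n)) by (apply Rdiv_lt_0_compat; lra).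
  pose proof (Rabs_pos M).
  assert (Hpos : 0 <= (C + Rabs M + 1) * (2 / c (S n))) by (apply Rmult_le_pos; lra).
  split; [lra|]; intros E s x HE Hs Hx; unfold Q.
  specialize (H s x Hs ltac:(lra)).
  assert (Hp : x <= x ^ (2 * n + 4)).
  { rewrite <- (pow_1 x) at 1; apply Rle_pow; [lra|lia]. }
  assert (C + Rabs M + 1 <= c (S n) / 2 * x ^ (2 * n + 4)).
  { apply Rle_trans with (c (S n) / 2 * ((C + Rabs M + 1) * (2 / c (S n)))).
    - right; field; lra.
    - apply Rmult_le_compat_l; lra. }
  pose proof (Rle_abs E); pose proof (Rle_abs M); lra.
Qed.

Lemma Q_ge_1_everywhere (n : nat) (c : nat -> R) (M : R) :
  0 < c (S n) -> exists lo, forall E s x, E <= lo -> 0 <= s <= M -> 0 <= x -> 1 <= Q n c E s x.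
Proof.
  intros Hc; destruct (U_lower n c M Hc) as [C [HC H]].
  exists (- C - 1); intros E s x HE Hs Hx; specialize (H s x Hs Hx); unfold Q.
  pose proof (pow_le x (2 * n + 4) Hx).
  assert (0 <= c (S n) / 2 * x ^ (2 * n + 4)) by (apply Rmult_le_pos; lra); lra.
Qed.

Lemma continuous_sum (f : nat -> R -> R) (n : nat) (x : R) :
  (forall k, continuous (f k) x) -> continuous (fun x => sum_f_R0 (fun k => f k x) n) x.
Proof.
  intros H; induction n as [|n IH]; simpl; [apply H|].
  apply (continuous_plus (fun x => sum_f_R0 (fun k => f k x) n) (f (S n))); [exact IH|apply H].
Qed.

Lemma Q_close (n : nat) (c : nat -> R) (s0 om : R) :
  0 < om -> exists eta, 0 < eta /\ forall E E0 s x,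
    Rabs (E - E0) < eta -> Rabs (s - s0) < eta -> 0 <= x ->
    Rabs (Q n c E s x - Q n c E0 s0 x) <= om * (1 + x ^ (2 * n + 4)).
Proof.
  intros Hom.
  (* [z] is the total change of the coefficients; it is continuous and vanishes at [s0].
     Coefficients and energy each get [om / 4], which the factor 2 in [Q] doubles. *)
  set (z := fun s => sum_f_R0 (fun k => Rabs (c k) * Rabs (s ^ (S n - k) - s0 ^ (S n - k))) (S n)).
  assert (Cz : continuous z s0).
  { apply (continuous_sum (fun k s => Rabs (c k) * Rabs (s ^ (S n - k) - s0 ^ (S n - k)))).
    intros k; apply (continuous_scal_r (Rabs (c k)) (fun s => Rabs (s ^ (S n - k) - s0 ^ (S n - k)))).
    apply (continuous_comp (fun s => s ^ (S n - k) - s0 ^ (S n - k)) Rabs); [|apply continuous_Rabs].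
    apply (ex_derive_continuous (fun s => s ^ (S n - k) - s0 ^ (S n - k))); auto_derive; exact I. }
  assert (Z0 : z s0 = 0).
  { unfold z; rewrite (sum_eq _ (fun _ => 0)).
    - rewrite sum_cte; ring.
    - intros k _; rewrite Rminus_diag_eq, Rabs_R0 by reflexivity; ring. }
  destruct (Cz (fun y => Rabs (y - z s0) < om / 4)) as [d Hd].
  { exists (mkposreal (om / 4) ltac:(lra)); trivial. }
  exists (Rmin d (om / 4)); split; [apply Rmin_glb_lt; [apply cond_pos|lra]|].
  intros E E0 s x HE Hs Hx.
  pose proof (Rmin_l d (om / 4)); pose proof (Rmin_r d (om / 4)).
  pose proof (pow_le x (2 * n + 4) Hx).
  assert (Hz : Rabs (U n c s x - U n c s0 x) <= z s * (1 + x ^ (2 * n + 4))).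
  { unfold U; rewrite <- minus_sum; apply sum_Rabs_le; intros k Hk.
    replace (c k * s ^ (S n - k) * x ^ (2 * S k) - c k * s0 ^ (S n - k) * x ^ (2 * S k))
      with (c k * (s ^ (S n - k) - s0 ^ (S n - k)) * x ^ (2 * S k)) by ring.
    rewrite !Rabs_mult; apply Rmult_le_compat_l; [apply Rmult_le_pos; apply Rabs_pos|].
    rewrite Rabs_pos_eq by (now apply pow_le); apply pow_le_1_plus; [exact Hx|lia]. }
  assert (Hzs : Rabs (z s - z s0) < om / 4) by (apply Hd; change (Rabs (s - s0) < d); lra).
  rewrite Z0, Rminus_0_r in Hzs; pose proof (Rle_abs (z s)).
  unfold Q; replace (2 * (U n c s x - E) - 2 * (U n c s0 x - E0))
    with (2 * ((U n c s x - U n c s0 x) - (E - E0))) by ring.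
  rewrite Rabs_mult, (Rabs_pos_eq 2) by lra.
  pose proof (Rabs_triang (U n c s x - U n c s0 x) (- (E - E0))) as T; rewrite Rabs_Ropp in T.
  unfold Rminus at 1.
  assert (z s * (1 + x ^ (2 * n + 4)) <= om / 4 * (1 + x ^ (2 * n + 4)))
    by (apply Rmult_le_compat_r; lra).
  nra.
Qed.

(** * Local structure of the spectrum *)

(** Choice turns the decaying solution into a total function of energy and scale. Inside an
    admissible box it exists by [dec_exists], and [dec_unique] makes the choice harmless. *)
Definition dec_pair (P : R -> R) (X : R) : (R -> R) * (R -> R) :=
  epsilon (inhabits (P, P)) (fun p => dec P X (fst p) (snd p)).

Definition chi (n : nat) (c : nat -> R) (X E s : R) : R -> R := fst (dec_pair (Q n c E s) X).
Definition dchi (n : nat) (c : nat -> R) (X E s : R) : R -> R := snd (dec_pair (Q n c E s) X).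

Definition box (M E s : R) : Prop := Rabs E <= M /\ 0 <= s <= M.

(** One normalization point serves the whole box, so that solutions for different (E, s) can be
    compared. It lies strictly to the right of 0 because norms over [0, X] must be positive. *)
Definition admissible (n : nat) (c : nat -> R) (M X : R) : Prop :=
  0 < X /\ forall E s x, box M E s -> X <= x -> 1 <= Q n c E s x.

Definition spec (n : nat) (c : nat -> R) (s E : R) : Prop := singular (Q n c E s).

Lemma admissible_exists (n : nat) (c : nat -> R) (M : R) :
  0 < c (S n) -> exists X, admissible n c M X.
Proof.
  intros Hc; destruct (Q_ge_1 n c M Hc) as [X [HX H]]; exists (X + 1); split; [lra|].
  intros E s x [H1 H2] Hx; apply H; trivial; lra.
Qed.

Lemma chi_dec (n : nat) (c : nat -> R) (M X E s : R) :
  admissible n c M X -> box M E s -> dec (Q n c E s) X (chi n c X E s) (dchi n c X E s).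
Proof.
  intros [HX HQ] Hb.
  refine (epsilon_spec (inhabits (Q n c E s, Q n c E s))
            (fun p => dec (Q n c E s) X (fst p) (snd p)) _).
  destruct (dec_exists (Q n c E s) X (Q_entire n c E s) (Q_continuous n c E s)) as [u [du H]].
  - intros x Hx; now apply HQ.
  - exists (u, du); exact H.
Qed.

Lemma spec_iff (n : nat) (c : nat -> R) (M X E s : R) :
  admissible n c M X -> box M E s ->
  spec n c s E <-> chi n c X E s 0 = 0 \/ dchi n c X E s 0 = 0.
Proof.
  intros Ha Hb; apply (singular_iff (Q n c E s) _ _ X (Q_entire n c E s) (Q_continuous n c E s)
    (Q_even n c E s)).
  - destruct Ha; lra.
  - intros x Hx; now apply Ha.
  - now apply (chi_dec n c M).
Qed.

Lemma chi_nontrivial (n : nat) (c : nat -> R) (M X E s x : R) :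
  admissible n c M X -> box M E s -> chi n c X E s x <> 0 \/ dchi n c X E s x <> 0.
Proof.
  intros Ha Hb; destruct (chi_dec n c M X E s Ha Hb) as [Hs [H1 _]].
  apply (sol_nontrivial _ _ _ x X (Q_continuous n c E s) Hs); left; lra.
Qed.

Lemma chi_close (n : nat) (c : nat -> R) (M X E0 s0 : R) :
  admissible n c M X -> box M E0 s0 -> forall eps, 0 < eps ->
  exists eta, 0 < eta /\ forall E s, box M E s -> Rabs (E - E0) < eta -> Rabs (s - s0) < eta ->
  forall x, 0 <= x <= X -> Rabs (chi n c X E s x - chi n c X E0 s0 x) < eps /\
                          Rabs (dchi n c X E s x - dchi n c X E0 s0 x) < eps.
Proof.
  intros Ha Hb eps Heps.
  destruct (dec_close (Q n c E0 s0) _ _ X (2 * n + 4) (Rlt_le _ _ (proj1 Ha))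
    (Q_continuous n c E0 s0) (fun x => proj2 Ha E0 s0 x Hb) (chi_dec n c M X E0 s0 Ha Hb) eps Heps)
    as [om [Hom H]].
  destruct (Q_close n c s0 om Hom) as [eta [Heta Hq]].
  exists eta; split; [exact Heta|]; intros E s Hbs HE Hs.
  apply (H (Q n c E s)); [intros x; now apply Ha| |now apply (chi_dec n c M)].
  intros x Hx; now apply Hq.
Qed.

(* The Wronskian at [0] is [2 (E2 - E1)] times the integral of [chi1 chi2] over the half-line. *)
Lemma wronskian_pos (n : nat) (c : nat -> R) (M X E0 s0 : R) :
  admissible n c M X -> box M E0 s0 ->
  exists eta, 0 < eta /\ forall E1 E2 s, box M E1 s -> box M E2 s ->
  Rabs (E1 - E0) < eta -> Rabs (E2 - E0) < eta -> Rabs (s - s0) < eta -> E1 < E2 ->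
  0 < chi n c X E1 s 0 * dchi n c X E2 s 0 - dchi n c X E1 s 0 * chi n c X E2 s 0.
Proof.
  intros Ha Hb; pose proof (proj1 Ha) as HX.
  set (u0 := chi n c X E0 s0).
  pose proof (chi_dec n c M X E0 s0 Ha Hb) as Hd0; fold u0 in Hd0.
  assert (C0 : forall x, continuous u0 x) by (intros x; apply (sol_continuous _ _ _ x (proj1 Hd0))).
  destruct (continuous_bounded u0 0 X) as [V [HV0 HV]]; [intros; apply C0|].
  set (N0 := RInt (fun x => u0 x * u0 x) 0 X).
  assert (HN0 : 0 < N0).
  { apply (RInt_pos_at _ 0 X X); [exact HX| | |lra|].
    - intros x; apply (continuous_mult u0 u0); apply C0.
    - intros x _; apply Rle_0_sqr.
    - destruct Hd0 as [_ [-> _]]; lra. }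
  (* If u1 and u2 are within [e <= 1] of u0, then u1 u2 >= u0^2 - e (2 V + 1), and integrating over
     [0, X] loses at most half of [N0]. *)
  set (e := Rmin 1 (N0 / (2 * X * (2 * V + 1)))).
  assert (Hden : 0 < 2 * X * (2 * V + 1)) by (apply Rmult_lt_0_compat; lra).
  assert (He : 0 < e) by (unfold e; apply Rmin_glb_lt; [lra|now apply Rdiv_lt_0_compat]).
  assert (He1 : e <= 1) by apply Rmin_l.
  assert (He2 : e * (2 * V + 1) <= N0 / (2 * X)).
  { apply Rle_trans with (N0 / (2 * X * (2 * V + 1)) * (2 * V + 1)).
    - apply Rmult_le_compat_r; [lra|apply Rmin_r].
    - right; field; lra. }
  destruct (chi_close n c M X E0 s0 Ha Hb e He) as [eta [Heta H]]; fold u0 in H.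
  exists eta; split; [exact Heta|]; intros E1 E2 s B1 B2 N1 N2 Ns Hlt.
  pose proof (chi_dec n c M X E1 s Ha B1) as D1; pose proof (chi_dec n c M X E2 s Ha B2) as D2.
  set (u1 := chi n c X E1 s) in *; set (u2 := chi n c X E2 s) in *.
  set (v1 := dchi n c X E1 s) in *; set (v2 := dchi n c X E2 s) in *.
  assert (C1 : forall x, continuous u1 x) by (intros x; apply (sol_continuous _ _ _ x (proj1 D1))).
  assert (C2 : forall x, continuous u2 x) by (intros x; apply (sol_continuous _ _ _ x (proj1 D2))).
  assert (C12 : forall x, continuous (fun x => u1 x * u2 x) x)
    by (intros x; apply (continuous_mult u1 u2); auto).
  (* The tail beyond [X] needs only a sign, since the larger energy has the smaller coefficient; the
     strict gain comes from [0, X]. *)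
  assert (WX : 0 <= wronskian u1 v1 u2 v2 X).
  { apply (wronskian_dec_nonneg (Q n c E1 s) (Q n c E2 s)); trivial.
    - intros x; now apply Ha.
    - intros x; now apply Ha.
    - intros x _; unfold Q; lra. }
  assert (WI : is_RInt (fun x => (- 2 * (E2 - E1)) * (u1 x * u2 x)) 0 X
                 (wronskian u1 v1 u2 v2 X - wronskian u1 v1 u2 v2 0)).
  { apply (is_RInt_derive (wronskian u1 v1 u2 v2)).
    - intros x _; replace (- 2 * (E2 - E1)) with (Q n c E2 s x - Q n c E1 s x) by (unfold Q; ring).
      apply wronskian_derive; [apply D1|apply D2].
    - intros x _; apply (continuous_scal_r (- 2 * (E2 - E1)) (fun x => u1 x * u2 x)), C12. }
  apply (is_RInt_unique (V := R_CompleteNormedModule)) in WI.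
  assert (WI2 : RInt (fun x => (- 2 * (E2 - E1)) * (u1 x * u2 x)) 0 X
          = (- 2 * (E2 - E1)) * RInt (fun x => u1 x * u2 x) 0 X).
  { apply (RInt_scal (fun x => u1 x * u2 x)), continuous_ex_RInt, C12. }
  assert (HI : N0 / 2 <= RInt (fun x => u1 x * u2 x) 0 X).
  { replace (N0 / 2) with (RInt (fun x => u0 x * u0 x - N0 / (2 * X)) 0 X).
    - apply RInt_le; [lra| |now apply continuous_ex_RInt|].
      + apply continuous_ex_RInt; intros x.
        apply (continuous_minus (fun x => u0 x * u0 x)); [|apply continuous_const].
        apply (continuous_mult u0 u0); apply C0.
      + intros x Hx.
        destruct (H E1 s B1 N1 Ns x ltac:(lra)) as [P1 _]; destruct (H E2 s B2 N2 Ns x ltac:(lra)) as [P2 _].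
        specialize (HV x ltac:(lra)); apply Rabs_le_between in HV.
        fold u1 in P1; fold u2 in P2; apply Rabs_def2 in P1; apply Rabs_def2 in P2.
        set (p := u1 x - u0 x) in *; set (q := u2 x - u0 x) in *.
        replace (u1 x * u2 x) with (u0 x * u0 x + (u0 x * (p + q) + p * q)) by (unfold p, q; ring).
        assert (- (e * (2 * V)) <= u0 x * (p + q)).
        { assert (0 <= (V - u0 x) * (2 * e - (p + q))) by (apply Rmult_le_pos; lra).
          assert (0 <= (V + u0 x) * (2 * e + (p + q))) by (apply Rmult_le_pos; lra). lra. }
        assert (- e <= p * q).
        { assert (0 <= (e - p) * (e - q)) by (apply Rmult_le_pos; lra).
          assert (0 <= (e + p) * (e + q)) by (apply Rmult_le_pos; lra).
          assert (e * e <= e * 1) by (apply Rmult_le_compat_l; lra). lra. }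
        lra.
    - transitivity (RInt (fun x => u0 x * u0 x) 0 X - RInt (fun _ => N0 / (2 * X)) 0 X).
      + apply (RInt_minus (fun x => u0 x * u0 x) (fun _ => N0 / (2 * X))).
        * apply continuous_ex_RInt; intros x; apply (continuous_mult u0 u0); apply C0.
        * apply ex_RInt_const.
      + fold N0; rewrite RInt_const; unfold scal; simpl; unfold mult; simpl; field; lra. }
  change (0 < wronskian u1 v1 u2 v2 0).
  rewrite WI2 in WI.
  assert (0 < (E2 - E1) * RInt (fun x => u1 x * u2 x) 0 X) by (apply Rmult_lt_0_compat; lra).
  lra.
Qed.

Lemma box_near (E0 s0 E s : R) :
  0 <= s0 -> 0 <= s -> Rabs (E - E0) < 1 -> Rabs (s - s0) < 1 -> box (Rabs E0 + s0 + 1) E s.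
Proof.
  intros H0 Hs HE Hss; apply Rabs_def2 in Hss; pose proof (Rabs_pos E0).
  split; [|lra].
  replace E with (E0 + (E - E0)) by ring; eapply Rle_trans; [apply Rabs_triang|lra].
Qed.

Lemma close_nonzero (a b : R) : a <> 0 -> Rabs (b - a) < Rabs a -> b <> 0.
Proof. intros Ha H ->; rewrite Rminus_0_l, Rabs_Ropp in H; lra. Qed.

Lemma close_same_sign (a b : R) : a <> 0 -> Rabs (b - a) < Rabs a -> 0 < a * b.
Proof.
  intros Ha H; destruct (Rdichotomy _ _ Ha) as [h|h].
  - rewrite (Rabs_left a h) in H; apply Rabs_def2 in H; nra.
  - rewrite (Rabs_pos_eq a) in H by lra; apply Rabs_def2 in H; nra.
Qed.

(** At the centre chi(0) or chi'(0) is nonzero, and it stays nonzero nearby. Two nearby levels would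
    then make the other quantity vanish at both, and with it the Wronskian that [wronskian_pos]
    keeps positive. *)
Lemma spec_locally_unique (n : nat) (c : nat -> R) (E0 s0 : R) :
  0 < c (S n) -> 0 <= s0 ->
  exists eta, 0 < eta /\ forall s E1 E2, 0 <= s -> Rabs (s - s0) < eta ->
  Rabs (E1 - E0) < eta -> Rabs (E2 - E0) < eta -> spec n c s E1 -> spec n c s E2 -> E1 = E2.
Proof.
  intros Hc Hs0; set (M := Rabs E0 + s0 + 1).
  destruct (admissible_exists n c M Hc) as [X Ha].
  assert (Hb : box M E0 s0)
    by (apply box_near; trivial; rewrite Rminus_diag_eq, Rabs_R0 by reflexivity; lra).
  destruct (wronskian_pos n c M X E0 s0 Ha Hb) as [eta1 [Heta1 HW]].
  assert (Hnt : exists e, 0 < e /\ ((chi n c X E0 s0 0 <> 0 /\ e = Rabs (chi n c X E0 s0 0))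
                        \/ (dchi n c X E0 s0 0 <> 0 /\ e = Rabs (dchi n c X E0 s0 0)))).
  { destruct (chi_nontrivial n c M X E0 s0 0 Ha Hb) as [h|h].
    - exists (Rabs (chi n c X E0 s0 0)); split; [now apply Rabs_pos_lt|now left].
    - exists (Rabs (dchi n c X E0 s0 0)); split; [now apply Rabs_pos_lt|now right]. }
  destruct Hnt as [e [He Hnt]].
  destruct (chi_close n c M X E0 s0 Ha Hb e He) as [eta2 [Heta2 HC]].
  exists (Rmin 1 (Rmin eta1 eta2)).
  pose proof (Rmin_l 1 (Rmin eta1 eta2)); pose proof (Rmin_r 1 (Rmin eta1 eta2)).
  pose proof (Rmin_l eta1 eta2); pose proof (Rmin_r eta1 eta2).
  split; [repeat apply Rmin_glb_lt; lra|].
  assert (Hkey : forall s E1 E2, 0 <= s -> Rabs (s - s0) < Rmin 1 (Rmin eta1 eta2) ->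
    Rabs (E1 - E0) < Rmin 1 (Rmin eta1 eta2) -> Rabs (E2 - E0) < Rmin 1 (Rmin eta1 eta2) ->
    spec n c s E1 -> spec n c s E2 -> ~ E1 < E2).
  { intros s E1 E2 Hs Ns N1 N2 S1 S2 Hlt.
    assert (B1 : box M E1 s) by (apply box_near; trivial; lra).
    assert (B2 : box M E2 s) by (apply box_near; trivial; lra).
    pose proof (HW E1 E2 s B1 B2 ltac:(lra) ltac:(lra) ltac:(lra) Hlt) as W.
    apply (spec_iff n c M X E1 s Ha B1) in S1; apply (spec_iff n c M X E2 s Ha B2) in S2.
    pose proof (proj1 Ha) as HX.
    destruct (HC E1 s B1 ltac:(lra) ltac:(lra) 0 ltac:(lra)) as [P1 P2].
    destruct (HC E2 s B2 ltac:(lra) ltac:(lra) 0 ltac:(lra)) as [P3 P4].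
    destruct Hnt as [[Hn ->]|[Hn ->]].
    - apply (close_nonzero _ _ Hn) in P1; apply (close_nonzero _ _ Hn) in P3.
      destruct S1 as [S1|S1]; [contradiction|]; destruct S2 as [S2|S2]; [contradiction|].
      rewrite S1, S2 in W; lra.
    - apply (close_nonzero _ _ Hn) in P2; apply (close_nonzero _ _ Hn) in P4.
      destruct S1 as [S1|S1]; [|contradiction]; destruct S2 as [S2|S2]; [|contradiction].
      rewrite S1, S2 in W; lra. }
  intros s E1 E2 Hs Ns N1 N2 S1 S2.
  destruct (Rtotal_order E1 E2) as [h|[h|h]]; [|exact h|]; exfalso.
  - now apply (Hkey s E1 E2).
  - now apply (Hkey s E2 E1).
Qed.

Lemma spec_closed (n : nat) (c : nat -> R) (E0 s0 : R) :
  0 < c (S n) -> 0 <= s0 -> ~ spec n c s0 E0 ->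
  exists eta, 0 < eta /\ forall s E, 0 <= s -> Rabs (s - s0) < eta ->
  Rabs (E - E0) < eta -> ~ spec n c s E.
Proof.
  intros Hc Hs0 Hn; set (M := Rabs E0 + s0 + 1).
  destruct (admissible_exists n c M Hc) as [X Ha].
  assert (Hb : box M E0 s0)
    by (apply box_near; trivial; rewrite Rminus_diag_eq, Rabs_R0 by reflexivity; lra).
  rewrite (spec_iff n c M X E0 s0 Ha Hb) in Hn; apply not_or_and in Hn; destruct Hn as [Hn1 Hn2].
  set (e := Rmin (Rabs (chi n c X E0 s0 0)) (Rabs (dchi n c X E0 s0 0))).
  assert (He : 0 < e) by (unfold e; apply Rmin_glb_lt; now apply Rabs_pos_lt).
  destruct (chi_close n c M X E0 s0 Ha Hb e He) as [eta [Heta HC]].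
  exists (Rmin 1 eta); pose proof (Rmin_l 1 eta); pose proof (Rmin_r 1 eta).
  split; [apply Rmin_glb_lt; lra|]; intros s E Hs Ns NE HS.
  assert (B : box M E s) by (apply box_near; trivial; lra).
  apply (spec_iff n c M X E s Ha B) in HS.
  pose proof (proj1 Ha) as HX.
  destruct (HC E s B ltac:(lra) ltac:(lra) 0 ltac:(lra)) as [P1 P2].
  assert (Q1 : Rabs (chi n c X E s 0 - chi n c X E0 s0 0) < Rabs (chi n c X E0 s0 0))
    by (eapply Rlt_le_trans; [exact P1|apply Rmin_l]).
  assert (Q2 : Rabs (dchi n c X E s 0 - dchi n c X E0 s0 0) < Rabs (dchi n c X E0 s0 0))
    by (eapply Rlt_le_trans; [exact P2|apply Rmin_r]).
  apply (close_nonzero _ _ Hn1) in Q1; apply (close_nonzero _ _ Hn2) in Q2; tauto.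
Qed.

(** Opposite signs at the ends are an open condition in s; for each nearby s the intermediate value
    theorem in E then yields a zero. *)
Lemma sign_change_persists (f : R -> R -> R) (M a b s0 : R) :
  (forall E0 s0, box M E0 s0 -> forall eps, 0 < eps -> exists eta, 0 < eta /\
     forall E s, box M E s -> Rabs (E - E0) < eta -> Rabs (s - s0) < eta ->
     Rabs (f E s - f E0 s0) < eps) ->
  - M < a -> a < b -> b < M -> 0 <= s0 < M -> f a s0 * f b s0 < 0 ->
  exists eta, 0 < eta /\ forall s, 0 <= s -> Rabs (s - s0) < eta ->
  exists E, a <= E <= b /\ f E s = 0.
Proof.
  intros Hf Ha Hab Hb Hs0 Hsign.
  assert (Bx : forall E s, a <= E <= b -> 0 <= s <= M -> box M E s).
  { intros E s HE Hs; split; [apply Rabs_le; lra|exact Hs]. }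
  assert (Na : f a s0 <> 0) by (intros E; rewrite E in Hsign; lra).
  assert (Nb : f b s0 <> 0) by (intros E; rewrite E in Hsign; lra).
  destruct (Hf a s0 (Bx a s0 ltac:(lra) ltac:(lra)) _ (Rabs_pos_lt _ Na)) as [e1 [He1 H1]].
  destruct (Hf b s0 (Bx b s0 ltac:(lra) ltac:(lra)) _ (Rabs_pos_lt _ Nb)) as [e2 [He2 H2]].
  exists (Rmin (M - s0) (Rmin e1 e2)).
  pose proof (Rmin_l (M - s0) (Rmin e1 e2)); pose proof (Rmin_r (M - s0) (Rmin e1 e2)).
  pose proof (Rmin_l e1 e2); pose proof (Rmin_r e1 e2).
  split; [repeat apply Rmin_glb_lt; lra|]; intros s Hs Ns.
  assert (HsM : 0 <= s < M) by (apply Rabs_def2 in Ns; lra).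
  assert (Z : forall t, Rabs (t - t) = 0) by (intros; rewrite Rminus_diag_eq, Rabs_R0; reflexivity).
  specialize (H1 a s (Bx a s ltac:(lra) ltac:(lra)) ltac:(rewrite Z; lra) ltac:(lra)).
  specialize (H2 b s (Bx b s ltac:(lra) ltac:(lra)) ltac:(rewrite Z; lra) ltac:(lra)).
  apply (close_same_sign _ _ Na) in H1; apply (close_same_sign _ _ Nb) in H2.
  assert (Cf : forall E, a <= E <= b -> continuity_pt (fun E => f E s) E).
  { intros E HE; apply continuity_pt_filterlim; intros P [eps HP].
    destruct (Hf E s (Bx E s HE ltac:(lra)) eps (cond_pos eps)) as [eta [Heta Hc]].
    assert (Hd : 0 < Rmin eta (Rmin (E + M) (M - E)))
      by (repeat apply Rmin_glb_lt; lra).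
    exists (mkposreal _ Hd); intros y Hy; apply HP; change (Rabs (y - E) < Rmin eta (Rmin (E + M) (M - E))) in Hy.
    pose proof (Rmin_l eta (Rmin (E + M) (M - E))); pose proof (Rmin_r eta (Rmin (E + M) (M - E))).
    pose proof (Rmin_l (E + M) (M - E)); pose proof (Rmin_r (E + M) (M - E)).
    apply Hc; [|lra|rewrite Z; exact Heta].
    apply Rabs_def2 in Hy; split; [apply Rabs_le; lra|lra]. }
  assert (Hprod : f a s * f b s < 0).
  { assert (0 < (f a s0 * f a s) * (f b s0 * f b s)) by (now apply Rmult_lt_0_compat).
    destruct (Rlt_dec (f a s * f b s) 0) as [h|h]; [exact h|exfalso].
    assert (0 <= (- (f a s0 * f b s0)) * (f a s * f b s)) by (apply Rmult_le_pos; lra).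
    nra. }
  destruct (Rlt_dec (f a s) 0) as [h|h].
  - destruct (IVT_interv (fun E => f E s) a b Cf Hab h) as [z [Hz Ez]]; [nra|exists z; now split].
  - destruct (IVT_interv (fun E => - f E s) a b) as [z [Hz Ez]].
    + intros E HE; now apply continuity_pt_opp, Cf.
    + exact Hab.
    + nra.
    + nra.
    + exists z; split; [exact Hz|lra].
Qed.

Lemma chi_0_continuous (n : nat) (c : nat -> R) (M X : R) : admissible n c M X ->
  (forall E0 s0, box M E0 s0 -> forall eps, 0 < eps -> exists eta, 0 < eta /\
     forall E s, box M E s -> Rabs (E - E0) < eta -> Rabs (s - s0) < eta ->
     Rabs (chi n c X E s 0 - chi n c X E0 s0 0) < eps) /\
  (forall E0 s0, box M E0 s0 -> forall eps, 0 < eps -> exists eta, 0 < eta /\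
     forall E s, box M E s -> Rabs (E - E0) < eta -> Rabs (s - s0) < eta ->
     Rabs (dchi n c X E s 0 - dchi n c X E0 s0 0) < eps).
Proof.
  intros Ha; pose proof (proj1 Ha) as HX.
  split; intros E0 s0 Hb eps He; destruct (chi_close n c M X E0 s0 Ha Hb eps He) as [eta [Heta H]];
    exists eta; split; trivial; intros E s HB N1 N2; apply (H E s HB N1 N2 0); lra.
Qed.

(** At a level one of chi(0), chi'(0) vanishes. The positive Wronskians of the pairs (E0 - h, E0)
    and (E0, E0 + h) force that quantity to have opposite signs at E0 - h and E0 + h, so the zero is
    a crossing. *)
Lemma spec_persists (n : nat) (c : nat -> R) (E0 s0 eps : R) :
  0 < c (S n) -> 0 <= s0 -> spec n c s0 E0 -> 0 < eps ->
  exists eta, 0 < eta /\ forall s, 0 <= s -> Rabs (s - s0) < eta ->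
  exists E, Rabs (E - E0) < eps /\ spec n c s E.
Proof.
  intros Hc Hs0 HS Heps; set (M := Rabs E0 + s0 + 1).
  destruct (admissible_exists n c M Hc) as [X Ha].
  assert (Z : forall t, Rabs (t - t) = 0) by (intros; rewrite Rminus_diag_eq, Rabs_R0; reflexivity).
  assert (Hb : box M E0 s0) by (apply box_near; trivial; rewrite Z; lra).
  destruct (wronskian_pos n c M X E0 s0 Ha Hb) as [eta1 [Heta1 HW]].
  set (h := Rmin (1 / 2) (Rmin (eta1 / 2) (eps / 2))).
  assert (Hh : 0 < h) by (unfold h; repeat apply Rmin_glb_lt; lra).
  assert (Hh1 : h <= 1 / 2) by apply Rmin_l.
  assert (Hh2 : h <= eta1 / 2) by (eapply Rle_trans; [apply Rmin_r|apply Rmin_l]).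
  assert (Hh3 : h <= eps / 2) by (eapply Rle_trans; [apply Rmin_r|apply Rmin_r]).
  assert (A1 : Rabs (E0 - h - E0) < 1 / 2 + h / 2) by (rewrite Rabs_left; lra).
  assert (A2 : Rabs (E0 + h - E0) < 1 / 2 + h / 2) by (rewrite Rabs_right; lra).
  assert (Bm : box M (E0 - h) s0) by (apply box_near; trivial; try rewrite Z; lra).
  assert (Bp : box M (E0 + h) s0) by (apply box_near; trivial; try rewrite Z; lra).
  assert (W1 := HW (E0 - h) E0 s0 Bm Hb ltac:(rewrite Rabs_left; lra) ltac:(rewrite Z; lra) ltac:(rewrite Z; lra) ltac:(lra)).
  assert (W2 := HW E0 (E0 + h) s0 Hb Bp ltac:(rewrite Z; lra) ltac:(rewrite Rabs_right; lra) ltac:(rewrite Z; lra) ltac:(lra)).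
  destruct (chi_0_continuous n c M X Ha) as [K1 K2].
  pose proof (Rabs_pos E0); pose proof (Rle_abs E0); pose proof (Rle_abs (- E0)) as HmE; rewrite Rabs_Ropp in HmE.
  assert (Hfin : forall f, (f = (fun E s => chi n c X E s 0) \/ f = (fun E s => dchi n c X E s 0)) ->
     f (E0 - h) s0 * f (E0 + h) s0 < 0 ->
     exists eta, 0 < eta /\ forall s, 0 <= s -> Rabs (s - s0) < eta ->
     exists E, Rabs (E - E0) < eps /\ spec n c s E).
  { intros f Hf Hs.
    destruct (sign_change_persists f M (E0 - h) (E0 + h) s0) as [eta [Heta H3]].
    - destruct Hf as [-> | ->]; assumption.
    - unfold M; lra.
    - lra.
    - unfold M; lra.
    - unfold M; lra.
    - exact Hs.
    - exists (Rmin 1 eta); pose proof (Rmin_l 1 eta); pose proof (Rmin_r 1 eta).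
      split; [apply Rmin_glb_lt; lra|].
      intros s Hs1 Ns; destruct (H3 s Hs1 ltac:(lra)) as [E [HE EE]]; exists E.
      assert (Rabs (E - E0) <= h) by (apply Rabs_le; lra).
      split; [lra|]; apply (spec_iff n c M X E s Ha).
      + apply box_near; trivial; lra.
      + destruct Hf as [-> | ->]; [left|right]; exact EE. }
  apply (spec_iff n c M X E0 s0 Ha Hb) in HS; destruct HS as [HS|HS]; rewrite HS in W1, W2.
  - apply (Hfin (fun E s => chi n c X E s 0)); [now left|].
    set (p := chi n c X (E0 - h) s0 0) in *; set (q := chi n c X (E0 + h) s0 0) in *.
    set (d := dchi n c X E0 s0 0) in *.
    destruct (Rlt_dec 0 d); nra.
  - apply (Hfin (fun E s => dchi n c X E s 0)); [now right|].
    set (p := dchi n c X (E0 - h) s0 0) in *; set (q := dchi n c X (E0 + h) s0 0) in *.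
    set (d := chi n c X E0 s0 0) in *.
    destruct (Rlt_dec 0 d); nra.
Qed.

(** * Parity and existence of levels *)

(** The hypothesis compares each point only with its neighbours, never the neighbours with each
    other, so the conclusion is carried across the interval by a supremum. *)
Lemma locally_increasing (f : R -> R) (a b : R) :
  a < b ->
  (forall t, a <= t <= b -> exists d, 0 < d /\ forall t', a <= t' <= b -> Rabs (t' - t) < d ->
     (t < t' -> f t < f t') /\ (t' < t -> f t' < f t)) ->
  f a < f b.
Proof.
  intros Hab Hloc.
  destruct (completeness (fun t => a <= t <= b /\ forall u, a < u <= t -> f a < f u))
    as [sg [Hub Hlub]].
  { exists b; intros t [Ht _]; lra. }
  { exists a; split; [lra|intros u Hu; lra]. }
  assert (Ha : a <= sg) by (apply Hub; split; [lra|intros; lra]).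
  assert (Hb : sg <= b) by (apply Hlub; intros t [Ht _]; lra).
  assert (Hin : forall u, a < u < sg -> f a < f u).
  { intros u Hu.
    destruct (classic (exists t, (a <= t <= b /\ (forall u, a < u <= t -> f a < f u)) /\ u < t))
      as [[t [[_ Ht] Hut]]|Hn]; [apply Ht; lra|exfalso].
    assert (sg <= u); [|lra].
    apply Hlub; intros t Ht; destruct (Rle_dec t u) as [h|h]; [exact h|].
    exfalso; apply Hn; exists t; split; [exact Ht|lra]. }
  destruct (Hloc sg ltac:(lra)) as [d [Hd Hsg]].
  assert (Hsga : a < sg -> f a < f sg).
  { intros h; set (u := Rmax ((a + sg) / 2) (sg - d / 2)).
    assert (H1 : a < u < sg).
    { unfold u; pose proof (Rmax_l ((a + sg) / 2) (sg - d / 2)).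
      split; [lra|apply Rmax_lub_lt; lra]. }
    apply Rlt_trans with (f u); [now apply Hin|].
    apply (Hsg u); [lra| |lra].
    assert (sg - d / 2 <= u) by apply Rmax_r.
    rewrite Rabs_left; lra. }
  destruct (Req_dec sg b) as [E|E]; [rewrite <- E; apply Hsga; lra|exfalso].
  set (v := Rmin b (sg + d / 2)).
  assert (Hv : sg < v) by (unfold v; apply Rmin_glb_lt; lra).
  assert (v <= b) by apply Rmin_l.
  assert (v <= sg + d / 2) by apply Rmin_r.
  assert (v <= sg); [|lra].
  apply Hub; split; [lra|]; intros u Hu.
  destruct (Rtotal_order u sg) as [h|[h|h]].
  - apply Hin; lra.
  - rewrite h; apply Hsga; lra.
  - assert (f sg < f u) by (apply (Hsg u); [lra|rewrite Rabs_right; lra|exact h]).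
    destruct (Req_dec a sg) as [e|e]; [now rewrite e|].
    specialize (Hsga ltac:(lra)); lra.
Qed.

Lemma div_lt_of_cross (a b c d : R) : 0 < b * d -> 0 < b * c - a * d -> a / b < c / d.
Proof.
  intros H1 H2.
  assert (b <> 0) by (intros ->; lra); assert (d <> 0) by (intros ->; lra).
  assert (E : c / d - a / b = (b * c - a * d) / (b * d)) by (field; split; assumption).
  assert (0 < (b * c - a * d) / (b * d)) by (now apply Rdiv_lt_0_compat).
  lra.
Qed.

(* Where [chi(0)] has no zero, [chi'(0)/chi(0)] is strictly increasing in the
   energy, and likewise [- chi(0)/chi'(0)]; so even and odd levels alternate. *)
Lemma parity_alternates (n : nat) (c : nat -> R) (M X s E E' : R) :
  admissible n c M X -> 0 <= s <= M -> Rabs E <= M -> Rabs E' <= M -> E < E' ->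
  spec n c s E -> spec n c s E' -> (forall t, E < t < E' -> ~ spec n c s t) ->
  (chi n c X E s 0 = 0 /\ dchi n c X E' s 0 = 0) \/ (dchi n c X E s 0 = 0 /\ chi n c X E' s 0 = 0).
Proof.
  intros Ha Hs HE HE' Hlt S S' Hgap.
  assert (Bx : forall t, E <= t <= E' -> box M t s).
  { intros t Ht; apply Rabs_le_between in HE; apply Rabs_le_between in HE'.
    split; [apply Rabs_le; lra|exact Hs]. }
  assert (Z : forall t, Rabs (t - t) = 0) by (intros; rewrite Rminus_diag_eq, Rabs_R0; reflexivity).
  assert (Hmid : forall t, E < t < E' -> chi n c X t s 0 <> 0 /\ dchi n c X t s 0 <> 0).
  { intros t Ht; specialize (Hgap t Ht).
    rewrite (spec_iff n c M X t s Ha (Bx t ltac:(lra))) in Hgap; tauto. }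
  destruct (chi_0_continuous n c M X Ha) as [K1 K2].
  apply (spec_iff n c M X E s Ha (Bx E ltac:(lra))) in S.
  apply (spec_iff n c M X E' s Ha (Bx E' ltac:(lra))) in S'.
  destruct S as [S|S]; destruct S' as [S'|S']; [exfalso|now left|now right|exfalso].
  (* Both ends odd: chi'(0) has no zero on the closed interval, so the quotient - chi(0)/chi'(0)
     increases strictly, yet it is 0 at both ends. *)
  - assert (Hnz : forall t, E <= t <= E' -> dchi n c X t s 0 <> 0).
    { intros t Ht; destruct (chi_nontrivial n c M X t s 0 Ha (Bx t Ht)) as [h|h]; [|exact h].
      destruct (Req_dec t E) as [->|e]; [contradiction|].
      destruct (Req_dec t E') as [->|e']; [contradiction|apply Hmid; lra]. }
    assert (H : - chi n c X E s 0 / dchi n c X E s 0 < - chi n c X E' s 0 / dchi n c X E' s 0).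
    { apply (locally_increasing (fun t => - chi n c X t s 0 / dchi n c X t s 0)); [exact Hlt|].
      intros t Ht.
      destruct (wronskian_pos n c M X t s Ha (Bx t Ht)) as [e1 [He1 W]].
      destruct (K2 t s (Bx t Ht) _ (Rabs_pos_lt _ (Hnz t Ht))) as [e2 [He2 C]].
      exists (Rmin e1 e2); pose proof (Rmin_l e1 e2); pose proof (Rmin_r e1 e2).
      split; [now apply Rmin_glb_lt|]; intros t' Ht' N.
      specialize (C t' s (Bx t' Ht') ltac:(lra) ltac:(rewrite Z; lra)).
      apply (close_same_sign _ _ (Hnz t Ht)) in C.
      split; intros h.
      - specialize (W t t' s (Bx t Ht) (Bx t' Ht') ltac:(rewrite Z; lra) ltac:(lra) ltac:(rewrite Z; lra) h).
        apply div_lt_of_cross; lra.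
      - specialize (W t' t s (Bx t' Ht') (Bx t Ht) ltac:(lra) ltac:(rewrite Z; lra) ltac:(rewrite Z; lra) h).
        apply div_lt_of_cross; lra. }
    rewrite S, S' in H; unfold Rdiv in H; rewrite Ropp_0, !Rmult_0_l in H; lra.
  - assert (Hnz : forall t, E <= t <= E' -> chi n c X t s 0 <> 0).
    { intros t Ht; destruct (chi_nontrivial n c M X t s 0 Ha (Bx t Ht)) as [h|h]; [exact h|].
      destruct (Req_dec t E) as [->|e]; [contradiction|].
      destruct (Req_dec t E') as [->|e']; [contradiction|apply Hmid; lra]. }
    assert (H : dchi n c X E s 0 / chi n c X E s 0 < dchi n c X E' s 0 / chi n c X E' s 0).
    { apply (locally_increasing (fun t => dchi n c X t s 0 / chi n c X t s 0)); [exact Hlt|].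
      intros t Ht.
      destruct (wronskian_pos n c M X t s Ha (Bx t Ht)) as [e1 [He1 W]].
      destruct (K1 t s (Bx t Ht) _ (Rabs_pos_lt _ (Hnz t Ht))) as [e2 [He2 C]].
      exists (Rmin e1 e2); pose proof (Rmin_l e1 e2); pose proof (Rmin_r e1 e2).
      split; [now apply Rmin_glb_lt|]; intros t' Ht' N.
      specialize (C t' s (Bx t' Ht') ltac:(lra) ltac:(rewrite Z; lra)).
      apply (close_same_sign _ _ (Hnz t Ht)) in C.
      split; intros h.
      - specialize (W t t' s (Bx t Ht) (Bx t' Ht') ltac:(rewrite Z; lra) ltac:(lra) ltac:(rewrite Z; lra) h).
        apply div_lt_of_cross; lra.
      - specialize (W t' t s (Bx t' Ht') (Bx t Ht) ltac:(lra) ltac:(rewrite Z; lra) ltac:(rewrite Z; lra) h).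
        apply div_lt_of_cross; lra. }
    rewrite S, S' in H; unfold Rdiv in H; rewrite !Rmult_0_l in H; lra.
Qed.

(** Here the coefficient is at least 1 on the whole half-line, so a decaying solution can be
    normalized at 0; by uniqueness [chi] is a positive multiple of it, and u' <= - u applies down to
    0. *)
Lemma chi_below_potential (n : nat) (c : nat -> R) (M X E s : R) :
  admissible n c M X -> box M E s -> (forall x, 0 <= x -> 1 <= Q n c E s x) ->
  (forall x, 0 <= x -> 0 < chi n c X E s x) /\ dchi n c X E s 0 < 0.
Proof.
  intros Ha Hb HQ; pose proof (proj1 Ha) as HX.
  destruct (dec_exists (Q n c E s) 0 (Q_entire n c E s) (Q_continuous n c E s) HQ) as [u [du Hd]].
  pose proof (dec_derive_le _ u du 0 HQ Hd 0 (Rle_refl 0)) as H0.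
  destruct Hd as [Hu [E0 Hp]]; rewrite E0 in H0.
  destruct (Hp X ltac:(lra)) as [HuX _].
  assert (Hinv : 0 < / u X) by now apply Rinv_0_lt_compat.
  assert (Hd : dec (Q n c E s) X (fun x => / u X * u x + 0 * u x) (fun x => / u X * du x + 0 * du x)).
  { split; [now apply sol_derive_combination|split].
    - rewrite Rinv_l; lra.
    - intros x Hx; destruct (Hp x ltac:(lra)).
      assert (0 < / u X * u x) by (now apply Rmult_lt_0_compat).
      assert (0 <= / u X * - du x) by (apply Rmult_le_pos; lra); lra. }
  pose proof (dec_unique _ _ _ _ _ X (Q_continuous n c E s) (fun x => proj2 Ha E s x Hb)
                (chi_dec n c M X E s Ha Hb) Hd) as HE.
  split.
  - intros x Hx; destruct (HE x) as [-> _]; destruct (Hp x Hx).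
    assert (0 < / u X * u x) by (now apply Rmult_lt_0_compat); lra.
  - destruct (HE 0) as [_ ->]; assert (0 < / u X * - du 0) by (apply Rmult_lt_0_compat; lra); lra.
Qed.

Lemma spec_lower_bound (n : nat) (c : nat -> R) (M : R) :
  0 < c (S n) -> exists lo, forall s E, 0 <= s <= M -> spec n c s E -> lo < E.
Proof.
  intros Hc; destruct (Q_ge_1_everywhere n c M Hc) as [lo Hlo]; exists lo.
  intros s E Hs HS; destruct (Rlt_dec lo E) as [h|h]; [exact h|exfalso].
  set (M' := Rabs E + M).
  assert (Hb : box M' E s) by (unfold M'; pose proof (Rabs_pos E); split; lra).
  destruct (admissible_exists n c M' Hc) as [X Ha].
  apply (spec_iff n c M' X E s Ha Hb) in HS.
  destruct (chi_below_potential n c M' X E s Ha Hb) as [H1 H2].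
  - intros x Hx; apply Hlo; trivial; lra.
  - specialize (H1 0 (Rle_refl 0)); destruct HS; lra.
Qed.

(* Comparison with [sin (pi x)] on [0, 1]. *)
Lemma chi_oscillates (n : nat) (c : nat -> R) (M X E s : R) :
  admissible n c M X -> box M E s -> (forall x, 0 <= x <= 1 -> Q n c E s x <= - 16) ->
  ~ (forall x, 0 <= x -> 0 < chi n c X E s x).
Proof.
  intros Ha Hb HQ Hpos.
  pose proof (proj1 (chi_dec n c M X E s Ha Hb)) as Hs.
  set (u := chi n c X E s) in *; set (du := dchi n c X E s) in *.
  pose proof PI_RGT_0 as HPI; pose proof PI_4 as HPI4.
  (* From PI <= 4 comes PI^2 <= 16 <= - Q, so this Wronskian with sin(PI x) does not decrease. Its
     end values PI u(0) and - PI u(1) contradict positivity of u. *)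
  assert (H : u 0 * (PI * cos (PI * 0)) - du 0 * sin (PI * 0)
              <= u 1 * (PI * cos (PI * 1)) - du 1 * sin (PI * 1)).
  { apply (derive_nonneg_incr (fun x => u x * (PI * cos (PI * x)) - du x * sin (PI * x))
      (fun x => (- (PI * PI) - Q n c E s x) * (u x * sin (PI * x)))); [lra| |].
    - intros x _; auto_derive.
      + split; [exact (ex_intro _ _ (proj1 Hs x))|exact (conj (ex_intro _ _ (proj2 Hs x)) I)].
      + rewrite (is_derive_unique (fun x : R => u x) _ _ (proj1 Hs x)),
          (is_derive_unique (fun x : R => du x) _ _ (proj2 Hs x)); ring.
    - intros x Hx; specialize (HQ x Hx); specialize (Hpos x ltac:(lra)).
      assert (0 <= sin (PI * x)) by (apply sin_ge_0; nra).
      apply Rmult_le_pos; [nra|nra]. }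
  rewrite Rmult_0_r, Rmult_1_r, cos_0, sin_0, cos_PI, sin_PI in H.
  pose proof (Hpos 0 ltac:(lra)); pose proof (Hpos 1 ltac:(lra)); nra.
Qed.

(* The largest energy below which [chi] stays positive is an odd level, and the
   slope [chi'(0)] changes sign below it. *)
Lemma two_levels (n : nat) (c : nat -> R) (s : R) :
  0 < c (S n) -> 0 <= s -> exists E E', E < E' /\ spec n c s E /\ spec n c s E'.
Proof.
  intros Hc Hs.
  destruct (Q_ge_1_everywhere n c s Hc) as [lo Hlo].
  destruct (continuous_bounded (U n c s) 0 1) as [B [HB0 HB]]; [intros; apply U_continuous|].
  (* At energy B + 8 or more, 2 (U - E) <= - 16 on [0, 1], as [chi_oscillates] requires. *)
  set (hi := Rmax lo (B + 8)).
  assert (Hlohi : lo <= hi) by apply Rmax_l.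
  assert (HhiB : B + 8 <= hi) by apply Rmax_r.
  set (M := Rabs lo + Rabs hi + s + 1).
  pose proof (Rabs_pos lo); pose proof (Rabs_pos hi).
  pose proof (Rle_abs lo); pose proof (Rle_abs hi); pose proof (Rle_abs (- lo)) as Hl; pose proof (Rle_abs (- hi)) as Hh.
  rewrite Rabs_Ropp in Hl, Hh.
  assert (Bx : forall E, lo <= E <= hi -> box M E s).
  { intros E HE; unfold M; split; [apply Rabs_le; lra|lra]. }
  destruct (admissible_exists n c M Hc) as [X Ha]; pose proof (proj1 Ha) as HX.
  set (f := fun E => chi n c X E s).
  assert (Hd : forall E, lo <= E <= hi -> dec (Q n c E s) X (f E) (dchi n c X E s)).
  { intros E HE; apply (chi_dec n c M); auto. }
  assert (Z : forall t, Rabs (t - t) = 0) by (intros; rewrite Rminus_diag_eq, Rabs_R0; reflexivity).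
  destruct (chi_below_potential n c M X lo s Ha (Bx lo ltac:(lra))) as [Plo Dlo].
  { intros x Hx; apply Hlo; lra. }
  fold (f lo) in Plo.
  assert (Hosc : ~ (forall x, 0 <= x <= X -> 0 < f hi x)).
  { intros Hp; apply (chi_oscillates n c M X hi s Ha (Bx hi ltac:(lra))).
    - intros x Hx; specialize (HB x Hx); apply Rabs_le_between in HB; unfold Q; lra.
    - intros x Hx; destruct (Rle_dec x X) as [h|h]; [apply Hp; lra|].
      destruct (Hd hi ltac:(lra)) as [_ [_ Hp']]; apply Hp'; lra. }
  destruct (completeness (fun E => lo <= E <= hi /\ forall x, 0 <= x <= X -> 0 < f E x))
    as [sg [Hub Hlub]].
  { exists hi; intros E [HE _]; lra. }
  { exists lo; split; [lra|intros x Hx; apply Plo; lra]. }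
  assert (Hsg1 : lo <= sg) by (apply Hub; split; [lra|intros x Hx; apply Plo; lra]).
  assert (Hsg2 : sg <= hi) by (apply Hlub; intros E [HE _]; lra).
  assert (Hclose := chi_close n c M X sg s Ha (Bx sg ltac:(lra))).
  fold (f sg) in Hclose.
  destruct (Hd sg ltac:(lra)) as [Hsol [HfX _]].
  assert (Hnonneg : forall x, 0 <= x <= X -> 0 <= f sg x).
  { intros x Hx; destruct (Rle_dec 0 (f sg x)) as [h|h]; [exact h|exfalso].
    destruct (Hclose (- f sg x) ltac:(lra)) as [eta [Heta HC]].
    destruct (classic (exists E, (lo <= E <= hi /\ forall x, 0 <= x <= X -> 0 < f E x) /\ sg - eta < E))
      as [[E [HE HEe]]|Hn].
    - pose proof (Hub E HE).
      destruct (HC E s (Bx E (proj1 HE)) ltac:(rewrite Rabs_left1; lra) ltac:(rewrite Z; lra) x Hx) as [K _].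
      pose proof (proj2 HE x Hx) as Kp; unfold f in *; apply Rabs_def2 in K; lra.
    - assert (sg <= sg - eta); [|lra].
      apply Hlub; intros E HE; destruct (Rle_dec E (sg - eta)) as [k|k]; [exact k|exfalso].
      apply Hn; exists E; split; [exact HE|lra]. }
  assert (Hzero : exists x0, 0 <= x0 <= X /\ f sg x0 = 0).
  { destruct (continuity_ab_min (f sg) 0 X) as [x0 [Hmin Hx0]]; [lra| |].
    { intros x _; apply continuity_pt_filterlim; apply (sol_continuous _ _ _ x Hsol). }
    exists x0; split; [exact Hx0|].
    destruct (Req_dec (f sg x0) 0) as [e|e]; [exact e|exfalso].
    pose proof (Hnonneg x0 Hx0).
    destruct (Hclose (f sg x0) ltac:(lra)) as [eta [Heta HC]].
    assert (Hpos : forall E, lo <= E <= hi -> Rabs (E - sg) < eta -> forall x, 0 <= x <= X -> 0 < f E x).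
    { intros E HE NE x Hx.
      destruct (HC E s (Bx E HE) NE ltac:(rewrite Z; lra) x Hx) as [K _].
      fold (f E) in K; apply Rabs_def2 in K; specialize (Hmin x Hx); lra. }
    destruct (Req_dec sg hi) as [k|k].
    - apply Hosc; intros x Hx; apply Hpos; trivial; [lra|rewrite <- k, Z; exact Heta].
    - set (E := Rmin hi (sg + eta / 2)).
      assert (sg < E) by (unfold E; apply Rmin_glb_lt; lra).
      assert (E <= hi) by apply Rmin_l.
      assert (E <= sg + eta / 2) by apply Rmin_r.
      assert (E <= sg); [|lra].
      apply Hub; split; [lra|]; intros x Hx; apply Hpos; trivial; [lra|rewrite Rabs_right; lra]. }
  destruct Hzero as [x0 [Hx0 E0]].
  (* An interior zero of a nonnegative function is a minimum, hence a double zero, which a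
     nontrivial solution cannot have; at [X] the value is 1. *)
  assert (Hx00 : x0 = 0).
  { destruct (Req_dec x0 0) as [e|e]; [exact e|exfalso].
    assert (x0 <> X) by (intros e'; rewrite e' in E0; lra).
    assert (HD : dchi n c X sg s x0 = 0).
    { pose proof (proj1 Hsol x0) as Hder; apply is_derive_Reals in Hder.
      pose (pr := exist _ _ Hder : derivable_pt (f sg) x0).
      change (dchi n c X sg s x0) with (derive_pt (f sg) x0 pr).
      apply (deriv_minimum (f sg) 0 X x0 pr); [lra|lra|].
      intros x Hx Hx'; rewrite E0; apply Hnonneg; lra. }
    destruct (chi_nontrivial n c M X sg s x0 Ha (Bx sg ltac:(lra))) as [h|h]; [exact (h E0)|exact (h HD)]. }
  subst x0.
  assert (HD : 0 < dchi n c X sg s 0).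
  { destruct (chi_nontrivial n c M X sg s 0 Ha (Bx sg ltac:(lra))) as [h|h]; [contradiction|].
    destruct (Rlt_dec 0 (dchi n c X sg s 0)) as [k|k]; [exact k|exfalso].
    destruct (Hsol) as [Hder _].
    assert (Hl' := Hder 0); apply is_derive_Reals in Hl'.
    destruct (Hl' (- dchi n c X sg s 0) ltac:(lra)) as [d Hdd].
    set (t := Rmin (d / 2) X).
    pose proof (cond_pos d).
    assert (Ht : 0 < t) by (unfold t; apply Rmin_glb_lt; lra).
    assert (t <= d / 2) by apply Rmin_l; assert (t <= X) by apply Rmin_r.
    specialize (Hdd t ltac:(lra) ltac:(rewrite Rabs_pos_eq; lra)).
    rewrite Rplus_0_l, E0, Rminus_0_r in Hdd.
    apply Rabs_def2 in Hdd.
    assert (0 <= f sg t / t) by (apply Rmult_le_pos; [apply Hnonneg; lra|now apply Rlt_le, Rinv_0_lt_compat]).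
    lra. }
  assert (Hlosg : lo < sg).
  { destruct (Req_dec lo sg) as [e|e]; [|lra].
    specialize (Plo 0 (Rle_refl 0)); rewrite e in Plo; lra. }
  (* Used at the given s itself, as an intermediate value theorem in the energy. *)
  destruct (sign_change_persists (fun E s => dchi n c X E s 0) M lo sg s) as [eta [Heta HI]].
  - apply (chi_0_continuous n c M X Ha).
  - unfold M; lra.
  - exact Hlosg.
  - unfold M; lra.
  - unfold M; lra.
  - assert (0 < - dchi n c X lo s 0 * dchi n c X sg s 0) by (apply Rmult_lt_0_compat; lra); lra.
  - destruct (HI s Hs ltac:(rewrite Z; lra)) as [E [HE EE]].
    exists E, sg; split; [|split].
    + destruct (Req_dec E sg) as [e|e]; [rewrite e in EE; lra|lra].
    + apply (spec_iff n c M X E s Ha (Bx E ltac:(lra))); now right.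
    + apply (spec_iff n c M X sg s Ha (Bx sg ltac:(lra))); now left.
Qed.

(** * Virial identities and large gaps *)

(** The product form of the boundary condition covers both parities and is exactly the boundary term
    of [virial_theorem]. *)
Definition half_line_state (n : nat) (c : nat -> R) (s E : R) (u du : R -> R) : Prop :=
  sol (Q n c E s) u du /\
  (exists C, forall x, 0 <= x -> Rabs (u x) <= C * exp (- x) /\ Rabs (du x) <= C * exp (- x)) /\
  u 0 * du 0 = 0 /\ exists x, 0 <= x /\ u x <> 0.

Lemma state_fast (n : nat) (c : nat -> R) (s E E' : R) (u du v dv : R -> R) :
  half_line_state n c s E u du -> half_line_state n c s E' v dv ->
  fast (fun x => u x * v x) /\ fast (fun x => u x * dv x) /\ fast (fun x => du x * dv x).
Proof.
  intros [Hu [[C HC] _]] [Hv [[D HD] _]].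
  pose proof (fun x => proj1 (sol_continuous _ _ _ x Hu)) as C1.
  pose proof (fun x => proj2 (sol_continuous _ _ _ x Hu)) as C2.
  pose proof (fun x => proj1 (sol_continuous _ _ _ x Hv)) as C3.
  pose proof (fun x => proj2 (sol_continuous _ _ _ x Hv)) as C4.
  repeat split; try (apply (fast_mult_exp _ _ C D)); trivial; intros x Hx;
    try apply HC; try apply HD; exact Hx.
Qed.

Lemma fast_U (n : nat) (c : nat -> R) (s : R) (f : R -> R) :
  fast f -> fast (fun x => U n c s x * f x) /\ fast (fun x => dU n c s x * f x).
Proof.
  intros Hf; split.
  - apply (fast_ext (fun x => sum_f_R0 (fun k => c k * s ^ (S n - k) * (x ^ (2 * S k) * f x)) (S n))).
    + intros x; unfold U; rewrite Rmult_comm, scal_sum; apply sum_eq; intros; ring.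
    + apply (fast_sum (fun k x => c k * s ^ (S n - k) * (x ^ (2 * S k) * f x))).
      intros k; apply fast_scal, fast_pow, Hf.
  - apply (fast_ext (fun x => sum_f_R0 (fun k => c k * s ^ (S n - k) * INR (2 * S k) * (x ^ pred (2 * S k) * f x)) (S n))).
    + intros x; unfold dU; rewrite Rmult_comm, scal_sum; apply sum_eq; intros; ring.
    + apply (fast_sum (fun k x => c k * s ^ (S n - k) * INR (2 * S k) * (x ^ pred (2 * S k) * f x))).
      intros k; apply fast_scal, fast_pow, Hf.
Qed.

Definition moment (u : R -> R) (k : nat) : R := J (fun x => x ^ k * (u x * u x)).

(** The density u'^2 + 2 (E - U) u^2 has derivative - 2 U' u^2, and U(0) = 0. *)
Lemma virial_boundary (n : nat) (c : nat -> R) (s E : R) (u du : R -> R) :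
  half_line_state n c s E u du ->
  du 0 ^ 2 + 2 * E * u 0 ^ 2 = 2 * J (fun x => dU n c s x * (u x * u x)).
Proof.
  intros Hst; destruct (state_fast n c s E E u du u du Hst Hst) as [F0 [F1 F2]].
  destruct (fast_U n c s _ F0) as [FU FdU].
  pose proof (proj1 Hst) as [H1 H2].
  assert (HJ : J (fun x => - 2 * (dU n c s x * (u x * u x)))
      = - (du 0 * du 0 + (2 * E * (u 0 * u 0) - 2 * (U n c s 0 * (u 0 * u 0))))).
  { apply (J_derive (fun x => du x * du x + (2 * E * (u x * u x) - 2 * (U n c s x * (u x * u x))))).
    - intros x; pose proof (U_derive n c s x) as H3; auto_derive.
      + repeat split; eexists; eauto.
      + rewrite (is_derive_unique (fun x : R => u x) _ _ (H1 x)),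
          (is_derive_unique (fun x : R => du x) _ _ (H2 x)),
          (is_derive_unique (fun x : R => U n c s x) _ _ H3); unfold Q; ring.
    - apply fast_plus; [exact F2|]; apply fast_minus; now apply fast_scal.
    - now apply fast_scal. }
  rewrite J_scal, U_0 in HJ by exact FdU; lra.
Qed.

(** [G] is x times the density of [virial_boundary], minus u u'; the subtraction cancels u'^2 in the
    derivative, so no kinetic term remains. *)
Lemma virial_theorem (n : nat) (c : nat -> R) (s E : R) (u du : R -> R) :
  half_line_state n c s E u du ->
  4 * E * J (fun x => u x * u x) = J (fun x => (4 * U n c s x + 2 * x * dU n c s x) * (u x * u x)).
Proof.
  intros Hst; destruct (state_fast n c s E E u du u du Hst Hst) as [F0 [F1 F2]].
  destruct (fast_U n c s _ F0) as [FU FdU].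
  pose proof (fast_pow 1 _ FdU) as FxdU.
  pose proof (proj1 Hst) as [H1 H2].
  assert (FV : fast (fun x => (4 * U n c s x + 2 * x * dU n c s x) * (u x * u x))).
  { apply (fast_ext (fun x => 4 * (U n c s x * (u x * u x)) + 2 * (x ^ 1 * (dU n c s x * (u x * u x))))).
    - intros x; ring.
    - apply fast_plus; now apply fast_scal. }
  set (G := fun x => x ^ 1 * (du x * du x + (2 * E * (u x * u x) - 2 * (U n c s x * (u x * u x))))
                     - u x * du x).
  assert (HJ : J (fun x => 4 * E * (u x * u x) - (4 * U n c s x + 2 * x * dU n c s x) * (u x * u x))
      = - G 0).
  { apply (J_derive G).
    - intros x; pose proof (U_derive n c s x) as H3; unfold G; auto_derive.
      + repeat split; eexists; eauto.
      + rewrite (is_derive_unique (fun x : R => u x) _ _ (H1 x)),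
          (is_derive_unique (fun x : R => du x) _ _ (H2 x)),
          (is_derive_unique (fun x : R => U n c s x) _ _ H3); unfold Q; ring.
    - apply fast_minus; [|exact F1].
      apply (fast_pow 1), fast_plus; [exact F2|]; apply fast_minus; now apply fast_scal.
    - apply fast_minus; [now apply fast_scal|exact FV]. }
  rewrite J_minus, J_scal in HJ by (trivial; now apply fast_scal).
  unfold G in HJ; destruct Hst as [_ [_ [E0 _]]]; rewrite E0 in HJ; simpl in HJ; lra.
Qed.

(** The derivative of x^2 u u' - x u^2 is x^2 u'^2 + x^2 Q u^2 - u^2. Dropping the nonnegative first
    term leaves an upper bound for a moment two orders above the potential. *)
Lemma kinetic_inequality (n : nat) (c : nat -> R) (s E : R) (u du : R -> R) :
  half_line_state n c s E u du ->
  2 * J (fun x => x ^ 2 * (U n c s x * (u x * u x))) <= 2 * E * moment u 2 + J (fun x => u x * u x).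
Proof.
  intros Hst; destruct (state_fast n c s E E u du u du Hst Hst) as [F0 [F1 F2]].
  destruct (fast_U n c s _ F0) as [FU FdU].
  pose proof (fast_pow 2 _ F2) as Fx2; pose proof (fast_pow 2 _ FU) as FxU.
  pose proof (fast_pow 2 _ F0) as Fx0.
  pose proof (proj1 Hst) as [H1 H2].
  set (G := fun x => x ^ 2 * (u x * du x) - x ^ 1 * (u x * u x)).
  set (g1 := fun x => 2 * (x ^ 2 * (U n c s x * (u x * u x))) - 2 * E * (x ^ 2 * (u x * u x))).
  assert (Fg1 : fast g1) by (apply fast_minus; now apply fast_scal).
  assert (HJ : J (fun x => x ^ 2 * (du x * du x) + (g1 x - u x * u x)) = - G 0).
  { apply (J_derive G).
    - intros x; unfold G; auto_derive.
      + repeat split; eexists; eauto.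
      + rewrite (is_derive_unique (fun x : R => u x) _ _ (H1 x)),
          (is_derive_unique (fun x : R => du x) _ _ (H2 x)); unfold Q, g1; ring.
    - apply fast_minus; now apply fast_pow.
    - apply fast_plus; [exact Fx2|now apply fast_minus]. }
  rewrite J_plus, J_minus in HJ by (trivial; now apply fast_minus).
  unfold g1 in HJ; rewrite J_minus, !J_scal in HJ by (trivial; now apply fast_scal).
  assert (0 <= J (fun x => x ^ 2 * (du x * du x))).
  { apply J_nonneg; [exact Fx2|]; intros x _; pose proof (Rle_0_sqr (du x)); unfold Rsqr in *; nra. }
  assert (G0 : G 0 = 0) by (unfold G; ring).
  fold (moment u 2) in HJ; rewrite G0 in HJ; lra.
Qed.

Lemma J_le_moments (u phi : R -> R) (a b : R) (i j : nat) :
  fast (fun x => u x * u x) -> fast (fun x => phi x * (u x * u x)) ->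
  (forall x, 0 <= x -> phi x <= a * x ^ i + b * x ^ j) ->
  J (fun x => phi x * (u x * u x)) <= a * moment u i + b * moment u j.
Proof.
  intros F0 Fp H; unfold moment.
  pose proof (fast_pow i _ F0) as Fi; pose proof (fast_pow j _ F0) as Fj.
  rewrite <- !J_scal, <- J_plus by (trivial; now apply fast_scal).
  apply J_le; [exact Fp|now apply fast_plus; apply fast_scal|].
  intros x Hx; specialize (H x Hx); pose proof (Rle_0_sqr (u x)); unfold Rsqr in *; nra.
Qed.

Lemma J_ge_moments (u phi : R -> R) (a b : R) (i j : nat) :
  fast (fun x => u x * u x) -> fast (fun x => phi x * (u x * u x)) ->
  (forall x, 0 <= x -> a * x ^ i + b * x ^ j <= phi x) ->
  a * moment u i + b * moment u j <= J (fun x => phi x * (u x * u x)).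
Proof.
  intros F0 Fp H.
  assert (Fm : fast (fun x => (-1 * phi x) * (u x * u x))).
  { apply (fast_ext (fun x => (-1) * (phi x * (u x * u x)))); [intros; ring|now apply fast_scal]. }
  pose proof (J_le_moments u (fun x => -1 * phi x) (- a) (- b) i j F0 Fm) as HJ.
  rewrite (J_ext _ (fun x => (-1) * (phi x * (u x * u x)))) in HJ by (intros; ring).
  rewrite J_scal in HJ by exact Fp.
  assert (forall x, 0 <= x -> -1 * phi x <= - a * x ^ i + - b * x ^ j).
  { intros x Hx; specialize (H x Hx); lra. }
  specialize (HJ H0); lra.
Qed.

Lemma moment_le (u : R -> R) (k : nat) (a b : R) (i j : nat) :
  fast (fun x => u x * u x) -> (forall x, 0 <= x -> x ^ k <= a * x ^ i + b * x ^ j) ->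
  moment u k <= a * moment u i + b * moment u j.
Proof.
  intros F0 H; apply (J_le_moments u (fun x => x ^ k)); trivial; now apply fast_pow.
Qed.

Lemma moment_nonneg (u : R -> R) (k : nat) : fast (fun x => u x * u x) -> 0 <= moment u k.
Proof.
  intros F0; apply J_nonneg; [now apply fast_pow|].
  intros x Hx; apply Rmult_le_pos; [now apply pow_le|apply Rle_0_sqr].
Qed.

Lemma moment_0 (u : R -> R) : moment u 0 = J (fun x => u x * u x).
Proof. unfold moment; apply J_ext; intros x; rewrite pow_O; ring. Qed.

Lemma virial_weight_bounds (n : nat) (c : nat -> R) (M : R) :
  0 < c (S n) -> exists A, 0 < A /\ forall s x, 0 <= s <= M -> 0 <= x ->
    4 * U n c s x + 2 * x * dU n c s x <= A * x ^ 0 + A * x ^ (2 * n + 4) /\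
    2 * c (S n) * x ^ (2 * n + 4) + - A * x ^ 0 <= 4 * U n c s x + 2 * x * dU n c s x.
Proof.
  intros Hc; destruct (U_leading n c M) as [K [HK H]]; destruct (U_lower n c M Hc) as [C [HC HL]].
  set (m := INR (2 * n + 4)).
  assert (Hm : 1 <= m) by (unfold m; apply (le_INR 1); lia).
  (* The leading part of 2 x U' pays for all of its own lower-order errors; the coefficient 2 c in
     the lower bound then comes from 4 U alone. *)
  destruct (pow_absorb (2 * n + 3) (2 * n + 4) (4 * K) (2 * (m * c (S n)))) as [C' [HC' Hab]];
    [lia|lra|assert (0 < m * c (S n)) by (apply Rmult_lt_0_compat; lra); lra|].
  assert (Hmc : 0 < m * c (S n)) by (apply Rmult_lt_0_compat; lra).
  exists (4 * c (S n) + 2 * (m * c (S n)) + 12 * K + 4 * C + C').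
  split; [lra|]; intros s x Hs Hx.
  destruct (H s x Hs Hx) as [H1 H2]; specialize (HL s x Hs Hx); specialize (Hab x Hx).
  apply Rabs_le_between in H1; apply Rabs_le_between in H2; fold m in H2.
  pose proof (pow_le_1_plus x (2 * n + 2) (2 * n + 4) Hx ltac:(lia)) as P1.
  pose proof (pow_le_1_plus x (2 * n + 3) (2 * n + 4) Hx ltac:(lia)) as P2.
  pose proof (pow_le_1_plus x 1 (2 * n + 4) Hx ltac:(lia)) as P3.
  pose proof (pow_le_1_plus x 1 (2 * n + 3) Hx ltac:(lia)) as P4.
  pose proof (pow_le x (2 * n + 4) Hx) as P5.
  rewrite pow_1 in P3, P4; rewrite pow_O.
  assert (E1 : x * x ^ (2 * n + 2) = x ^ (2 * n + 3)).
  { replace (2 * n + 3)%nat with (S (2 * n + 2)) by lia; reflexivity. }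
  assert (E2 : x * x ^ (2 * n + 3) = x ^ (2 * n + 4)).
  { replace (2 * n + 4)%nat with (S (2 * n + 3)) by lia; reflexivity. }
  set (y := x ^ (2 * n + 4)) in *; set (z := x ^ (2 * n + 3)) in *; set (w := x ^ (2 * n + 2)) in *.
  assert (D1 : x * dU n c s x <= m * c (S n) * y + K * (x + z)).
  { apply Rle_trans with (x * (m * c (S n) * z + K * (1 + w))).
    - apply Rmult_le_compat_l; lra.
    - rewrite <- E2, <- E1; right; ring. }
  assert (D2 : m * c (S n) * y - K * (x + z) <= x * dU n c s x).
  { apply Rle_trans with (x * (m * c (S n) * z - K * (1 + w))).
    - rewrite <- E2, <- E1; right; ring.
    - apply Rmult_le_compat_l; lra. }
  assert (Q1 : K * w <= K * (1 + y)) by (apply Rmult_le_compat_l; lra).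
  assert (Q2 : K * z <= K * (1 + y)) by (apply Rmult_le_compat_l; lra).
  assert (Q3 : K * x <= K * (1 + y)) by (apply Rmult_le_compat_l; lra).
  assert (Q4 : K * x <= K * (1 + z)) by (apply Rmult_le_compat_l; lra).
  assert (Q5 : 0 <= K * y) by (apply Rmult_le_pos; lra).
  assert (Q6 : 0 <= C * y) by (apply Rmult_le_pos; lra).
  assert (Q7 : 0 <= C' * y) by (apply Rmult_le_pos; lra).
  split; lra.
Qed.

(* With [E = e^4] the virial identities place the mass at distances where
   [U' >> sqrt E]: the moments of order [2r] and [2r + 2] are of size [e^4] and
   at most [e^6], and interpolation bounds the moment of order [2r - 1] below by [e^3]. *)
Lemma force_lower_bound (n : nat) (c : nat -> R) (M : R) :
  0 < c (S n) -> exists kap e0, 0 < kap /\ 1 <= e0 /\ forall s e u du,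
    0 <= s <= M -> e0 <= e -> half_line_state n c s (e ^ 4) u du ->
    kap * e ^ 3 * J (fun x => u x * u x) <= J (fun x => dU n c s x * (u x * u x)).
Proof.
  intros Hc.
  destruct (U_leading n c M) as [K [HK HU]]; destruct (U_lower n c M Hc) as [C [HC HL]].
  destruct (virial_weight_bounds n c M Hc) as [A [HA HV]].
  set (be := c (S n)) in *; set (m := INR (2 * n + 4)) in *.
  assert (Hm : 1 <= m) by (unfold m; apply (le_INR 1); lia).
  assert (Hmb : 0 < m * be) by (apply Rmult_lt_0_compat; lra).
  destruct (pow_absorb (2 * n + 2) (2 * n + 3) K (m * be / 2)) as [C3 [HC3 Hab]]; [lia|lra|lra|].
  set (A2 := (4 + A) / (2 * be)).
  assert (HA2 : 0 < A2) by (apply Rdiv_lt_0_compat; lra).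
  set (A3 := 2 / be * ((1 + C) * (2 + A2) + 1)).
  assert (Hib : 0 < 2 / be) by (apply Rdiv_lt_0_compat; lra).
  assert (HA3 : 0 < A3).
  { apply Rmult_lt_0_compat; [lra|]; assert (0 <= (1 + C) * (2 + A2)) by (apply Rmult_le_pos; lra); lra. }
  (* The cut is made at T = tau e. Since tau^2 >= A A3, the mass beyond [T] accounts for at most
     half of the bound 2 e^4 N <= A mm. *)
  set (tau := 1 + A * A3).
  assert (HAA : 0 < A * A3) by (now apply Rmult_lt_0_compat).
  assert (Htau : 1 <= tau) by (unfold tau; lra).
  set (A4 := m * be / 2 / (A * tau)).
  assert (HAt : 0 < A * tau) by (apply Rmult_lt_0_compat; lra).
  assert (HA4 : 0 < A4) by (apply Rdiv_lt_0_compat; lra).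
  set (C5 := C3 + K).
  (* For e this large, e^4 dominates [A], and half of the gain [A4 * e ^ 3] pays for the lower-order
     part [C5] of the force. *)
  exists (A4 / 2), (1 + A + 2 * C5 / A4).
  assert (HC5 : 0 <= 2 * C5 / A4).
  { apply Rmult_le_pos; [unfold C5; lra|now apply Rlt_le, Rinv_0_lt_compat]. }
  split; [lra|split; [lra|]].
  intros s e u du Hs He Hst.
  destruct (state_fast n c s _ _ u du u du Hst Hst) as [F0 _].
  destruct (fast_U n c s _ F0) as [FU FdU].
  set (N := moment u 0).
  assert (HN : 0 <= N) by (now apply moment_nonneg).
  assert (EN : J (fun x => u x * u x) = N) by (symmetry; apply moment_0).
  assert (E1 : 1 <= e) by lra.
  assert (E2 : 1 <= e ^ 2) by (apply pow_R1_Rle; lra).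
  assert (E3 : e <= e ^ 3) by (rewrite <- (pow_1 e) at 1; apply Rle_pow; [lra|lia]).
  assert (E4 : e <= e ^ 4) by (rewrite <- (pow_1 e) at 1; apply Rle_pow; [lra|lia]).
  pose proof (virial_theorem n c s _ u du Hst) as V2; rewrite EN in V2.
  assert (FV : fast (fun x => (4 * U n c s x + 2 * x * dU n c s x) * (u x * u x))).
  { apply (fast_ext (fun x => 4 * (U n c s x * (u x * u x)) + 2 * (x ^ 1 * (dU n c s x * (u x * u x))))).
    - intros x; ring.
    - apply fast_plus; apply fast_scal; [exact FU|now apply (fast_pow 1)]. }
  assert (B1 : 4 * e ^ 4 * N <= A * N + A * moment u (2 * n + 4)).
  { rewrite V2; apply J_le_moments; trivial; intros x Hx; apply HV; trivial. }
  assert (B2 : 2 * be * moment u (2 * n + 4) + - A * N <= 4 * e ^ 4 * N).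
  { rewrite V2; apply J_ge_moments; trivial; intros x Hx; apply HV; trivial. }
  set (mm := moment u (2 * n + 4)) in *.
  assert (N4 : N <= e ^ 4 * N) by (rewrite <- (Rmult_1_l N) at 1; apply Rmult_le_compat_r; lra).
  assert (B3 : 2 * e ^ 4 * N <= A * mm).
  { assert (A * N <= e ^ 4 * N) by (apply Rmult_le_compat_r; lra). lra. }
  assert (B4 : mm <= A2 * (e ^ 4 * N)).
  { apply Rmult_le_reg_l with (2 * be); [lra|].
    replace (2 * be * (A2 * (e ^ 4 * N))) with ((4 + A) * (e ^ 4 * N)) by (unfold A2; field; lra).
    assert (A * N <= A * (e ^ 4 * N)) by (apply Rmult_le_compat_l; lra). lra. }
  (* The assumption r >= 2 enters here: x^4 <= 1 + x^(2r). *)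
  assert (B5 : moment u 4 <= N + mm).
  { replace (N + mm) with (1 * N + 1 * mm) by ring; apply moment_le; [exact F0|].
    intros x Hx; pose proof (pow_le_1_plus x 4 (2 * n + 4) Hx ltac:(lia)); rewrite pow_O; lra. }
  assert (B6 : e ^ 2 * moment u 2 <= e ^ 4 * N + moment u 4).
  { assert (moment u 2 <= e ^ 2 * N + / e ^ 2 * moment u 4).
    { apply moment_le; [exact F0|]; intros x Hx; rewrite pow_O.
      apply Rmult_le_reg_l with (e ^ 2); [lra|].
      replace (e ^ 2 * (e ^ 2 * 1 + / e ^ 2 * x ^ 4)) with (e ^ 2 * e ^ 2 + x ^ 2 * x ^ 2) by (field; lra).
      set (p := e ^ 2); set (q := x ^ 2).
      pose proof (Rle_0_sqr (p - q)); pose proof (Rle_0_sqr p); pose proof (Rle_0_sqr q); unfold Rsqr in *; nra. }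
    apply Rle_trans with (e ^ 2 * (e ^ 2 * N + / e ^ 2 * moment u 4)).
    - apply Rmult_le_compat_l; lra.
    - right; field; lra. }
  assert (B7 : e ^ 2 * moment u 2 <= (2 + A2) * (e ^ 4 * N)) by lra.
  pose proof (kinetic_inequality n c s _ u du Hst) as V3; rewrite EN in V3.
  assert (FxU : fast (fun x => (x ^ 2 * U n c s x) * (u x * u x))).
  { apply (fast_ext (fun x => x ^ 2 * (U n c s x * (u x * u x)))); [intros; ring|now apply fast_pow]. }
  assert (B8 : be / 2 * moment u (2 * n + 6) + - C * moment u 2
               <= J (fun x => x ^ 2 * (U n c s x * (u x * u x)))).
  { rewrite (J_ext _ (fun x => (x ^ 2 * U n c s x) * (u x * u x))) by (intros; ring).
    apply J_ge_moments; trivial; intros x Hx; specialize (HL s x Hs Hx).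
    replace (x ^ (2 * n + 6)) with (x ^ 2 * x ^ (2 * n + 4)) by (rewrite <- pow_add; f_equal; lia).
    pose proof (pow_le x 2 Hx).
    apply Rle_trans with (x ^ 2 * (be / 2 * x ^ (2 * n + 4) - C)); [right; ring|].
    apply Rmult_le_compat_l; lra. }
  set (mp := moment u (2 * n + 6)) in *; set (m2 := moment u 2) in *.
  assert (Hm2 : 0 <= m2) by (now apply moment_nonneg).
  assert (B9 : mp <= A3 * (e ^ 6 * N)).
  { assert (Hp : be / 2 * mp <= (1 + C) * (e ^ 4 * m2) + e ^ 6 * N).
    { assert (C * m2 <= C * (e ^ 4 * m2)).
      { apply Rmult_le_compat_l; [lra|]; rewrite <- (Rmult_1_l m2) at 1; apply Rmult_le_compat_r; lra. }
      assert (N <= e ^ 6 * N).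
      { rewrite <- (Rmult_1_l N) at 1; apply Rmult_le_compat_r; [lra|apply pow_R1_Rle; lra]. }
      lra. }
    assert (Hq : e ^ 4 * m2 <= (2 + A2) * (e ^ 6 * N)).
    { replace (e ^ 4 * m2) with (e ^ 2 * (e ^ 2 * m2)) by ring.
      replace ((2 + A2) * (e ^ 6 * N)) with (e ^ 2 * ((2 + A2) * (e ^ 4 * N))) by ring.
      apply Rmult_le_compat_l; lra. }
    assert ((1 + C) * (e ^ 4 * m2) <= (1 + C) * ((2 + A2) * (e ^ 6 * N)))
      by (apply Rmult_le_compat_l; lra).
    apply Rmult_le_reg_l with (be / 2); [lra|].
    replace (be / 2 * (A3 * (e ^ 6 * N))) with (((1 + C) * (2 + A2) + 1) * (e ^ 6 * N))
      by (unfold A3; field; lra).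
    lra. }
  set (T := tau * e).
  assert (HT : 1 <= T) by (unfold T; rewrite <- (Rmult_1_l 1); apply Rmult_le_compat; lra).
  (* Interpolation by cutting at [T]: below it x^(2r) <= T x^(2r-1), above it x^(2r) <= x^(2r+2) /
     T^2. *)
  assert (B10 : mm <= T * moment u (2 * n + 3) + / T ^ 2 * mp).
  { apply moment_le; [exact F0|]; intros x Hx.
    replace (x ^ (2 * n + 6)) with (x ^ 2 * x ^ (2 * n + 4)) by (rewrite <- pow_add; f_equal; lia).
    pose proof (pow_le x (2 * n + 4) Hx); pose proof (pow_le x (2 * n + 3) Hx).
    assert (ET : x ^ (2 * n + 4) = x * x ^ (2 * n + 3))
      by (replace (2 * n + 4)%nat with (S (2 * n + 3)) by lia; reflexivity).
    assert (HT2 : 0 < T ^ 2) by (apply pow_lt; lra).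
    assert (HiT : 0 < / T ^ 2) by now apply Rinv_0_lt_compat.
    destruct (Rle_dec x T) as [h|h].
    - assert (x * x ^ (2 * n + 3) <= T * x ^ (2 * n + 3)) by (apply Rmult_le_compat_r; lra).
      assert (0 <= / T ^ 2 * (x ^ 2 * x ^ (2 * n + 4))).
      { apply Rmult_le_pos; [lra|apply Rmult_le_pos; [apply pow_le; lra|lra]]. }
      lra.
    - assert (T ^ 2 <= x ^ 2) by (apply pow_incr; lra).
      assert (1 <= / T ^ 2 * x ^ 2).
      { rewrite <- (Rinv_l (T ^ 2)) by lra; apply Rmult_le_compat_l; lra. }
      assert (1 * x ^ (2 * n + 4) <= / T ^ 2 * x ^ 2 * x ^ (2 * n + 4))
        by (apply Rmult_le_compat_r; lra).
      assert (0 <= T * x ^ (2 * n + 3)) by (apply Rmult_le_pos; lra).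
      lra. }
  set (mq := moment u (2 * n + 3)) in *.
  assert (B11 : A * (/ T ^ 2 * mp) <= e ^ 4 * N).
  { assert (HT2 : 0 < T ^ 2) by (apply pow_lt; lra).
    apply Rmult_le_reg_l with (T ^ 2); [exact HT2|].
    replace (T ^ 2 * (A * (/ T ^ 2 * mp))) with (A * mp) by (field; lra).
    apply Rle_trans with (A * (A3 * (e ^ 6 * N))); [apply Rmult_le_compat_l; lra|].
    replace (T ^ 2 * (e ^ 4 * N)) with (tau ^ 2 * (e ^ 6 * N)) by (unfold T; ring).
    rewrite <- Rmult_assoc; apply Rmult_le_compat_r.
    - apply Rmult_le_pos; [apply pow_le; lra|exact HN].
    - unfold tau; nra. }
  assert (B12 : e ^ 3 * N <= A * tau * mq).
  { apply Rmult_le_reg_l with e; [lra|].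
    assert (A * mm <= A * (T * mq + / T ^ 2 * mp)) by (apply Rmult_le_compat_l; lra).
    replace (e * (A * tau * mq)) with (A * (T * mq)) by (unfold T; ring).
    replace (e * (e ^ 3 * N)) with (e ^ 4 * N) by ring; lra. }
  assert (B13 : m * be / 2 * mq + - C5 * N <= J (fun x => dU n c s x * (u x * u x))).
  { apply J_ge_moments; trivial; intros x Hx; rewrite pow_O.
    destruct (HU s x Hs Hx) as [_ H2]; apply Rabs_le_between in H2; specialize (Hab x Hx).
    fold be in H2; fold m in H2; unfold C5; lra. }
  assert (B14 : A4 * (e ^ 3 * N) <= m * be / 2 * mq).
  { unfold A4; apply Rle_trans with (m * be / 2 / (A * tau) * (A * tau * mq)).
    - apply Rmult_le_compat_l; [now apply Rlt_le, Rdiv_lt_0_compat; lra|exact B12].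
    - right; field; lra. }
  assert (B15 : C5 <= A4 / 2 * e ^ 3).
  { apply Rle_trans with (A4 / 2 * (2 * C5 / A4)); [right; field; lra|].
    apply Rmult_le_compat_l; lra. }
  assert (C5 * N <= A4 / 2 * e ^ 3 * N) by (apply Rmult_le_compat_r; lra).
  rewrite EN; lra.
Qed.

Lemma J_cauchy_schwarz (u v : R -> R) :
  fast (fun x => u x * u x) -> fast (fun x => u x * v x) -> fast (fun x => v x * v x) ->
  0 < J (fun x => v x * v x) ->
  J (fun x => u x * v x) ^ 2 <= J (fun x => u x * u x) * J (fun x => v x * v x).
Proof.
  intros Fuu Fuv Fvv Hv.
  set (a := J (fun x => v x * v x)) in *; set (b := J (fun x => u x * v x)).
  set (f := fun x => a ^ 2 * (u x * u x) + (- 2 * a * b * (u x * v x) + b ^ 2 * (v x * v x))).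
  assert (Ff : fast f) by (apply fast_plus; [|apply fast_plus]; now apply fast_scal).
  assert (Hf : 0 <= J f).
  { apply J_nonneg; [exact Ff|]; intros x _.
    replace (f x) with (Rsqr (a * u x - b * v x)) by (unfold f, Rsqr; ring); apply Rle_0_sqr. }
  unfold f in Hf; rewrite !J_plus, !J_scal in Hf
    by (trivial; try apply fast_plus; now apply fast_scal).
  fold a b in Hf.
  apply Rmult_le_reg_l with a; [exact Hv|].
  set (d := J (fun x => u x * u x)) in *.
  apply Rmult_le_reg_l with a; [exact Hv|]; nra.
Qed.

Lemma state_norm_pos (n : nat) (c : nat -> R) (s E : R) (u du : R -> R) :
  half_line_state n c s E u du -> 0 < J (fun x => u x * u x).
Proof.
  intros Hst; destruct (state_fast n c s E E u du u du Hst Hst) as [F0 _].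
  destruct Hst as [_ [_ [_ [x [Hx Hux]]]]].
  apply (J_pos (fun x => u x * u x) x); trivial.
  - intros y _; apply Rle_0_sqr.
  - now apply Rsqr_pos_lt.
Qed.

Lemma wronskian_integral (n : nat) (c : nat -> R) (s E E' : R) (u du v dv : R -> R) :
  half_line_state n c s E u du -> half_line_state n c s E' v dv ->
  u 0 * dv 0 - du 0 * v 0 = 2 * (E' - E) * J (fun x => u x * v x).
Proof.
  intros Hu Hv.
  destruct (state_fast n c s E E' u du v dv Hu Hv) as [F0 [F1 F2]].
  destruct (state_fast n c s E' E v dv u du Hv Hu) as [_ [F3 _]].
  assert (HJ : J (fun x => (Q n c E' s x - Q n c E s x) * (u x * v x)) = - wronskian u du v dv 0).
  { apply J_derive.
    - intros x; apply wronskian_derive; [apply Hu|apply Hv].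
    - apply fast_minus; [exact F1|]; apply (fast_ext (fun x => v x * du x)); [intros; ring|exact F3].
    - apply (fast_ext (fun x => (- 2 * (E' - E)) * (u x * v x))).
      + intros x; unfold Q; ring.
      + now apply fast_scal. }
  rewrite (J_ext _ (fun x => (- 2 * (E' - E)) * (u x * v x))) in HJ by (intros; unfold Q; ring).
  rewrite J_scal in HJ by exact F0; unfold wronskian in HJ; lra.
Qed.

(** Energies are fourth powers so that E^(3/4) becomes e^3. The norms cancel after multiplying the
    boundary bounds, and [e <= 2 * e'] allows replacing e' by e/2, whence the factor 1/4. Squares
    are used because either level may be the higher one. *)
Lemma even_odd_gap (n : nat) (c : nat -> R) (s e e' kap : R) (u du v dv : R -> R) :
  0 < kap -> 1 <= e -> e <= 2 * e' ->
  half_line_state n c s (e ^ 4) u du -> half_line_state n c s (e' ^ 4) v dv ->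
  du 0 = 0 -> v 0 = 0 ->
  kap * e ^ 3 * J (fun x => u x * u x) <= J (fun x => dU n c s x * (u x * u x)) ->
  kap * e' ^ 3 * J (fun x => v x * v x) <= J (fun x => dU n c s x * (v x * v x)) ->
  (kap * e / 4) ^ 2 <= (e' ^ 4 - e ^ 4) ^ 2.
Proof.
  intros Hk He Hee Hu Hv E0 E1 Fu Fv.
  pose proof (state_norm_pos _ _ _ _ _ _ Hu) as Nu; pose proof (state_norm_pos _ _ _ _ _ _ Hv) as Nv.
  pose proof (virial_boundary _ _ _ _ _ _ Hu) as Vu; pose proof (virial_boundary _ _ _ _ _ _ Hv) as Vv.
  pose proof (wronskian_integral _ _ _ _ _ _ _ _ _ Hu Hv) as W.
  destruct (state_fast _ _ _ _ _ _ _ _ _ Hu Hv) as [Fuv _].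
  destruct (state_fast _ _ _ _ _ _ _ _ _ Hu Hu) as [Fuu _].
  destruct (state_fast _ _ _ _ _ _ _ _ _ Hv Hv) as [Fvv _].
  pose proof (J_cauchy_schwarz u v Fuu Fuv Fvv Nv) as CS.
  rewrite E0, E1 in *.
  set (a := J (fun x => u x * u x)) in *; set (b := J (fun x => v x * v x)) in *.
  set (d := J (fun x => u x * v x)) in *.
  set (p := u 0) in *; set (q := dv 0) in *; set (D := e' ^ 4 - e ^ 4) in *.
  assert (P1 : kap * a <= e * p ^ 2).
  { apply Rmult_le_reg_l with (e ^ 3); [apply pow_lt; lra|].
    replace (e ^ 3 * (e * p ^ 2)) with (e ^ 4 * p ^ 2) by ring; lra. }
  assert (P2 : 2 * (kap * e' ^ 3 * b) <= q ^ 2) by lra.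
  assert (P3 : p ^ 2 * q ^ 2 <= 4 * D ^ 2 * (a * b)).
  { replace (p ^ 2 * q ^ 2) with (4 * D ^ 2 * d ^ 2).
    - apply Rmult_le_compat_l; [|exact CS]; pose proof (pow2_ge_0 D); lra.
    - replace (p ^ 2 * q ^ 2) with ((p * q - 0 * 0) ^ 2) by ring; rewrite W; ring. }
  assert (Hab : 0 < a * b) by (now apply Rmult_lt_0_compat).
  assert (P4 : 2 * kap ^ 2 * e' ^ 3 <= 4 * e * D ^ 2).
  { apply Rmult_le_reg_r with (a * b); [exact Hab|].
    apply Rle_trans with ((e * p ^ 2) * q ^ 2).
    - replace (2 * kap ^ 2 * e' ^ 3 * (a * b)) with ((kap * a) * (2 * (kap * e' ^ 3 * b))) by ring.
      apply Rmult_le_compat; trivial.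
      + apply Rmult_le_pos; lra.
      + apply Rmult_le_pos; [lra|]; apply Rmult_le_pos; [|lra].
        apply Rmult_le_pos; [lra|apply pow_le; lra].
    - replace (e * p ^ 2 * q ^ 2) with (e * (p ^ 2 * q ^ 2)) by ring.
      replace (4 * e * D ^ 2 * (a * b)) with (e * (4 * D ^ 2 * (a * b))) by ring.
      apply Rmult_le_compat_l; lra. }
  assert (P5 : (e / 2) ^ 3 <= e' ^ 3) by (apply pow_incr; lra).
  assert (P6 : 2 * kap ^ 2 * (e / 2) ^ 3 <= 2 * kap ^ 2 * e' ^ 3).
  { apply Rmult_le_compat_l; [|exact P5]; pose proof (pow2_ge_0 kap); lra. }
  apply Rmult_le_reg_l with (4 * e); [lra|].
  replace (4 * e * (kap * e / 4) ^ 2) with (2 * kap ^ 2 * (e / 2) ^ 3) by field; lra.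
Qed.

Lemma chi_state (n : nat) (c : nat -> R) (M X s E : R) :
  admissible n c M X -> box M E s -> spec n c s E ->
  half_line_state n c s E (chi n c X E s) (dchi n c X E s).
Proof.
  intros Ha Hb HS; pose proof (chi_dec n c M X E s Ha Hb) as Hd; pose proof (proj1 Ha) as HX.
  split; [apply Hd|split; [|split]].
  - destruct (dec_global_bound _ _ _ X (Rlt_le _ _ HX) (fun x => proj2 Ha E s x Hb) Hd) as [C [_ HC]].
    now exists C.
  - apply (spec_iff n c M X E s Ha Hb) in HS; destruct HS as [-> | ->]; ring.
  - exists X; split; [lra|]; destruct Hd as [_ [-> _]]; lra.
Qed.

(** If the gap were below G, both energies would be at least L^4 and their roots comparable;
    consecutive levels have opposite parity, so [even_odd_gap] applies with the even one in the
    first place. *)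
Lemma high_gap (n : nat) (c : nat -> R) (M G : R) :
  0 < c (S n) -> exists Emax, forall s E E', 0 <= s <= M -> spec n c s E -> spec n c s E' ->
    E < E' -> (forall t, E < t < E' -> ~ spec n c s t) -> Emax <= E' -> G <= E' - E.
Proof.
  intros Hc; destruct (force_lower_bound n c M Hc) as [kap [e0 [Hk [He0 HF]]]].
  (* The second term makes kap L / 4 exceed |G|; the third excludes x > 2 y when x^4 - y^4 <= |G|,
     because then 15 y^4 <= |G| would follow. *)
  set (L := e0 + 4 * Rabs G / kap + 2 * Rabs G + 1).
  pose proof (Rabs_pos G) as HG; pose proof (Rle_abs G).
  assert (H4 : 0 <= 4 * Rabs G / kap) by (apply Rmult_le_pos; [lra|now apply Rlt_le, Rinv_0_lt_compat]).
  exists (L ^ 4 + Rabs G); intros s E E' Hs S S' Hlt Hgap HE'.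
  destruct (Rle_dec G (E' - E)) as [h|h]; [exact h|exfalso].
  assert (HL : e0 <= L) by (unfold L; lra).
  assert (HL4 : L <= L ^ 4) by (rewrite <- (pow_1 L) at 1; apply Rle_pow; [lra|lia]).
  assert (HE : L ^ 4 <= E) by lra.
  assert (Hroot : forall y, L ^ 4 <= y -> exists e, L <= e /\ e ^ 4 = y).
  { intros y Hy; exists (sqrt (sqrt y)).
    assert (0 <= y) by lra.
    assert (E4 : sqrt (sqrt y) ^ 4 = y).
    { replace (sqrt (sqrt y) ^ 4) with ((sqrt (sqrt y) * sqrt (sqrt y)) * (sqrt (sqrt y) * sqrt (sqrt y))) by ring.
      rewrite sqrt_sqrt by apply sqrt_pos; now apply sqrt_sqrt. }
    split; [|exact E4].
    destruct (Rle_dec L (sqrt (sqrt y))) as [k|k]; [exact k|exfalso].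
    assert (sqrt (sqrt y) ^ 4 < L ^ 4); [|lra].
    assert (Hq := sqrt_pos (sqrt y)).
    assert (Hlt2 : sqrt (sqrt y) ^ 2 < L ^ 2) by nra.
    replace (sqrt (sqrt y) ^ 4) with (sqrt (sqrt y) ^ 2 * sqrt (sqrt y) ^ 2) by ring.
    replace (L ^ 4) with (L ^ 2 * L ^ 2) by ring.
    assert (0 <= sqrt (sqrt y) ^ 2) by (apply pow2_ge_0); nra. }
  destruct (Hroot E HE) as [e [He Ee]]; destruct (Hroot E' ltac:(lra)) as [e' [He' Ee']].
  assert (Hcomp : forall x y, L <= x -> L <= y -> x ^ 4 - y ^ 4 <= Rabs G -> x <= 2 * y).
  { intros x y Hx Hy Hxy; destruct (Rle_dec x (2 * y)) as [k|k]; [exact k|exfalso].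
    assert ((2 * y) ^ 4 <= x ^ 4) by (apply pow_incr; lra).
    assert (y <= y ^ 4) by (rewrite <- (pow_1 y) at 1; apply Rle_pow; [lra|lia]).
    replace ((2 * y) ^ 4) with (16 * y ^ 4) in * by ring; unfold L in *; lra. }
  set (M' := Rabs E' + Rabs E + M).
  destruct (admissible_exists n c M' Hc) as [X Ha].
  pose proof (Rabs_pos E) as PE; pose proof (Rabs_pos E') as PE'.
  assert (B : box M' E s) by (unfold M'; split; lra).
  assert (B' : box M' E' s) by (unfold M'; split; lra).
  pose proof (chi_state n c M' X s E Ha B S) as St; pose proof (chi_state n c M' X s E' Ha B' S') as St'.
  rewrite <- Ee in St at 1; rewrite <- Ee' in St' at 1.
  pose proof (HF s e _ _ Hs ltac:(lra) St) as F1; pose proof (HF s e' _ _ Hs ltac:(lra) St') as F2.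
  assert (HkL : 4 * Rabs G < kap * L).
  { apply Rle_lt_trans with (kap * (4 * Rabs G / kap)); [right; field; lra|].
    apply Rmult_lt_compat_l; unfold L; lra. }
  assert (Hfin : forall x, L <= x -> (kap * x / 4) ^ 2 <= (e' ^ 4 - e ^ 4) ^ 2 -> False).
  { intros x Hx Hsq; rewrite Ee, Ee' in Hsq.
    assert (kap * L <= kap * x) by (apply Rmult_le_compat_l; lra).
    assert ((E' - E) ^ 2 < (kap * x / 4) ^ 2); [|lra].
    assert (0 < E' - E < kap * x / 4) by lra; nra. }
  destruct (parity_alternates n c M' X s E E' Ha (proj2 B) (proj1 B) (proj1 B') Hlt S S' Hgap)
    as [[K1 K2]|[K1 K2]].
  - apply (Hfin e' He').
    replace ((e' ^ 4 - e ^ 4) ^ 2) with ((e ^ 4 - e' ^ 4) ^ 2) by ring.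
    apply (even_odd_gap n c s e' e kap _ _ _ _ Hk ltac:(lra) (Hcomp e' e He' He ltac:(lra)) St' St K2 K1 F2 F1).
  - apply (Hfin e He).
    apply (even_odd_gap n c s e e' kap _ _ _ _ Hk ltac:(lra) (Hcomp e e' He He' ltac:(lra)) St St' K1 K2 F1 F2).
Qed.

(** * Continuity of the minimal gap *)

Definition gap_set (Lv : R -> Prop) (g : R) : Prop :=
  exists E E', Lv E /\ Lv E' /\ E < E' /\ (forall E'', Lv E'' -> ~ (E < E'' < E')) /\ g = E' - E.

Definition min_gap (Lv : R -> Prop) : R := real (Glb_Rbar (gap_set Lv)).

(** The infimum of the levels above [E] is attained because distinct levels stay [d] apart. It is
    taken as a supremum of negatives, the form in which completeness is stated. *)
Lemma next_level (Lv : R -> Prop) (E F d : R) :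
  0 < d -> (forall x y, E <= x <= F -> E <= y <= F -> Lv x -> Lv y -> Rabs (x - y) < d -> x = y) ->
  Lv E -> Lv F -> E < F ->
  exists E', Lv E' /\ E < E' <= F /\ forall x, Lv x -> ~ (E < x < E').
Proof.
  intros Hd Hsep SE SF HEF.
  destruct (completeness (fun y => exists x, Lv x /\ E < x <= F /\ y = - x)) as [g [Hub Hlub]].
  { exists (- E); intros y [x [_ [Hx ->]]]; lra. }
  { exists (- F), F; repeat split; trivial; lra. }
  destruct (classic (exists x, Lv x /\ E < x <= F /\ x < - g + d)) as [[x [Sx [Hx Hxg]]]|Hn].
  - exists x; split; [exact Sx|split; [exact Hx|]].
    intros y Sy Hy.
    assert (- y <= g) by (apply Hub; exists y; repeat split; trivial; lra).
    assert (y = x); [|lra].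
    apply Hsep; trivial; [lra|lra|rewrite Rabs_left; lra].
  - exfalso; assert (g <= g - d); [|lra].
    apply Hlub; intros y [x [Sx [Hx ->]]].
    destruct (Rle_dec (- x) (g - d)) as [k|k]; [exact k|exfalso].
    apply Hn; exists x; repeat split; trivial; lra.
Qed.

Lemma min_gap_glb (Lv : R -> Prop) :
  (exists g, gap_set Lv g) -> is_glb_Rbar (gap_set Lv) (min_gap Lv).
Proof.
  intros [g0 H0]; pose proof (Glb_Rbar_correct (gap_set Lv)) as H; unfold min_gap.
  destruct (Glb_Rbar (gap_set Lv)) as [l| |] eqn:E; [exact H|exfalso|exfalso].
  - exact (proj1 H g0 H0).
  - assert (Hl : Rbar_le 0 m_infty); [|exact Hl].
    apply H; intros g [x [y [_ [_ [Hxy [_ ->]]]]]]; simpl; lra.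
Qed.

Lemma le_min_gap (Lv : R -> Prop) (l : R) :
  (exists g, gap_set Lv g) -> (forall g, gap_set Lv g -> l <= g) -> l <= min_gap Lv.
Proof.
  intros Hex H; apply (proj2 (min_gap_glb Lv Hex) (Finite l)); intros g Hg; exact (H g Hg).
Qed.

(** The interface between the differential equation and the compactness argument. Local properties
    are joint in energy and scale, and global bounds are uniform on [0, M], so s = 0 is treated like
    any other scale. *)
Record stable_levels (Lv : R -> R -> Prop) : Prop := {
  levels_below : forall M, exists lo, forall s E, 0 <= s <= M -> Lv s E -> lo < E;
  levels_unique : forall E0 s0, 0 <= s0 -> exists eta, 0 < eta /\ forall s E1 E2,
    0 <= s -> Rabs (s - s0) < eta -> Rabs (E1 - E0) < eta -> Rabs (E2 - E0) < eta ->
    Lv s E1 -> Lv s E2 -> E1 = E2;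
  levels_closed : forall E0 s0, 0 <= s0 -> ~ Lv s0 E0 -> exists eta, 0 < eta /\ forall s E,
    0 <= s -> Rabs (s - s0) < eta -> Rabs (E - E0) < eta -> ~ Lv s E;
  levels_persist : forall E0 s0 eps, 0 <= s0 -> Lv s0 E0 -> 0 < eps -> exists eta, 0 < eta /\
    forall s, 0 <= s -> Rabs (s - s0) < eta -> exists E, Rabs (E - E0) < eps /\ Lv s E;
  levels_high_gap : forall M G, exists Emax, forall s E E', 0 <= s <= M -> Lv s E -> Lv s E' ->
    E < E' -> (forall t, E < t < E' -> ~ Lv s t) -> Emax <= E' -> G <= E' - E;
  levels_two : forall s, 0 <= s -> exists E E', E < E' /\ Lv s E /\ Lv s E' }.

(** A Lebesgue number for the neighbourhoods of [levels_unique]; halving the radii lets a point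
    within [d] of x share the neighbourhood of x. *)
Lemma levels_separated (Lv : R -> R -> Prop) (s a b : R) :
  stable_levels Lv -> 0 <= s ->
  exists d, 0 < d /\ forall x y, a <= x <= b -> Lv s x -> Lv s y -> Rabs (x - y) < d -> x = y.
Proof.
  intros HS Hs.
  assert (Hch : forall t, exists eta : posreal, forall E1 E2,
    Rabs (E1 - t) < eta -> Rabs (E2 - t) < eta -> Lv s E1 -> Lv s E2 -> E1 = E2).
  { intros t; destruct (levels_unique Lv HS t s Hs) as [eta [Heta H]]; exists (mkposreal eta Heta).
    intros E1 E2 H1 H2; apply H; trivial; rewrite Rminus_diag_eq, Rabs_R0 by reflexivity; exact Heta. }
  set (eta := fun t => proj1_sig (constructive_indefinite_description _ (Hch t))).
  assert (Heta : forall t E1 E2, Rabs (E1 - t) < eta t -> Rabs (E2 - t) < eta t ->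
    Lv s E1 -> Lv s E2 -> E1 = E2).
  { intros t; exact (proj2_sig (constructive_indefinite_description _ (Hch t))). }
  destruct (compactness_value_1d a b (fun t => pos_div_2 (eta t))) as [d Hd].
  exists d; split; [apply cond_pos|]; intros x y Hx Sx Sy Hxy.
  apply NNPP; intros Hne; apply (Hd x Hx); intros [t [_ [H1 H2]]]; apply Hne; simpl in H1, H2.
  pose proof (cond_pos (eta t)).
  apply (Heta t); trivial; [lra|].
  replace (y - t) with ((x - t) - (x - y)) by ring.
  pose proof (Rabs_triang (x - t) (- (x - y))) as T; rewrite Rabs_Ropp in T; unfold Rminus at 1; lra.
Qed.

Lemma gap_set_below (Lv : R -> R -> Prop) (s E F : R) :
  stable_levels Lv -> 0 <= s -> Lv s E -> Lv s F -> E < F ->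
  exists g, gap_set (Lv s) g /\ g <= F - E.
Proof.
  intros HS Hs SE SF HEF.
  destruct (levels_separated Lv s E F HS Hs) as [d [Hd Hsep]].
  destruct (next_level (Lv s) E F d Hd) as [E' [SE' [HE' Hn]]]; trivial.
  { intros x y Hx _ Sx Sy; now apply Hsep. }
  exists (E' - E); split; [|lra].
  exists E, E'; repeat split; trivial; lra.
Qed.

Lemma gap_set_inhabited (Lv : R -> R -> Prop) (s : R) :
  stable_levels Lv -> 0 <= s -> exists g, gap_set (Lv s) g.
Proof.
  intros HS Hs; destruct (levels_two Lv HS s Hs) as [E [E' [H [SE SE']]]].
  destruct (gap_set_below Lv s E E' HS Hs SE SE' H) as [g [Hg _]]; now exists g.
Qed.

Lemma min_gap_le (Lv : R -> R -> Prop) (s E F : R) :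
  stable_levels Lv -> 0 <= s -> Lv s E -> Lv s F -> E < F -> min_gap (Lv s) <= F - E.
Proof.
  intros HS Hs SE SF HEF; destruct (gap_set_below Lv s E F HS Hs SE SF HEF) as [g [Hg Hle]].
  apply Rle_trans with g; [|exact Hle].
  exact (proj1 (min_gap_glb (Lv s) (gap_set_inhabited Lv s HS Hs)) g Hg).
Qed.

(** High gaps are at least 1 by [levels_high_gap]; the others lie in a bounded window, where levels
    are separated. *)
Lemma min_gap_pos (Lv : R -> R -> Prop) (s : R) :
  stable_levels Lv -> 0 <= s -> 0 < min_gap (Lv s).
Proof.
  intros HS Hs.
  destruct (levels_below Lv HS s) as [lo Hlo].
  destruct (levels_high_gap Lv HS s 1) as [Emax HG].
  destruct (levels_separated Lv s lo Emax HS Hs) as [d [Hd Hsep]].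
  apply Rlt_le_trans with (Rmin 1 d); [apply Rmin_glb_lt; lra|].
  apply le_min_gap; [now apply gap_set_inhabited|].
  intros g [E [E' [SE [SE' [HEE [Hn ->]]]]]].
  pose proof (Rmin_l 1 d); pose proof (Rmin_r 1 d).
  destruct (Rle_dec Emax E') as [h|h].
  - assert (1 <= E' - E); [|lra].
    apply (HG s E E'); trivial; [lra|intros t Ht St; exact (Hn t St Ht)].
  - destruct (Rle_dec d (E' - E)) as [k|k]; [lra|exfalso].
    pose proof (Hlo s E ltac:(lra) SE).
    assert (E = E'); [|lra].
    apply Hsep; trivial; [lra|rewrite Rabs_left; lra].
Qed.

(** Both ends of a nearly minimal gap persist. New levels between them do no harm, since the
    distance of any two levels bounds the minimal gap from above. *)
Lemma min_gap_upper (Lv : R -> R -> Prop) (s0 eps : R) :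
  stable_levels Lv -> 0 <= s0 -> 0 < eps ->
  exists eta, 0 < eta /\ forall s, 0 <= s -> Rabs (s - s0) < eta ->
  min_gap (Lv s) <= min_gap (Lv s0) + eps.
Proof.
  intros HS Hs0 Heps.
  assert (Hg : exists g, gap_set (Lv s0) g /\ g < min_gap (Lv s0) + eps / 2).
  { apply NNPP; intros Hn.
    assert (min_gap (Lv s0) + eps / 2 <= min_gap (Lv s0)); [|lra].
    apply le_min_gap; [now apply gap_set_inhabited|]; intros g Hg.
    destruct (Rle_dec (min_gap (Lv s0) + eps / 2) g) as [k|k]; [exact k|exfalso].
    apply Hn; exists g; split; [exact Hg|lra]. }
  destruct Hg as [g [[E [E' [SE [SE' [HEE [_ ->]]]]]] Hlt]].
  set (h := Rmin (eps / 4) ((E' - E) / 2)).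
  assert (Hh : 0 < h) by (unfold h; apply Rmin_glb_lt; lra).
  assert (h <= eps / 4) by apply Rmin_l; assert (h <= (E' - E) / 2) by apply Rmin_r.
  destruct (levels_persist Lv HS E s0 h Hs0 SE Hh) as [e1 [He1 H1]].
  destruct (levels_persist Lv HS E' s0 h Hs0 SE' Hh) as [e2 [He2 H2]].
  exists (Rmin e1 e2); pose proof (Rmin_l e1 e2); pose proof (Rmin_r e1 e2).
  split; [now apply Rmin_glb_lt|]; intros s Hs Ns.
  destruct (H1 s Hs ltac:(lra)) as [F [HF SF]]; destruct (H2 s Hs ltac:(lra)) as [F' [HF' SF']].
  apply Rabs_def2 in HF; apply Rabs_def2 in HF'.
  pose proof (min_gap_le Lv s F F' HS Hs SF SF' ltac:(lra)); lra.
Qed.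

(** High gaps exceed the minimal gap at [s0] by the choice of [Emax]. All other pairs of levels lie
    in a compact square, and each of its points (u, v) has a harmless neighbourhood: no levels near
    a non-level, no two levels near u = v, and otherwise a distance close to that of two levels at
    [s0]. *)
Lemma min_gap_lower (Lv : R -> R -> Prop) (s0 eps : R) :
  stable_levels Lv -> 0 <= s0 -> 0 < eps ->
  exists eta, 0 < eta /\ forall s, 0 <= s -> Rabs (s - s0) < eta ->
  min_gap (Lv s0) - eps <= min_gap (Lv s).
Proof.
  intros HS Hs0 Heps.
  destruct (levels_below Lv HS (s0 + 1)) as [lo Hlo].
  destruct (levels_high_gap Lv HS (s0 + 1) (min_gap (Lv s0))) as [Emax HG].
  assert (Hch : forall u v, exists eta : posreal, forall s E1 E2, 0 <= s -> Rabs (s - s0) < eta ->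
    Rabs (E1 - u) < eta -> Rabs (E2 - v) < eta -> Lv s E1 -> Lv s E2 -> E1 < E2 ->
    min_gap (Lv s0) - eps <= E2 - E1).
  { intros u v.
    destruct (classic (Lv s0 u)) as [Su|Su].
    2:{ destruct (levels_closed Lv HS u s0 Hs0 Su) as [e [He H]]; exists (mkposreal e He).
        intros s E1 E2 Hs Ns N1 _ S1; exfalso; exact (H s E1 Hs Ns N1 S1). }
    destruct (classic (Lv s0 v)) as [Sv|Sv].
    2:{ destruct (levels_closed Lv HS v s0 Hs0 Sv) as [e [He H]]; exists (mkposreal e He).
        intros s E1 E2 Hs Ns _ N2 _ S2; exfalso; exact (H s E2 Hs Ns N2 S2). }
    destruct (Req_dec u v) as [<-|Huv].
    { destruct (levels_unique Lv HS u s0 Hs0) as [e [He H]]; exists (mkposreal e He).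
      intros s E1 E2 Hs Ns N1 N2 S1 S2 Hlt; simpl in *.
      specialize (H s E1 E2 Hs Ns N1 N2 S1 S2); lra. }
    assert (Hp : 0 < Rmin (eps / 2) (Rabs (u - v) / 2)).
    { apply Rmin_glb_lt; [lra|]; assert (0 < Rabs (u - v)) by (apply Rabs_pos_lt; lra); lra. }
    exists (mkposreal _ Hp); simpl; intros s E1 E2 Hs _ N1 N2 S1 S2 Hlt.
    pose proof (Rmin_l (eps / 2) (Rabs (u - v) / 2)); pose proof (Rmin_r (eps / 2) (Rabs (u - v) / 2)).
    apply Rabs_def2 in N1; apply Rabs_def2 in N2.
    destruct (Rlt_dec u v) as [k|k].
    - pose proof (min_gap_le Lv s0 u v HS Hs0 Su Sv k); lra.
    - rewrite (Rabs_pos_eq (u - v)) in * by lra; lra. }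
  (* Choosing first in v and then in u yields the gauge of two variables required by
     [compactness_value_2d]. *)
  assert (Hch2 : forall u, exists f : R -> posreal, forall v s E1 E2, 0 <= s -> Rabs (s - s0) < f v ->
    Rabs (E1 - u) < f v -> Rabs (E2 - v) < f v -> Lv s E1 -> Lv s E2 -> E1 < E2 ->
    min_gap (Lv s0) - eps <= E2 - E1).
  { intros u; exists (fun v => proj1_sig (constructive_indefinite_description _ (Hch u v))).
    intros v; exact (proj2_sig (constructive_indefinite_description _ (Hch u v))). }
  set (eta := fun u => proj1_sig (constructive_indefinite_description _ (Hch2 u))).
  assert (Heta : forall u v s E1 E2, 0 <= s -> Rabs (s - s0) < eta u v ->
    Rabs (E1 - u) < eta u v -> Rabs (E2 - v) < eta u v -> Lv s E1 -> Lv s E2 -> E1 < E2 ->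
    min_gap (Lv s0) - eps <= E2 - E1).
  { intros u; exact (proj2_sig (constructive_indefinite_description _ (Hch2 u))). }
  destruct (compactness_value_2d lo Emax lo Emax eta) as [d Hd].
  exists (Rmin 1 d); pose proof (Rmin_l 1 d); pose proof (Rmin_r 1 d).
  split; [apply Rmin_glb_lt; [lra|apply cond_pos]|]; intros s Hs Ns.
  apply le_min_gap; [now apply gap_set_inhabited|].
  intros g [E [E' [SE [SE' [HEE [Hn ->]]]]]].
  assert (HsM : 0 <= s <= s0 + 1) by (apply Rabs_def2 in Ns; lra).
  destruct (Rle_dec Emax E') as [h|h].
  - assert (min_gap (Lv s0) <= E' - E); [|lra].
    apply (HG s E E'); trivial; intros t Ht St; exact (Hn t St Ht).
  - pose proof (Hlo s E HsM SE).
    apply NNPP; intros Hne; apply (Hd E E'); [lra|lra|].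
    intros [u [v [_ [_ [N1 [N2 N3]]]]]]; apply Hne.
    apply (Heta u v s E E'); trivial; lra.
Qed.

Lemma spec_stable_levels (n : nat) (c : nat -> R) : 0 < c (S n) -> stable_levels (spec n c).
Proof.
  intros Hc; constructor.
  - intros M; now apply spec_lower_bound.
  - intros E0 s0; now apply spec_locally_unique.
  - intros E0 s0; now apply spec_closed.
  - intros E0 s0 eps Hs0 HS He; now apply spec_persists.
  - intros M G; now apply high_gap.
  - intros s; now apply two_levels.
Qed.

Lemma min_gap_continuous (n : nat) (c : nat -> R) (s0 eps : R) :
  0 < c (S n) -> 0 <= s0 -> 0 < eps ->
  exists eta, 0 < eta /\ forall s, 0 <= s -> Rabs (s - s0) < eta ->
  Rabs (min_gap (spec n c s) - min_gap (spec n c s0)) < eps.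
Proof.
  intros Hc Hs0 He; pose proof (spec_stable_levels n c Hc) as HS.
  destruct (min_gap_upper _ s0 (eps / 2) HS Hs0 ltac:(lra)) as [e1 [He1 H1]].
  destruct (min_gap_lower _ s0 (eps / 2) HS Hs0 ltac:(lra)) as [e2 [He2 H2]].
  exists (Rmin e1 e2); pose proof (Rmin_l e1 e2); pose proof (Rmin_r e1 e2).
  split; [now apply Rmin_glb_lt|]; intros s Hs Ns.
  specialize (H1 s Hs ltac:(lra)); specialize (H2 s Hs ltac:(lra)).
  apply Rabs_def1; lra.
Qed.

(** * Scaling in the mass *)

Lemma L2_line_scale (f : R -> R) (lam : R) : 0 < lam -> L2_line f -> L2_line (fun x => f (lam * x)).
Proof.
  intros Hl [l H]; exists (/ lam * l).
  assert (Hi : 0 < / lam) by now apply Rinv_0_lt_compat.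
  intros P [eps HP].
  assert (Hd : 0 < eps * lam) by (apply Rmult_lt_0_compat; [apply cond_pos|exact Hl]).
  destruct (H (fun y => ball l (eps * lam) y)) as [S1 S2 [M1 HM1] [M2 HM2] HS].
  { exists (mkposreal _ Hd); trivial. }
  apply (Filter_prod _ _ _ (fun a => a < M1 / lam) (fun b => M2 / lam < b)).
  - exists (M1 / lam); trivial.
  - exists (M2 / lam); trivial.
  - intros a b Ha Hb.
    destruct (HS (lam * a) (lam * b)) as [y [Hy1 Hy2]].
    + apply HM1; apply (Rmult_lt_compat_l lam) in Ha; [|exact Hl].
      replace (lam * (M1 / lam)) with M1 in Ha by (field; lra); exact Ha.
    + apply HM2; apply (Rmult_lt_compat_l lam) in Hb; [|exact Hl].
      replace (lam * (M2 / lam)) with M2 in Hb by (field; lra); exact Hb.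
    + exists (/ lam * y); split.
      * simpl in *; rewrite <- (Rplus_0_r (lam * a)), <- (Rplus_0_r (lam * b)) in Hy1.
        apply (is_RInt_comp_lin (fun x => f x ^ 2)), (is_RInt_scal _ _ _ (/ lam)) in Hy1.
        revert Hy1; apply is_RInt_ext; intros x _.
        unfold scal; simpl; unfold mult; simpl; rewrite Rplus_0_r; field; lra.
      * apply HP; change (Rabs (y - l) < eps * lam) in Hy2.
        change (Rabs (/ lam * y - / lam * l) < eps).
        replace (/ lam * y - / lam * l) with (/ lam * (y - l)) by ring.
        rewrite Rabs_mult, (Rabs_pos_eq (/ lam)) by lra.
        apply (Rmult_lt_compat_l (/ lam)) in Hy2; [|exact Hi].
        replace (/ lam * (eps * lam)) with (pos eps) in Hy2 by (field; lra); exact Hy2.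
Qed.

Lemma singular_scale (P : R -> R) (lam : R) :
  0 < lam -> singular P -> singular (fun y => lam ^ 2 * P (lam * y)).
Proof.
  intros Hl [u [du [[H1 H2] [[x Hx] HL]]]].
  exists (fun y => u (lam * y)), (fun y => lam * du (lam * y)); split; [split|split].
  - intros y; replace (lam * du (lam * y)) with (scal lam (du (lam * y))) by reflexivity.
    apply (is_derive_comp u (fun y => lam * y)); [apply H1|auto_derive; [exact I|ring]].
  - intros y.
    replace (lam ^ 2 * P (lam * y) * u (lam * y)) with (lam * scal lam (P (lam * y) * u (lam * y)))
      by (unfold scal; simpl; unfold mult; simpl; ring).
    apply is_derive_scal, (is_derive_comp du (fun y => lam * y)); [apply H2|auto_derive; [exact I|ring]].
  - exists (x / lam); replace (lam * (x / lam)) with x by (field; lra); exact Hx.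
  - now apply L2_line_scale.
Qed.

Lemma singular_ext (P P' : R -> R) : (forall x, P x = P' x) -> singular P -> singular P'.
Proof.
  intros E [u [du [[H1 H2] H]]]; exists u, du; split; [split|exact H].
  - exact H1.
  - intros x; rewrite <- E; apply H2.
Qed.

Definition merged_coeffs (a : R) (b : nat -> R) (k : nat) : R :=
  b (S k) + match k with O => a / 2 | _ => 0 end.

Lemma Wpot_U (n : nat) (a : R) (b : nat -> R) (q : R) :
  Wpot (n + 2) a b q = U n (merged_coeffs a b) 1 q.
Proof.
  unfold Wpot, Vpot, U; replace (n + 2 - 1)%nat with (S n) by lia.
  rewrite !(decomp_sum _ (S n)) by lia; simpl pred.
  replace (sum_f_R0 (fun i => merged_coeffs a b (S i) * 1 ^ (S n - S i) * q ^ (2 * S (S i))) n)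
    with (sum_f_R0 (fun i => b (S (S i)) * q ^ (2 * S (S i))) n).
  - unfold merged_coeffs; rewrite pow1; simpl; ring.
  - apply sum_eq; intros i _; unfold merged_coeffs; rewrite pow1; ring.
Qed.

Lemma eigenvalue_singular (r : nat) (a : R) (b : nat -> R) (m E : R) :
  0 < m -> is_eigenvalue r a b m E <-> singular (fun x => 2 * m * (Wpot r a b x - E)).
Proof.
  intros Hm; split.
  - intros [u [du [d2u [H1 [H2 [H3 [H4 H5]]]]]]].
    exists u, du; split; [split; [exact H1|]|split; [exact H3|exact H4]].
    intros x; replace (2 * m * (Wpot r a b x - E) * u x) with (d2u x); [apply H2|].
    specialize (H5 x).
    assert (H6 : (2 * m) * (- d2u x / (2 * m)) = - d2u x) by (field; lra).
    replace (- d2u x / (2 * m)) with (E * u x - Wpot r a b x * u x) in H6 by lra; lra.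
  - intros [u [du [[H1 H2] [H3 H4]]]].
    exists u, du, (fun x => 2 * m * (Wpot r a b x - E) * u x).
    refine (conj H1 (conj H2 (conj H3 (conj H4 _)))); intros x; field; lra.
Qed.

(* Substituting [x = y / sqrt s] with [m = s ^ (r + 1)]. *)
Lemma eigenvalue_iff_spec (n : nat) (a : R) (b : nat -> R) (s E : R) :
  0 < s ->
  is_eigenvalue (n + 2) a b (s ^ (n + 3)) E <-> spec n (merged_coeffs a b) s (s ^ (n + 2) * E).
Proof.
  intros Hs; rewrite eigenvalue_singular by (now apply pow_lt).
  set (lam := / sqrt s).
  assert (Hq : 0 < sqrt s) by now apply sqrt_lt_R0.
  assert (Hl : 0 < lam) by now apply Rinv_0_lt_compat.
  assert (Hl2 : lam ^ 2 = / s).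
  { unfold lam; rewrite pow_inv, <- Rsqr_pow2, Rsqr_sqrt by lra; reflexivity. }
  (* The substitution gives a term of degree 2k + 2 the factor s^(- (k + 1)); multiplied by s^r it
     becomes the power of s built into [U]. *)
  assert (HU : forall y, s ^ (n + 2) * U n (merged_coeffs a b) 1 (lam * y) = U n (merged_coeffs a b) s y).
  { intros y; unfold U; rewrite scal_sum; apply sum_eq; intros k Hk.
    rewrite pow1, Rpow_mult_distr, (pow_mult lam), Hl2.
    replace (s ^ (n + 2)) with (s ^ (S n - k) * s ^ S k) by (rewrite <- pow_add; f_equal; lia).
    rewrite pow_inv; field; apply pow_nonzero; lra. }
  assert (Hkey : forall y, lam ^ 2 * (2 * s ^ (n + 3) * (Wpot (n + 2) a b (lam * y) - E))
                 = Q n (merged_coeffs a b) (s ^ (n + 2) * E) s y).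
  { intros y; unfold Q; rewrite Wpot_U, <- HU, Hl2.
    replace (n + 3)%nat with (S (n + 2)) by lia; simpl; field; lra. }
  split; intros H.
  - apply (singular_scale _ lam Hl) in H; revert H; apply singular_ext; exact Hkey.
  - apply (singular_scale _ (/ lam) (Rinv_0_lt_compat _ Hl)) in H; revert H; apply singular_ext.
    intros x; rewrite <- Hkey.
    replace (lam * (/ lam * x)) with x by (field; lra); field; lra.
Qed.

Lemma min_gap_scale (Lv Lv' : R -> Prop) (k : R) :
  0 < k -> (forall E, Lv' E <-> Lv (k * E)) -> (exists g, gap_set Lv g) ->
  min_gap Lv' = / k * min_gap Lv.
Proof.
  intros Hk HS Hex.
  assert (Hi : 0 < / k) by now apply Rinv_0_lt_compat.
  assert (HS1 : forall E, Lv E -> Lv' (/ k * E)).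
  { intros E HE; apply HS; replace (k * (/ k * E)) with E by (field; lra); exact HE. }
  assert (Hg1 : forall g, gap_set Lv' g -> gap_set Lv (k * g)).
  { intros g [E [E' [H1 [H2 [H3 [H4 ->]]]]]]; exists (k * E), (k * E'); repeat split; try now apply HS.
    - now apply Rmult_lt_compat_l.
    - intros x Sx [Hx1 Hx2]; apply (H4 (/ k * x)); [now apply HS1|].
      split; apply Rmult_lt_reg_l with k; trivial;
        replace (k * (/ k * x)) with x by (field; lra); trivial.
    - ring. }
  assert (Hg2 : forall g, gap_set Lv g -> gap_set Lv' (/ k * g)).
  { intros g [E [E' [H1 [H2 [H3 [H4 ->]]]]]]; exists (/ k * E), (/ k * E'); repeat split; try now apply HS1.
    - now apply Rmult_lt_compat_l.
    - intros x Sx [Hx1 Hx2]; apply (H4 (k * x)); [now apply HS|].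
      split; apply Rmult_lt_reg_l with (/ k); trivial;
        replace (/ k * (k * x)) with x by (field; lra); trivial.
    - ring. }
  pose proof (min_gap_glb Lv Hex) as [L1 L2].
  assert (Hglb : is_glb_Rbar (gap_set Lv') (/ k * min_gap Lv)).
  { split.
    - intros g Hg; specialize (L1 _ (Hg1 g Hg)); simpl in *.
      apply Rmult_le_reg_l with k; [exact Hk|].
      replace (k * (/ k * min_gap Lv)) with (min_gap Lv) by (field; lra); exact L1.
    - intros l Hl; destruct Hex as [g0 Hg0].
      destruct l as [l| |]; [|exact (Hl _ (Hg2 g0 Hg0))|exact I].
      assert (H : Rbar_le (k * l) (min_gap Lv)).
      { apply L2; intros g Hg; specialize (Hl _ (Hg2 g Hg)); simpl in *.
        apply Rmult_le_reg_l with (/ k); [exact Hi|].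
        replace (/ k * (k * l)) with l by (field; lra); exact Hl. }
      simpl in *; apply Rmult_le_reg_l with k; [exact Hk|].
      replace (k * (/ k * min_gap Lv)) with (min_gap Lv) by (field; lra); exact H. }
  unfold min_gap at 1; rewrite (is_glb_Rbar_unique _ _ Hglb); reflexivity.
Qed.

Lemma gap_scaling (n : nat) (a : R) (b : nat -> R) (m : R) :
  0 < b (n + 2)%nat -> 0 < m ->
  gap (n + 2) a b m = Rpower m (- INR (n + 2) / (INR (n + 2) + 1))
    * min_gap (spec n (merged_coeffs a b) (Rpower m (/ (INR (n + 2) + 1)))).
Proof.
  intros Hb Hm; set (r := INR (n + 2)).
  assert (Hr : 0 <= r) by apply pos_INR.
  set (s := Rpower m (/ (r + 1))); assert (Hs : 0 < s) by apply exp_pos.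
  assert (Hc : 0 < merged_coeffs a b (S n)).
  { unfold merged_coeffs; replace (S (S n)) with (n + 2)%nat by lia; lra. }
  assert (E1 : s ^ (n + 3) = m).
  { rewrite <- Rpower_pow by exact Hs; unfold s; rewrite Rpower_mult.
    replace (n + 3)%nat with (S (n + 2)) by lia; rewrite S_INR; fold r.
    rewrite Rinv_l by lra; now apply Rpower_1. }
  assert (E2 : / s ^ (n + 2) = Rpower m (- r / (r + 1))).
  { rewrite <- Rpower_pow by exact Hs; fold r; unfold s; rewrite Rpower_mult, <- Rpower_Ropp.
    f_equal; field; lra. }
  rewrite <- E2, <- E1.
  apply (min_gap_scale (spec n (merged_coeffs a b) s) (is_eigenvalue (n + 2) a b (s ^ (n + 3)))).
  - now apply pow_lt.
  - intros E; now apply eigenvalue_iff_spec.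
  - apply gap_set_inhabited; [now apply spec_stable_levels|lra].
Qed.

Lemma Rpower_continuous (y m : R) : 0 < m -> continuous (fun m => Rpower m y) m.
Proof.
  intros Hm; apply (ex_derive_continuous (fun m => Rpower m y)).
  exists (y * Rpower m (y - 1)); apply is_derive_Reals; now apply derivable_pt_lim_power.
Qed.

Theorem theorem4p1 (r : nat) (a : R) (b : nat -> R) :
  (2 <= r)%nat -> 0 < a -> 0 < b r ->
  (forall m, 0 < m -> continuous (gap r a b) m) /\
  (forall m, 0 < m -> continuous (rigidity r a b) m) /\
  exists D0 : R, 0 < D0 /\
    filterlim (fun m => gap r a b m / (D0 * Rpower m (- INR r / (INR r + 1))))
      (at_right 0) (locally 1) /\
    filterlim (fun m => rigidity r a b m /
                        (D0 ^ 2 * Rpower m (- (INR r - 1) / (INR r + 1))))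
      (at_right 0) (locally 1).
Proof.
  intros Hr _ Hb; destruct (Nat.le_exists_sub 2 r Hr) as [n [-> _]].
  set (rr := INR (n + 2)).
  assert (Hrr : 0 <= rr) by apply pos_INR.
  set (c := merged_coeffs a b).
  assert (Hc : 0 < c (S n)).
  { unfold c, merged_coeffs; replace (S (S n)) with (n + 2)%nat by lia; lra. }
  set (delta := fun s => min_gap (spec n c s)).
  set (sg := fun m => Rpower m (/ (rr + 1))).
  assert (Hsg : forall m, 0 < sg m) by (intros; apply exp_pos).
  assert (Hgap : forall m, 0 < m ->
     gap (n + 2) a b m = Rpower m (- rr / (rr + 1)) * delta (sg m)).
  { intros m Hm; now apply gap_scaling. }
  assert (Cdelta : forall m, 0 < m -> continuous (fun m => delta (sg m)) m).
  { intros m Hm P [eps HP].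
    destruct (min_gap_continuous n c (sg m) eps Hc (Rlt_le _ _ (Hsg m)) (cond_pos eps))
      as [eta [Heta H]].
    destruct (Rpower_continuous (/ (rr + 1)) m Hm (fun y => Rabs (y - sg m) < eta)) as [d Hd].
    { exists (mkposreal eta Heta); trivial. }
    exists d; intros y Hy; apply HP, H; [apply Rlt_le, Hsg|exact (Hd y Hy)]. }
  assert (Cgap : forall m, 0 < m -> continuous (gap (n + 2) a b) m).
  { intros m Hm; apply (continuous_ext_loc (gap (n + 2) a b) (fun m => Rpower m (- rr / (rr + 1)) * delta (sg m))).
    - exists (mkposreal m Hm); intros y Hy; symmetry; apply Hgap.
      apply Rabs_def2 in Hy; simpl in Hy; unfold minus, plus, opp in Hy; simpl in Hy; lra.
    - apply (continuous_mult (fun m => Rpower m (- rr / (rr + 1))) (fun m => delta (sg m)));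
        [now apply Rpower_continuous|now apply Cdelta]. }
  split; [exact Cgap|split].
  { intros m Hm; unfold rigidity.
    apply (continuous_mult (fun m => m) (fun m => gap (n + 2) a b m ^ 2)); [apply continuous_id|].
    apply (continuous_comp (gap (n + 2) a b) (fun y => y ^ 2)); [now apply Cgap|].
    apply (ex_derive_continuous (fun y => y ^ 2)); auto_derive; exact I. }
  (* The constant Delta_0 is the minimal gap of the limiting operator - 1/2 d^2/dy^2 + b_r
     y^(2r). *)
  assert (HD0 : 0 < delta 0) by (apply min_gap_pos; [now apply spec_stable_levels|lra]).
  assert (Hlim : filterlim (fun m => gap (n + 2) a b m / (delta 0 * Rpower m (- rr / (rr + 1))))
                   (at_right 0) (locally 1)).
  { intros P [eps HP].
    assert (He : 0 < eps * delta 0) by (apply Rmult_lt_0_compat; [apply cond_pos|exact HD0]).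
    destruct (min_gap_continuous n c 0 _ Hc (Rle_refl 0) He) as [eta [Heta H]].
    (* As m = s^(r+1), the condition s < eta is m < eta^(r+1). *)
    exists (mkposreal (eta ^ (n + 3)) (pow_lt _ _ Heta)); intros m Hm Hm0.
    change (Rabs (m - 0) < eta ^ (n + 3)) in Hm; rewrite Rminus_0_r, Rabs_pos_eq in Hm by lra.
    apply HP; rewrite Hgap by exact Hm0.
    assert (Hsm : sg m < eta).
    { destruct (Rlt_dec (sg m) eta) as [h|h]; [exact h|exfalso].
      assert (eta ^ (n + 3) <= sg m ^ (n + 3)) by (apply pow_incr; lra).
      assert (sg m ^ (n + 3) = m); [|lra].
      rewrite <- Rpower_pow by apply Hsg; unfold sg; rewrite Rpower_mult.
      replace (n + 3)%nat with (S (n + 2)) by lia; rewrite S_INR; fold rr.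
      rewrite Rinv_l by lra; now apply Rpower_1. }
    specialize (H (sg m) (Rlt_le _ _ (Hsg m))).
    rewrite Rminus_0_r, Rabs_pos_eq in H by (apply Rlt_le, Hsg); specialize (H Hsm).
    pose proof (exp_pos (- rr / (rr + 1) * ln m)) as HR; fold (Rpower m (- rr / (rr + 1))) in HR.
    change (Rabs (Rpower m (- rr / (rr + 1)) * delta (sg m) / (delta 0 * Rpower m (- rr / (rr + 1))) - 1) < eps).
    replace (Rpower m (- rr / (rr + 1)) * delta (sg m) / (delta 0 * Rpower m (- rr / (rr + 1))) - 1)
      with ((delta (sg m) - delta 0) / delta 0) by (field; lra).
    unfold Rdiv; rewrite Rabs_mult, (Rabs_pos_eq (/ delta 0)) by (now apply Rlt_le, Rinv_0_lt_compat).
    apply Rmult_lt_reg_r with (delta 0); [exact HD0|].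
    rewrite Rmult_assoc, Rinv_l, Rmult_1_r by lra; exact H. }
  exists (delta 0); split; [exact HD0|split; [exact Hlim|]].
  (* The rigidity ratio is the square of the gap ratio, because 1 - 2r/(r+1) = - (r-1)/(r+1). *)
  apply (filterlim_ext_loc
    (fun m => (gap (n + 2) a b m / (delta 0 * Rpower m (- rr / (rr + 1)))) ^ 2)).
  - exists (mkposreal 1 Rlt_0_1); intros m _ Hm.
    pose proof (exp_pos (- rr / (rr + 1) * ln m)) as HR; fold (Rpower m (- rr / (rr + 1))) in HR.
    assert (E : Rpower m (- (rr - 1) / (rr + 1)) = m * Rpower m (- rr / (rr + 1)) ^ 2).
    { rewrite <- (Rpower_1 m Hm) at 2; rewrite <- (Rpower_pow 2) by exact HR.
      rewrite Rpower_mult, <- Rpower_plus; f_equal; simpl; field; lra. }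
    rewrite E; unfold rigidity; field; repeat split; lra.
  - apply (filterlim_comp _ _ _ (fun m => gap (n + 2) a b m / (delta 0 * Rpower m (- rr / (rr + 1))))
             (fun y => y ^ 2) (at_right 0) (locally 1)); [exact Hlim|].
    replace 1 with (1 ^ 2) at 2 by ring.
    apply (ex_derive_continuous (fun y => y ^ 2)); auto_derive; exact I.
Qed.
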